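(* Let $p$, $q$, $r$ be distinct primes with $p^2q^2<r$. Then every spectral set of the cyclic group $\mathbb{Z}_{p^2q^2r}$ is a tile. Consequently, $\mathbb{Z}_{p^2q^2r}$ is a Fuglede group.
   Context: For a finite abelian group $G$ (here cyclic, $\mathbb{Z}_n$, whose characters are $x\mapsto e^{2\pi i \lambda x/n}$, $\lambda\in\mathbb{Z}_n$), a nonempty set $S\subseteq G$ is spectral if there is a set $\Lambda$ of characters of $G$ whose restrictions to $S$ form an orthogonal basis of the space of complex functions on $S$ (then $|\Lambda|=|S|$ and $(S,\Lambda)$ is called a spectral pair). A set $S\subseteq G$ is a tile if there is $T\subseteq G$ such that every element of $G$ can be written uniquely as $s+t$ with $s\in S$, $t\in T$. A group $G$ is a Fuglede group if a subset of $G$ is spectral if and only if it is a tile. *)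

(* Defs.v *)
From HB Require Import structures.
From mathcomp Require Import all_boot all_order all_algebra all_field.
Set Implicit Arguments. Unset Strict Implicit. Unset Printing Implicit Defensive.
Import Order.TTheory GRing.Theory Num.Theory.
Local Open Scope ring_scope.

(* The cyclic group Z_n is modelled by 'Z_n (with n >= 2 in all uses).
   Complex numbers: algC.  omega n := exp(2 pi i / n):  n.-root (-1) is, by
   the algC convention (minimal nonnegative argument), exp(i pi / n), so its
   square is exp(2 pi i / n). *)
Definition omega (n : nat) : algC := (n.-root (-1)) ^+ 2.

Definition chr (n : nat) (l x : 'Z_n) : algC := omega n ^+ (nat_of_ord l * nat_of_ord x)%N.

Definition ipS (n : nat) (S : {set 'Z_n}) (f g : 'Z_n -> algC) : algC :=
  \sum_(s in S) f s * (g s)^*.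

Definition orth_basis_on (n : nat) (S L : {set 'Z_n}) : Prop :=
  [/\
      (forall l l', l \in L -> l' \in L -> l != l' -> ipS S (chr l) (chr l') = 0),
      (forall c : 'Z_n -> algC,
          (forall s, s \in S -> \sum_(l in L) c l * chr l s = 0) ->
          forall l, l \in L -> c l = 0)
    &
      (forall f : 'Z_n -> algC, exists c : 'Z_n -> algC,
          forall s, s \in S -> f s = \sum_(l in L) c l * chr l s)].

Definition spectral (n : nat) (S : {set 'Z_n}) : Prop :=
  S != set0 /\ exists L : {set 'Z_n}, orth_basis_on S L.

Definition tile (n : nat) (S : {set 'Z_n}) : Prop :=
  exists T : {set 'Z_n}, forall g : 'Z_n,
    exists! st : 'Z_n * 'Z_n, [/\ st.1 \in S, st.2 \in T & st.1 + st.2 = g].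

Definition fuglede_group (n : nat) : Prop :=
  forall S : {set 'Z_n}, S != set0 -> (spectral S <-> tile S).

(* Main.v *)
Require Import Defs.
From mathcomp Require Import all_boot all_order all_algebra all_field.
From mathcomp Require Import zify ring.
Set Implicit Arguments. Unset Strict Implicit. Unset Printing Implicit Defensive.
Import Order.TTheory GRing.Theory Num.Theory.

(** Write x in Z_N, N = p^2 q^2 r, by its base p digits modulo p^2, its base q digits
    modulo q^2 and its residue modulo r.  By Galois conjugation the Fourier transform of
    a set S at a character depends, as far as its vanishing is concerned, only on the
    order of the character, and (Ramanujan sums) it vanishes at order d exactly when
    the numbers of elements of S in the residue classes modulo divisors of d satisfy a
    linear relation.  Both being spectral and being a tile are shown to be equivalent
    to the Coven-Meyerowitz conditions (T1) and (T2).

    A spectral pair (S, L) splits into r layers, the classes modulo r.  If |S| < r, both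
    sets have an empty layer, so they project injectively onto a spectral pair of
    Z_(p^2 q^2).  If |S| >= r > p^2 q^2, all layers have the same size, and some layer
    of L consists of points that also occur in other layers; this layer is then a common
    spectrum of all the layers of S.  In Z_(p^2 q^2), the orders of the differences of
    L alone determine prime powers for which (T1) and (T2) hold for every S that has L
    as a spectrum; the proof is a case analysis on which prime powers occur as orders,
    based on the Lam-Leung description of vanishing sums for two primes.

    For tiles, r divides only one of |S|, |T|; Tijdeman's theorem allows replacing the
    other set by its multiple by r, which reduces (T2) to Z_(p^2 q^2). *)

(** * A primitive root of unity *)

(** The case analysis rests on one arithmetic mechanism. Vanishing at a prime power controls the
    mass of f on coarse classes; vanishing at a mixed order p^(a+1) q^(b+1) writes this mass as n
    (al p + be q). When the mass divided by n is p, q, p^2 with p < q, or q m with m < p, one of al,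
    be must be 0, so f consists of cosets of one kind and vanishes at a further prime power. The
    size |L| is squeezed between such divisibilities, applied to S, and injections of L into
    products of digits, whose failure would produce a difference of an excluded order.

    The obstacle is the large case: there duality is available for a single layer of S, whereas all
    layers must vanish at the same orders. Hence the conclusion in Z_(p^2 q^2) is stated for all
    multisets of the right size that vanish at the orders of differences of L. *)

Section OmegaPrimitive.
Local Open Scope ring_scope.

Lemma sum_unity (F : fieldType) (n : nat) (x : F) :
  x ^+ n = 1 -> \sum_(j < n) x ^+ j = if x == 1 then n%:R else 0.
Proof.
move=> xn1; case: eqP => [->|/eqP x1].
  under eq_bigr do rewrite expr1n.
  by rewrite sumr_const card_ord.
apply: (mulfI (x := x - 1)); first by rewrite subr_eq0.
by rewrite -subrX1 xn1 subrr mulr0.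
Qed.

Lemma norm_unity (x : algC) n : (0 < n)%N -> `|x ^+ n| = 1 -> `|x| = 1.
Proof. by move=> n0; rewrite normrX => /eqP; rewrite pexpr_eq1 // => /eqP. Qed.

Lemma dist1_sq (y : algC) : `|y| = 1 -> `|1 - y| ^+ 2 = 2 - 2 * 'Re y.
Proof.
move=> y1; have yy : y * y^* = 1 by rewrite -normCK y1 expr1n.
rewrite normCK rmorphB rmorph1 ReE /=.
rewrite mulrCA divff ?pnatr_eq0 // mulr1.
transitivity (1 - y - y^* + y * y^*); first by ring.
by rewrite yy; ring.
Qed.

(** [rootC_Re_max] compares with roots in the upper half plane; a root in the lower one is replaced
    by its conjugate, again a root of -1 with the same real part. *)
Lemma Re_root_max (n : nat) (y : algC) : (1 < n)%N -> y ^+ n = -1 ->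
  'Re y <= 'Re (n.-root (-1 : algC)).
Proof.
move=> n1 yn; have n0 : (0 < n)%N by lia.
have [im|im] := boolP (0 <= 'Im y); first exact: rootC_Re_max.
rewrite -Re_conj; apply: rootC_Re_max => //.
  by rewrite -rmorphXn yn rmorphN1.
rewrite Im_conj oppr_ge0; case/orP: (Creal_Im y) => // h.
by rewrite h in im.
Qed.

(* Every n-th root of -1 is at least as far from 1 as z = n.-root (-1).  If z^2
   had order n/k with k > 1, the k-th roots y of z would be n-th roots of -1, and
   1 - z = (1 - y)(1 + y + ... + y^(k-1)) would force |1 + ... + y^(k-1)| <= 1
   for all of them, whereas the squares of these k norms add up to k^2. *)
Lemma omega_prim n : (1 < n)%N -> n.-primitive_root (omega n).
Proof.
move=> n1; have n0 : (0 < n)%N by lia.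
rewrite /omega; set z := n.-root (-1).
have zn : z ^+ n = -1 by rewrite rootCK.
have N1 : (1 : algC) != -1 by rewrite eq_sym -subr_eq0 -opprD oppr_eq0 -[1 + 1]/(2%:R) pnatr_eq0.
have wn : (z ^+ 2) ^+ n = 1 by rewrite -exprM mulnC exprM zn sqrrN expr1n.
have [e we /dvdnP[k nE]] := prim_order_exists n0 wn.
have [k1|k1] := leqP k 1.
  have -> : n = e by case: k nE k1 => [|[|k]] //= nE _; lia.
  exact: we.
exfalso.
have e0 : (0 < e)%N by nia.
(* (z^e)^2 = (z^2)^e = 1, and z^e = 1 would give z^n = 1. Hence every k-th root of z is an n-th root
   of -1. *)
have ze : z ^+ e = -1.
  have : (z ^+ e) ^+ 2 == 1 by rewrite -exprM mulnC exprM (prim_expr_order we).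
  rewrite sqrf_eq1 => /orP[/eqP ze1|/eqP//].
  by move: zn N1; rewrite nE mulnC exprM ze1 expr1n => <-; rewrite eqxx.
have [x xk] := C_prim_root_exists (ltnW k1).
have x1 := prim_expr_order xk.
set y0 := k.-root z; have y0k : y0 ^+ k = z by rewrite rootCK //; lia.
pose y (j : 'I_k) := y0 * x ^+ j.
have yk j : y j ^+ k = z by rewrite exprMn y0k -exprM mulnC exprM x1 expr1n mulr1.
have yn j : y j ^+ n = -1 by rewrite nE exprM yk.
have nz : `|z| = 1 by apply: (@norm_unity _ n) => //; rewrite zn normrN1.
have ny j : `|y j| = 1 by apply: (@norm_unity _ n) => //; rewrite yn normrN1.
have z1 : 0 < `|1 - z|.
  rewrite normr_gt0 subr_eq0; apply/eqP => z1.
  by move: zn N1; rewrite -z1 expr1n => <-; rewrite eqxx.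
have sle j : `|\sum_(i < k) y j ^+ i| <= 1.
  have := subrX1 (y j) k; rewrite yk => /(congr1 Num.norm); rewrite normrM.
  rewrite distrC (distrC _ 1) => E.
  have le : `|1 - z| <= `|1 - y j|.
    rewrite -(ler_pXn2r (n := 2)) ?nnegrE ?normr_ge0 // !dist1_sq //.
    by rewrite lerB // ler_pM2l ?ltr0n // Re_root_max.
  rewrite -(ler_pM2l z1) mulr1 {2}E ler_wpM2r //.
have xx : x * x^* = 1.
  by rewrite -normCK (@norm_unity x k) ?expr1n ?x1 ?normr1 //; lia.
(* Parseval: for a <> b the terms are multiples of a full sum of powers of a k-th root of unity
   other than 1. *)
have S : \sum_(j < k) `|\sum_(i < k) y j ^+ i| ^+ 2 = (k * k)%:R.
  under eq_bigr => j _ do rewrite normCK rmorph_sum mulr_suml /=.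
  rewrite exchange_big /=.
  transitivity (\sum_(a < k) k%:R : algC); last by rewrite sumr_const card_ord mulrnA.
  apply: eq_bigr => a _.
  under eq_bigr => j _ do rewrite mulr_sumr.
  rewrite exchange_big (bigD1 a) //= [X in X + _](_ : _ = k%:R); last first.
    transitivity (\sum_(j < k) 1 : algC); last by rewrite sumr_const card_ord.
    apply: eq_bigr => j _; by rewrite rmorphXn /= -exprMn -normCK ny !expr1n.
  rewrite big1 ?addr0 // => b ba.
  have E (j : 'I_k) : y j ^+ a * (y j ^+ b)^* = y0 ^+ a * (y0 ^+ b)^* * (x ^+ a * (x^*) ^+ b) ^+ j.
    rewrite /y !(exprMn, rmorphM, rmorphXn) /= -!exprM.
    by rewrite (mulnC a j) (mulnC b j); ring.
  under eq_bigr => j _ do rewrite E.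
  rewrite -mulr_sumr sum_unity; last first.
    by rewrite exprMn -!exprM -!(mulnC k) !exprM -rmorphXn /= x1 rmorph1 !expr1n mul1r.
  case: eqP => [xab|]; last by rewrite mulr0.
  have : x ^+ a == x ^+ b.
    by rewrite -[x ^+ a]mulr1 -(expr1n _ b) -xx exprMn mulrCA xab mulr1.
  rewrite (eq_prim_root_expr xk) !modn_small // => /eqP/val_inj ab.
  by rewrite ab eqxx in ba.
have : \sum_(j < k) `|\sum_(i < k) y j ^+ i| ^+ 2 <= \sum_(j < k) 1 :> algC.
  by apply: ler_sum => j _; rewrite -[leRHS](expr1n _ 2) ler_pXn2r ?nnegrE.
rewrite S sumr_const card_ord ler_nat; nia.
Qed.

End OmegaPrimitive.

(** * Vanishing sums in Z_(p^2 q^2) *)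

Section Tree.
Variable A : finType.
Implicit Types x y : A * A.

(* A * A, with #|A| = p, stands for Z_(p^2) in base p, low digit first: eqv a is
   congruence modulo p ^ a, and ty x y = a when x - y has order p ^ a. *)
Definition eqv (a : nat) x y : bool :=
  match a with 0 => true | 1 => x.1 == y.1 | _ => x == y end.

Definition upd (a : nat) x (i : A) : A * A :=
  if a is 0 then (i, x.2) else (x.1, i).

Definition ty x y : nat := if x == y then 0 else if x.1 == y.1 then 1 else 2.

Lemma eqv_refl a x : eqv a x x.
Proof. by case: a => [|[|a]] /=. Qed.

Lemma eqv_sym a x y : eqv a x y = eqv a y x.
Proof. by case: a => [|[|a]] //=; rewrite eq_sym. Qed.

Lemma eqv_trans a x y z : eqv a x y -> eqv a y z -> eqv a x z.
Proof. by case: a => [|[|a]] //= /eqP-> /eqP->. Qed.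

Lemma eqv_ty a x y : a <= 2 -> eqv a x y = (ty x y <= 2 - a).
Proof.
rewrite /ty; case: a => [|[|[|a]]] //= _; first by case: ifP => // _; case: ifP.
  case: (x =P y) => [->|_]; first by rewrite eqxx.
  by case: ifP.
by case: ifP => // _; case: ifP.
Qed.

Lemma ty0 x y : (ty x y == 0) = (x == y).
Proof. by rewrite /ty; case: (x == y) => //; case: (x.1 == y.1). Qed.

Lemma ty_le2 x y : ty x y <= 2.
Proof. by rewrite /ty; case: (x == y) => //; case: (x.1 == y.1). Qed.

Lemma ty2 x y : x.1 != y.1 -> ty x y = 2.
Proof. by move=> n; rewrite /ty (negbTE n); case: (x =P y) n => // ->; rewrite eqxx. Qed.

Lemma ty1 x y : x.1 = y.1 -> x != y -> ty x y = 1.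
Proof. by move=> e n; rewrite /ty (negbTE n) e eqxx. Qed.

Definition coo (a : nat) x := if a is 0 then x.1 else x.2.

Lemma eqv_upd a x y i : a < 2 ->
  eqv a.+1 (upd a x i) y = eqv a x y && (coo a y == i).
Proof.
case: a => [|[|a]] //= _.
by case: y => y1 y2; rewrite xpair_eqE /= (eq_sym i).
Qed.

Lemma eqv_updl a x i y : a < 2 -> eqv a (upd a x i) y = eqv a x y.
Proof. by case: a => [|[|a]]. Qed.

Lemma eqvSP a x y : a < 2 -> eqv a x y -> eqv a.+1 (upd a x (coo a y)) y.
Proof. by move=> a2 xy; rewrite eqv_upd // xy eqxx. Qed.

End Tree.

Arguments eqv {A} a x y : simpl nomatch.

Section Marginals.
Variables A B : finType.
Notation X := ((A * A) * (B * B))%type.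
Notation p := #|A|.
Notation q := #|B|.
Implicit Types (f : X -> nat) (x y : X).

(* f is a multiset in Z_(p^2) x Z_(q^2).  The relation zer f a b says that its Fourier
   transform vanishes at the characters of order p ^ a * q ^ b: it is the Ramanujan sum
   relation divided by p ^ a.-1 * q ^ b.-1.  indp f a b (indq f a b) says that f modulo
   p ^ a.+1 * q ^ b (p ^ a * q ^ b.+1) is a union of cosets of order p (q). *)
Definition marg f (a b : nat) x : nat :=
  \sum_(y | eqv a x.1 y.1 && eqv b x.2 y.2) f y.

Definition zer f (a b : nat) : Prop := forall x,
  match a, b with
  | 0, 0 => marg f 0 0 x = 0
  | a'.+1, 0 => p * marg f a 0 x = marg f a' 0 x
  | 0, b'.+1 => q * marg f 0 b x = marg f 0 b' x
  | a'.+1, b'.+1 =>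
      p * q * marg f a b x + marg f a' b' x = q * marg f a' b x + p * marg f a b' x
  end.

Definition indp f (a b : nat) := forall x, p * marg f a.+1 b x = marg f a b x.
Definition indq f (a b : nat) := forall x, q * marg f a b.+1 x = marg f a b x.

Lemma marg00 f x : marg f 0 0 x = \sum_y f y.
Proof. by []. Qed.

Lemma marg_eqv f a b x y : eqv a x.1 y.1 -> eqv b x.2 y.2 -> marg f a b x = marg f a b y.
Proof.
move=> xy1 xy2; apply: eq_bigl => z; congr andb.
  apply/idP/idP; last exact: eqv_trans.
  by apply: eqv_trans; rewrite eqv_sym.
apply/idP/idP; last exact: eqv_trans.
by apply: eqv_trans; rewrite eqv_sym.
Qed.

Lemma marg_split_p f a b x : a < 2 ->
  marg f a b x = \sum_(i : A) marg f a.+1 b (upd a x.1 i, x.2).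
Proof.
move=> a2; rewrite /marg (partition_big (fun y : X => coo a y.1) predT) //=.
apply: eq_bigr => i _; apply: eq_bigl => y /=; rewrite eqv_upd //.
by rewrite -andbA [_ && (_ == i)]andbC andbA.
Qed.

Lemma marg_split_q f a b x : b < 2 ->
  marg f a b x = \sum_(i : B) marg f a b.+1 (x.1, upd b x.2 i).
Proof.
move=> b2; rewrite /marg (partition_big (fun y : X => coo b y.2) predT) //=.
by apply: eq_bigr => i _; apply: eq_bigl => y /=; rewrite eqv_upd // andbA.
Qed.

Lemma indq_pred f a b : a < 2 -> indq f a.+1 b -> indq f a b.
Proof.
move=> a2 h x; rewrite !(marg_split_p _ _ _ a2) big_distrr /=.
by apply: eq_bigr => i _; rewrite h.
Qed.

Lemma indp_pred f a b : b < 2 -> indp f a b.+1 -> indp f a b.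
Proof.
move=> b2 h x; rewrite !(marg_split_q _ _ _ b2) big_distrr /=.
by apply: eq_bigr => i _; rewrite h.
Qed.

Lemma indq_zerS f a b : a < 2 -> indq f a.+1 b -> zer f a.+1 b.+1.
Proof.
by move=> a2 h x; have := h x; have := indq_pred a2 h x; lia.
Qed.

Lemma indp_zerS f a b : b < 2 -> indp f a b.+1 -> zer f a.+1 b.+1.
Proof.
by move=> b2 h x; have := h x; have := indp_pred b2 h x; lia.
Qed.

(** Subtracting [indq f a b] from the relation of order p^(a+1) q^(b+1) leaves p times
    [indq f a.+1 b]. *)
Lemma zer_indq f a b : 0 < p -> zer f a.+1 b.+1 -> indq f a b -> indq f a.+1 b.
Proof.
move=> p0 z h x; have := h x; have := z x => /= E E'.
apply/eqP; rewrite -(eqn_pmul2l p0) mulnA -(eqn_add2r (marg f a b x)) E E'.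
by rewrite addnC.
Qed.

(** Additivity rebuilds g from its column [jm] and the increments of row [i0] over the entry at
    [jm]. Taking [jm] where this row is minimal keeps the increments nonnegative, so truncated
    subtraction is exact. *)
Lemma additive_split (I J : finType) (g : I -> J -> nat) (n : nat) (i0 : I) (j0 : J) :
  0 < n ->
  (forall i i' j j', g i j + g i' j' = g i j' + g i' j) ->
  (forall i j, n %| g i j) ->
  exists (be : I -> nat) (al : J -> nat), forall i j, g i j = n * (be i + al j).
Proof.
move=> n0 add dv; case: (arg_minnP (P := xpredT) (g i0) (isT : xpredT j0)) => jm _ jmin.
exists (fun i => g i jm %/ n), (fun j => (g i0 j - g i0 jm) %/ n) => i j.
rewrite mulnDr ![n * _]mulnC !divnK ?dvdn_sub //.
by have := add i i0 j jm; have := jmin j isT; lia.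
Qed.

(* In every class modulo p ^ a0 * q ^ b0, f modulo p ^ a.+1 * q ^ b.+1 consists of n * al
   cosets of order p and n * be cosets of order q. *)
Definition fibered f a b n a0 b0 := forall x, exists al be,
  [/\ marg f a0 b0 x = n * (al * p + be * q),
      al = 0 -> forall y, eqv a0 x.1 y.1 -> eqv b0 x.2 y.2 ->
        q * marg f a.+1 b.+1 y = marg f a.+1 b y &
      be = 0 -> forall y, eqv a0 x.1 y.1 -> eqv b0 x.2 y.2 ->
        p * marg f a.+1 b.+1 y = marg f a b.+1 y].

(** The counts of the p subclasses add up, and a zero sum of naturals has only zero terms. *)
Lemma fibered_p f a b n a0 b0 : a0 < 2 -> fibered f a b n a0.+1 b0 -> fibered f a b n a0 b0.
Proof.
move=> a2 h x.
have /fin_all_exists[al] : forall i : A, exists al, exists be, _ := fun i => h (upd a0 x.1 i, x.2).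
case/fin_all_exists => be H.
exists (\sum_i al i), (\sum_i be i); split.
- rewrite (marg_split_p _ _ _ a2) !big_distrl -big_split big_distrr /=.
  by apply: eq_bigr => i _; case: (H i).
- move/eqP; rewrite sum_nat_eq0 => /forallP al0 y xy1 xy2.
  case: (H (coo a0 y.1)) => _ h1 _; apply: h1 => //=.
    by apply/eqP; have := al0 (coo a0 y.1).
  exact: eqvSP.
- move/eqP; rewrite sum_nat_eq0 => /forallP al0 y xy1 xy2.
  case: (H (coo a0 y.1)) => _ _ h1; apply: h1 => //=.
    by apply/eqP; have := al0 (coo a0 y.1).
  exact: eqvSP.
Qed.

Lemma fibered_q f a b n a0 b0 : b0 < 2 -> fibered f a b n a0 b0.+1 -> fibered f a b n a0 b0.
Proof.
move=> b2 h x.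
have /fin_all_exists[al] : forall i : B, exists al, exists be, _ := fun i => h (x.1, upd b0 x.2 i).
case/fin_all_exists => be H.
exists (\sum_i al i), (\sum_i be i); split.
- rewrite (marg_split_q _ _ _ b2) !big_distrl -big_split big_distrr /=.
  by apply: eq_bigr => i _; case: (H i).
- move/eqP; rewrite sum_nat_eq0 => /forallP al0 y xy1 xy2.
  case: (H (coo b0 y.2)) => _ h1 _; apply: h1 => //=.
    by apply/eqP; have := al0 (coo b0 y.2).
  exact: eqvSP.
- move/eqP; rewrite sum_nat_eq0 => /forallP al0 y xy1 xy2.
  case: (H (coo b0 y.2)) => _ _ h1; apply: h1 => //=.
    by apply/eqP; have := al0 (coo b0 y.2).
  exact: eqvSP.
Qed.

(** On a coset of the subgroup of order p q the relation expresses p q g(i,j) as a function of i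
    plus a function of j, so the mixed differences of g vanish. *)
Lemma zer_additive f a b x : a < 2 -> b < 2 -> 0 < p -> 0 < q -> zer f a.+1 b.+1 ->
  let g i j := marg f a.+1 b.+1 (upd a x.1 i, upd b x.2 j) in
  forall i i' j j', g i j + g i' j' = g i j' + g i' j.
Proof.
move=> a2 b2 p0 q0 z g.
have gA i : marg f a.+1 b (upd a x.1 i, x.2) = \sum_j g i j by rewrite (marg_split_q _ _ _ b2).
have gB j : marg f a b.+1 (x.1, upd b x.2 j) = \sum_i g i j by rewrite (marg_split_p _ _ _ a2).
have zg i j : p * q * g i j + marg f a b x = q * \sum_k g k j + p * \sum_k g i k.
  rewrite -gA -gB.
  have := z (upd a x.1 i, upd b x.2 j) => /=.
  rewrite -/(g i j).
  have -> : marg f a b (upd a x.1 i, upd b x.2 j) = marg f a b x.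
    by apply: marg_eqv; rewrite /= eqv_updl // eqv_refl.
  have -> : marg f a b.+1 (upd a x.1 i, upd b x.2 j) = marg f a b.+1 (x.1, upd b x.2 j).
    by apply: marg_eqv; rewrite /= ?eqv_updl // eqv_refl.
  have -> : marg f a.+1 b (upd a x.1 i, upd b x.2 j) = marg f a.+1 b (upd a x.1 i, x.2).
    by apply: marg_eqv; rewrite /= ?eqv_updl // eqv_refl.
  by [].
have pq0 : 0 < p * q by rewrite muln_gt0 p0.
move=> i i' j j'; apply/eqP; rewrite -(eqn_pmul2l pq0) !mulnDr; apply/eqP.
by have := zg i j; have := zg i' j'; have := zg i j'; have := zg i' j; lia.
Qed.

(* Lam-Leung for two primes: on a coset of the subgroup of order p * q a vanishing
   non-negative function is a sum of al p-cosets and be q-cosets. *)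
Lemma fibered_coset f a b n : a < 2 -> b < 2 -> 0 < n -> 0 < p -> 0 < q ->
  (forall x, n %| marg f a.+1 b.+1 x) ->
  zer f a.+1 b.+1 -> fibered f a b n a b.
Proof.
move=> a2 b2 n0 p0 q0 dv z x.
pose g (i : A) (j : B) := marg f a.+1 b.+1 (upd a x.1 i, upd b x.2 j).
have gA i : marg f a.+1 b (upd a x.1 i, x.2) = \sum_j g i j by rewrite (marg_split_q _ _ _ b2).
have gB j : marg f a b.+1 (x.1, upd b x.2 j) = \sum_i g i j by rewrite (marg_split_p _ _ _ a2).
have add : forall i i' j j', g i j + g i' j' = g i j' + g i' j := zer_additive x a2 b2 p0 q0 z.
have [i0 _] := card_gt0P p0; have [j0 _] := card_gt0P q0.
have [be [al gE]] : exists (be : A -> nat) (al : B -> nat), forall i j, g i j = n * (be i + al j).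
  by apply: (additive_split i0 j0 n0 add) => i j; apply: dv.
have gx y : eqv a x.1 y.1 -> eqv b x.2 y.2 -> marg f a.+1 b.+1 y = g (coo a y.1) (coo b y.2).
  by move=> xy1 xy2; apply: marg_eqv; rewrite eqv_sym; apply: eqvSP.
(* [al j] is the multiplicity of the p-coset in column j, [be i] that of the q-coset in row i, both
   in units of n. *)
exists (\sum_j al j), (\sum_i be i); split.
- rewrite (marg_split_p _ _ _ a2); under eq_bigr => i _ do rewrite gA.
  under eq_bigr => i _ do under eq_bigr => j _ do rewrite gE mulnDr.
  under eq_bigr => i _ do rewrite big_split sum_nat_const -big_distrr /=.
  rewrite big_split sum_nat_const -big_distrr /= -big_distrr /= -/p -/q.
  by nia.
- move/eqP; rewrite sum_nat_eq0 => /forallP al0 y xy1 xy2.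
  have E j : al j = 0 by apply/eqP; have := al0 j.
  rewrite gx // -[marg f a.+1 b y](_ : marg f a.+1 b (upd a x.1 (coo a y.1), x.2) = _).
    by rewrite gA; under eq_bigr => j _ do rewrite gE E; rewrite sum_nat_const gE E.
  by apply: marg_eqv => //=; apply: eqvSP.
- move/eqP; rewrite sum_nat_eq0 => /forallP al0 y xy1 xy2.
  have E j : be j = 0 by apply/eqP; have := al0 j.
  rewrite gx // -[marg f a b.+1 y](_ : marg f a b.+1 (x.1, upd b x.2 (coo b y.2)) = _).
    by rewrite gB; under eq_bigr => j _ do rewrite gE E; rewrite sum_nat_const gE E.
  by apply: marg_eqv => //=; apply: eqvSP.
Qed.

Lemma fibered_zer f a b n a0 b0 : a < 2 -> b < 2 -> 0 < n -> 0 < p -> 0 < q ->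
  (forall x, n %| marg f a.+1 b.+1 x) -> zer f a.+1 b.+1 ->
  a0 <= a -> b0 <= b -> fibered f a b n a0 b0.
Proof.
move=> a2 b2 n0 p0 q0 dv z; have d := fibered_coset a2 b2 n0 p0 q0 dv z.
case: a b d a0 b0 {dv z} a2 b2 => [|[|a]] [|[|b]] d [|[|a0]] [|[|b0]] //= _ _ _ _.
- exact: fibered_q.
- exact: fibered_p.
- by apply: fibered_p => //; apply: fibered_q.
- exact: fibered_p.
- exact: fibered_q.
Qed.

(** The form in which [fibered] is applied: the masses of the classes leave no room for q-cosets, so
    only p-cosets remain. *)
Lemma fibered_indp f a b n a0 b0 : fibered f a b n a0 b0 ->
  (forall x al be, marg f a0 b0 x = n * (al * p + be * q) -> be = 0) -> indp f a b.+1.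
Proof.
move=> d h x; have [al [be [e _ h0]]] := d x.
by apply: h0 (h _ _ _ e) _ _ _; apply: eqv_refl.
Qed.

Lemma fibered_indq f a b n a0 b0 : fibered f a b n a0 b0 ->
  (forall x al be, marg f a0 b0 x = n * (al * p + be * q) -> al = 0) -> indq f a.+1 b.
Proof.
move=> d h x; have [al [be [e h0 _]]] := d x.
by apply: h0 (h _ _ _ e) _ _ _; apply: eqv_refl.
Qed.

(** Equidistribution over p-cosets passes to coarser levels of q. The case c = 0 is how mixed orders
    yield vanishing at powers of p. *)
Lemma indp_zer f a b c : indp f a b -> c <= b -> b <= 2 -> zer f a.+1 c.
Proof.
move=> h cb b2.
have {cb b2} [h' c2] : indp f a c /\ c <= 2.
  elim: b h cb b2 => [|b IH] h; first by rewrite leqn0 => /eqP->.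
  rewrite leq_eqVlt => /orP[/eqP-> //|cb] b2.
  by apply: IH (indp_pred _ h) _ _; lia.
by case: c h' c2 => [|c] h' c2 //; apply: indp_zerS.
Qed.

Lemma indq_zer f a b c : indq f a b -> c <= a -> a <= 2 -> zer f c b.+1.
Proof.
move=> h cb b2.
have {cb b2} [h' c2] : indq f c b /\ c <= 2.
  elim: a h cb b2 => [|a IH] h; first by rewrite leqn0 => /eqP->.
  rewrite leq_eqVlt => /orP[/eqP-> //|cb] b2.
  by apply: IH (indq_pred _ h) _ _; lia.
by case: c h' c2 => [|c] h' c2 //; apply: indq_zerS.
Qed.

End Marginals.

Definition sel (b1 b2 : bool) (a : nat) : bool :=
  match a with 0 => true | 1 => b1 | _ => b2 end.

(** * Spectral pairs in Z_(p^2 q^2) *)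

Section TypedSets.
Variable B : finType.
Notation q := #|B|.
Implicit Types (Y : {set B * B}) (y : B * B).

Definition typed (b1 b2 : bool) Y :=
  forall y y', y \in Y -> y' \in Y -> sel b1 b2 (ty y y').

Lemma typed1_const Y y y' : typed true false Y -> y \in Y -> y' \in Y -> y.1 = y'.1.
Proof.
move=> h yY y'Y; have := h _ _ yY y'Y; rewrite /ty.
by case: eqP => [->|_] //; case: eqP.
Qed.

Lemma typed2_inj Y : typed false true Y -> {in Y &, injective (fun y => y.1)}.
Proof.
move=> h y y' yY y'Y /= e; have := h _ _ yY y'Y; rewrite /ty e eqxx.
by case: eqP.
Qed.

Lemma typed1_inj Y : typed true false Y -> {in Y &, injective (fun y => y.2)}.
Proof.
move=> h y y' yY y'Y /= e; have := typed1_const h yY y'Y.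
by case: y e {yY} => a b; case: y' {y'Y} => c d /= -> ->.
Qed.

(** If only order q occurs, the set lies in one class modulo q and the second digit separates it; if
    only q^2 occurs, the first digit does. *)
Lemma typed_bound b1 b2 Y : typed b1 b2 Y -> #|Y| <= q ^ (b1 + b2).
Proof.
case: b1; case: b2 => h.
- by rewrite -[q ^ _]/(q ^ 2) -mulnn -card_prod max_card.
- by rewrite -[q ^ _]/q -(card_in_imset (typed1_inj h)) max_card.
- by rewrite -[q ^ _]/q -(card_in_imset (typed2_inj h)) max_card.
- rewrite expn0; apply/card_le1_eqP => y y' yY y'Y; apply/eqP.
  by rewrite -ty0; have := h _ _ y'Y yY; case: (ty y' y) => [|[|]].
Qed.

Lemma typed_full Y y t : typed true false Y -> #|Y| = q -> y \in Y -> (y.1, t) \in Y.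
Proof.
move=> h Yq yY.
have : (fun y : B * B => y.2) @: Y == [set: B].
  by rewrite eqEcard subsetT cardsT (card_in_imset (typed1_inj h)) Yq leqnn.
move/eqP/setP/(_ t); rewrite inE => /imsetP[y' y'Y ->].
by rewrite (typed1_const h yY y'Y) -surjective_pairing.
Qed.

Lemma typed_transversal Y v : typed false true Y -> #|Y| = q -> exists2 y, y \in Y & y.1 = v.
Proof.
move=> h Yq.
have : (fun y : B * B => y.1) @: Y == [set: B].
  by rewrite eqEcard subsetT cardsT (card_in_imset (typed2_inj h)) Yq leqnn.
by move/eqP/setP/(_ v); rewrite inE => /imsetP[y' y'Y ->]; exists y'.
Qed.

Lemma other_elt (v : B) : 1 < q -> exists v', v' != v.
Proof.
move=> q1; have /card_gt0P[v' h] : 0 < #|predC1 v| by rewrite cardC1; lia.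
by exists v'.
Qed.

Lemma typed_hit2 b1 Y y : 1 < q -> typed b1 true Y -> #|Y| = q ^ (b1 + 1) ->
  exists2 y', y' \in Y & ty y y' = 2.
Proof.
move=> q1; have [v' vv'] := other_elt y.1 q1.
have ty2 y' : y'.1 = v' -> ty y y' = 2.
  move=> e; rewrite /ty e (eq_sym _ v') (negbTE vv').
  by case: eqP => // ye; move: vv'; rewrite ye e eqxx.
case: b1 => h Yq.
  have : Y == [set: B * B] by rewrite eqEcard subsetT cardsT card_prod Yq -[q ^ _]/(q ^ 2) mulnn leqnn.
  by move/eqP=> YT; exists (v', v'); rewrite ?YT ?inE // ty2.
have [y' y'Y e] := typed_transversal v' h Yq.
by exists y' => //; apply: ty2.
Qed.

Lemma typed_hit b1 b2 b Y y : 1 < q -> typed b1 b2 Y -> #|Y| = q ^ (b1 + b2) -> y \in Y ->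
  b <= 2 -> sel b1 b2 b -> exists2 y', y' \in Y & ty y y' = b.
Proof.
move=> q1 h Yq yY; case: b => [|[|[|b]]] //= _.
- by exists y => //; apply/eqP; rewrite ty0.
- move=> b1T; rewrite {}b1T in h Yq.
  have [t ty2] := other_elt y.2 q1.
  have yt : ty y (y.1, t) = 1.
    rewrite /ty eqxx; case: (y =P (y.1, t)) => // e.
    by move: ty2; rewrite (congr1 snd e) /= eqxx.
  exists (y.1, t) => //.
  case: b2 h Yq => h Yq; last exact: typed_full.
  have : Y == [set: B * B] by rewrite eqEcard subsetT cardsT card_prod Yq -[q ^ _]/(q ^ 2) mulnn leqnn.
  by move/eqP->; rewrite inE.
- by move=> b2T; rewrite {}b2T in h Yq; apply: typed_hit2 q1 h Yq.
Qed.

End TypedSets.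

(** * Exchange of p and q, orders of differences, spectral pairs *)

Section Swap.
Variables A B : finType.

Definition sw (x : (A * A) * (B * B)) : (B * B) * (A * A) := (x.2, x.1).

End Swap.

Lemma swK (A B : finType) : cancel (@sw A B) (@sw B A).
Proof. by case. Qed.

Lemma sw_inj (A B : finType) : injective (@sw A B).
Proof. exact: can_inj (@swK A B). Qed.

Section Pairs.
Variables A B : finType.
Notation X := ((A * A) * (B * B))%type.
Notation p := #|A|.
Notation q := #|B|.
Implicit Types (f : X -> nat) (x y : X) (L S : {set X}).

(** Records which orders p^a q^b occur among the differences of L; boolean, so that its values can
    serve as exponents in the sizes below. *)
Definition difft L a b : bool :=
  [exists x, exists y, [&& x \in L, y \in L, ty x.1 y.1 == a & ty x.2 y.2 == b]].

Lemma difftP L a b : reflect (exists x y, [/\ x \in L, y \in L, ty x.1 y.1 = a & ty x.2 y.2 = b]) (difft L a b).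
Proof.
apply: (iffP existsP) => [[x /existsP[y /and4P[xL yL /eqP ea /eqP eb]]]|[x [y [xL yL ea eb]]]].
  by exists x, y.
by exists x; apply/existsP; exists y; rewrite xL yL ea eb !eqxx.
Qed.

Lemma difft_mem L x y : x \in L -> y \in L -> difft L (ty x.1 y.1) (ty x.2 y.2).
Proof. by move=> xL yL; apply/difftP; exists x, y. Qed.

Definition ind S x : nat := x \in S.

(** For f = [ind S] this is the orthogonality on S of the characters in L; 0 < a + b leaves out the
    trivial character. *)
Definition zerD L f := forall a b, 0 < a + b -> difft L a b -> zer f a b.

Definition spectral_pair S L :=
  [/\ #|S| = #|L|, 0 < #|L|, zerD L (ind S) & zerD S (ind L)].

(* The exponents P1, ..., Q2 depend on L and k only, not on f: all the layers of a
   spectral set then satisfy (T1) and (T2) for the same prime powers. *)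
Definition good L k := exists P1 P2 Q1 Q2 : bool,
  k = p ^ (P1 + P2) * q ^ (Q1 + Q2) /\
  forall f, \sum_x f x = k -> zerD L f ->
  forall a b, a <= 2 -> b <= 2 -> 0 < a + b -> sel P1 P2 a -> sel Q1 Q2 b -> zer f a b.

Lemma sum_ind S : \sum_x ind S x = #|S|.
Proof. by rewrite -sum1_card [RHS]big_mkcond; apply: eq_bigr => x _; rewrite /ind; case: (x \in S). Qed.

Lemma dvd_zer10 f : zer f 1 0 -> p %| \sum_x f x.
Proof.
move=> z; have [x _|x0] := pickP (@predT X); last by rewrite big1 // => x; have := x0 x.
by rewrite -(marg00 f x) -z dvdn_mulr.
Qed.

Lemma dvd_zer20 f : zer f 2 0 -> p %| \sum_x f x.
Proof.
move=> z; have [x _|x0] := pickP (@predT X); last by rewrite big1 // => x; have := x0 x.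
rewrite -(marg00 f x) marg_split_p //; apply: dvdn_sum => i _.
by rewrite -z dvdn_mulr.
Qed.

Lemma dvd_zer1020 f : zer f 1 0 -> zer f 2 0 -> p ^ 2 %| \sum_x f x.
Proof.
move=> z z'; have [x _|x0] := pickP (@predT X); last by rewrite big1 // => x; have := x0 x.
by rewrite -(marg00 f x) -z -z' mulnA dvdn_mulr.
Qed.

Lemma dvdp_zerD f L : zerD L f -> p ^ (difft L 1 0 + difft L 2 0) %| \sum_x f x.
Proof.
move=> z; case: (boolP (difft L 1 0)) => w1; case: (boolP (difft L 2 0)) => w2 //=.
- by apply: dvd_zer1020; apply: z.
- by apply: dvd_zer10; apply: z.
- by apply: dvd_zer20; apply: z.
Qed.

Lemma fib_typed L a : typed (difft L 0 1) (difft L 0 2) [set y | (a, y) \in L].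
Proof.
move=> y y'; rewrite !inE => h h'; have := difft_mem h h'; rewrite /= {1}/ty eqxx.
by rewrite /sel; have := ty_le2 y y'; case: (ty y y') => [|[|[|]]].
Qed.

Lemma card_fib L : #|L| = \sum_a #|[set y | (a, y) \in L]|.
Proof.
rewrite -sum1_card (partition_big (fun x : X => x.1) predT) //=.
apply: eq_bigr => a _; rewrite sum1dep_card.
have ai : injective (fun y : B * B => (a, y)) by move=> y y' [].
rewrite -(card_imset _ ai); congr #|pred_of_set _|; apply/setP => -[x y].
rewrite inE /=; apply/andP/imsetP => [[xL /eqP e]|[y' ]].
  by exists y; rewrite ?inE -?e.
by rewrite inE => yL [-> ->].
Qed.

(** Differences inside a fibre over Z_(p^2) have order a power of q, so [typed_bound] applies to
    each of the p^2 fibres. *)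
Lemma card_le_fib L : #|L| <= p ^ 2 * q ^ (difft L 0 1 + difft L 0 2).
Proof.
rewrite card_fib -mulnn -card_prod -sum_nat_const.
by apply: leq_sum => a _; apply: typed_bound; apply: fib_typed.
Qed.

Lemma fib_full L : #|L| = p ^ 2 * q ^ (difft L 0 1 + difft L 0 2) ->
  forall a, #|[set y | (a, y) \in L]| = q ^ (difft L 0 1 + difft L 0 2).
Proof.
move=> h a; set m := q ^ _.
have le a' : #|[set y | (a', y) \in L]| <= m by apply: typed_bound; apply: fib_typed.
apply/eqP; rewrite eqn_leq le /= leqNgt; apply/negP => lt.
have : #|L| < p ^ 2 * m.
  rewrite card_fib -mulnn -card_prod -sum_nat_const.
  rewrite (bigD1 a) //= [ltnRHS](bigD1 a) //= -addSn leq_add //.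
  by apply: leq_sum.
by rewrite h ltnn.
Qed.

End Pairs.

Section SwapPairs.
Variables A B : finType.
Notation X := ((A * A) * (B * B))%type.
Implicit Types (f : X -> nat) (L S : {set X}).

Definition fsw f : (B * B) * (A * A) -> nat := fun x => f (sw x).

Lemma marg_sw f a b x : marg (fsw f) b a (sw x) = marg f a b x.
Proof.
rewrite /marg (reindex (@sw A B)) /=; last by exists (@sw B A) => z _; rewrite swK.
apply: eq_big => [y|y _]; first by rewrite andbC.
by rewrite /fsw swK.
Qed.

Lemma zer_sw f a b : zer (fsw f) b a <-> zer f a b.
Proof.
split=> z x.
  have := z (sw x); case: a b {z} => [|a] [|b]; rewrite !marg_sw => //.
  by rewrite (mulnC #|B|) addnC [in RHS]addnC addnC => ->; rewrite addnC.
rewrite -[x]swK; have := z (sw x); case: a b {z} => [|a] [|b]; rewrite !marg_sw => //.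
by rewrite (mulnC #|A|) => ->; rewrite addnC.
Qed.

Lemma difft_sw L a b : difft [set sw x | x in L] b a = difft L a b.
Proof.
apply/difftP/difftP => [[_ [_ [/imsetP[x xL ->] /imsetP[y yL ->] e1 e2]]]|[x [y [xL yL e1 e2]]]].
  by exists x, y.
by exists (sw x), (sw y); split; rewrite ?imset_f.
Qed.

Lemma ind_sw S x : ind [set sw y | y in S] x = fsw (ind S) x.
Proof. by rewrite /ind /fsw -{1}[x]swK mem_imset //; apply: sw_inj. Qed.

Lemma eq_zer f g a b : f =1 g -> zer f a b -> zer g a b.
Proof.
move=> fg z x; have E c d y : marg g c d y = marg f c d y by apply: eq_bigr => i _; rewrite fg.
by have := z x; case: a {z} => [|a]; case: b => [|b]; rewrite !E.
Qed.

Lemma zerD_sw L f : zerD L f -> zerD [set sw x | x in L] (fsw f).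
Proof. by move=> z a b ab; rewrite difft_sw => w; apply/zer_sw/z => //; rewrite addnC. Qed.

End SwapPairs.

Lemma spectral_pair_sw (A B : finType) (S L : {set (A * A) * (B * B)}) :
  spectral_pair S L -> spectral_pair [set sw x | x in S] [set sw x | x in L].
Proof.
case=> e0 e1 e2 e3; split; rewrite ?card_imset //; try exact: sw_inj.
- by move=> a b ab w; apply: eq_zer (fun x => esym (ind_sw S x)) _; apply: zerD_sw e2 _ _ ab w.
- by move=> a b ab w; apply: eq_zer (fun x => esym (ind_sw L x)) _; apply: zerD_sw e3 _ _ ab w.
Qed.

Lemma sum_fsw (A B : finType) (f : (A * A) * (B * B) -> nat) : \sum_x fsw f x = \sum_x f x.
Proof. by rewrite [RHS](reindex (@sw B A)) //; exists (@sw A B) => z _; rewrite swK. Qed.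

Lemma good_sw (A B : finType) (L : {set (A * A) * (B * B)}) k :
  good [set sw x | x in L] k -> good L k.
Proof.
case=> P1 [P2 [Q1 [Q2 [e h]]]]; exists Q1, Q2, P1, P2; split; first by rewrite mulnC.
move=> f fk z a b a2 b2 ab sa sb; apply/zer_sw; apply: h => //; rewrite ?sum_fsw //.
  exact: zerD_sw.
by rewrite addnC.
Qed.

(** * Representations of a number as al p + be q *)

Section Arith.
Variables p q : nat.
Hypotheses (p_pr : prime p) (q_pr : prime q) (pq : p != q).

Lemma coprime_pq : coprime p q.
Proof. by rewrite prime_coprime // dvdn_prime2. Qed.

Lemma rep_p al be : p = al * p + be * q -> be = 0.
Proof.
move=> e; have : p %| be * q by rewrite -(dvdn_addr _ (dvdn_mull al (dvdnn p))) -e.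
rewrite Gauss_dvdl ?coprime_pq // => /dvdnP[c bE]; move: e.
have := prime_gt1 p_pr; have := prime_gt1 q_pr; rewrite bE.
by case: c {bE} => // c; nia.
Qed.

Lemma rep_q al be : q = al * p + be * q -> al = 0.
Proof.
move=> e; have : q %| al * p by rewrite -(dvdn_addl _ (dvdn_mull be (dvdnn q))) -e.
rewrite Gauss_dvdl; last by rewrite coprime_sym coprime_pq.
move=> /dvdnP[c bE]; move: e.
have := prime_gt1 p_pr; have := prime_gt1 q_pr; rewrite bE.
by case: c {bE} => // c; nia.
Qed.

(** p divides be, and a nonzero be would make be q at least p q, which exceeds p^2 because p < q. *)
Lemma rep_pp al be : p < q -> p ^ 2 = al * p + be * q -> be = 0.
Proof.
move=> lt e; have : p %| be * q.
  by rewrite -(dvdn_addr _ (dvdn_mull al (dvdnn p))) -e dvdn_exp.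
rewrite Gauss_dvdl ?coprime_pq // => /dvdnP[c bE]; move: e.
have := prime_gt1 p_pr; have := prime_gt1 q_pr; rewrite bE -mulnn.
by case: c {bE} => // c; nia.
Qed.

Lemma rep_qm m al be : m < p -> q * m = al * p + be * q -> al = 0.
Proof.
move=> lt e; have : q %| al * p.
  by rewrite -(dvdn_addl _ (dvdn_mull be (dvdnn q))) -e dvdn_mulr.
rewrite Gauss_dvdl; last by rewrite coprime_sym coprime_pq.
move=> /dvdnP[c bE]; move: e.
have := prime_gt1 p_pr; have := prime_gt1 q_pr; rewrite bE.
by case: c {bE} => // c; nia.
Qed.

Lemma rep_m m al be : m < p -> m = al * p + be * q -> al = 0.
Proof. by case: al => // al; nia. Qed.

Lemma dvd_pow k i j : p ^ i %| k -> q ^ j %| k -> p ^ i * q ^ j %| k.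
Proof.
move=> h h'; rewrite Gauss_dvd ?h //.
by case: i {h} => [|i]; case: j {h'} => [|j]; rewrite ?coprime1n ?coprimen1 ?coprime_pexpl ?coprime_pexpr ?coprime_pq.
Qed.

End Arith.

Lemma sum_eq_max (I : finType) (g : I -> nat) m :
  (forall i, g i <= m) -> \sum_i g i = #|I| * m -> forall i, g i = m.
Proof.
move=> le e i; apply/eqP; rewrite eqn_leq le /= leqNgt; apply/negP => lt.
have : \sum_i g i < #|I| * m.
  rewrite -sum_nat_const (bigD1 i) //= [ltnRHS](bigD1 i) //= -addSn leq_add //.
  exact: leq_sum.
by rewrite e ltnn.
Qed.

Lemma sum_eq_min (I : finType) (g : I -> nat) m :
  (forall i, m <= g i) -> \sum_i g i = #|I| * m -> forall i, g i = m.
Proof.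
move=> le e i; apply/eqP; rewrite eqn_leq le andbT leqNgt; apply/negP => lt.
have : #|I| * m < \sum_i g i.
  rewrite -sum_nat_const (bigD1 i) //= [ltnRHS](bigD1 i) //= -addSn leq_add //.
  exact: leq_sum.
by rewrite e ltnn.
Qed.

(** * Common tools for the case analysis *)

Section Tools.
Variables A B : finType.
Notation X := ((A * A) * (B * B))%type.
Notation p := #|A|.
Notation q := #|B|.
Hypotheses (p_pr : prime p) (q_pr : prime q) (pq : p != q).
Implicit Types (f : X -> nat) (x y : X) (L S : {set X}).

Let p0 : 0 < p := prime_gt0 p_pr.
Let q0 : 0 < q := prime_gt0 q_pr.
Let p1 : 1 < p := prime_gt1 p_pr.
Let q1 : 1 < q := prime_gt1 q_pr.

Lemma inhabited_coords : inhabited X.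
Proof.
have [a _] := card_gt0P p0; have [b _] := card_gt0P q0.
by split; exact: ((a, a), (b, b)).
Qed.

Lemma good_intro L k (P1 P2 Q1 Q2 : bool) : k = p ^ (P1 + P2) * q ^ (Q1 + Q2) ->
  (forall f, \sum_x f x = k -> zerD L f ->
   [/\ P1 -> zer f 1 0, P2 -> zer f 2 0, Q1 -> zer f 0 1, Q2 -> zer f 0 2 &
    [/\ P1 -> Q1 -> zer f 1 1, P1 -> Q2 -> zer f 1 2, P2 -> Q1 -> zer f 2 1 &
        P2 -> Q2 -> zer f 2 2]]) -> good L k.
Proof.
move=> ke h; exists P1, P2, Q1, Q2; split=> // f fk z.
have [h1 h2 h3 h4 [h5 h6 h7 h8]] := h f fk z.
by move=> [|[|[|a]]] [|[|[|b]]] //= *; auto.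
Qed.

Lemma dvd_zerq f : [/\ zer f 0 1 -> q %| \sum_x f x, zer f 0 2 -> q %| \sum_x f x &
  zer f 0 1 -> zer f 0 2 -> q ^ 2 %| \sum_x f x].
Proof.
rewrite -(sum_fsw f); split=> [z|z|z z'].
- by apply: dvd_zer10; apply/zer_sw.
- by apply: dvd_zer20; apply/zer_sw.
- by apply: dvd_zer1020; apply/zer_sw.
Qed.

Lemma dvdq_zerD f L : zerD L f -> q ^ (difft L 0 1 + difft L 0 2) %| \sum_x f x.
Proof.
have [d1 d2 d3] := dvd_zerq f.
move=> z; case: (boolP (difft L 0 1)) => w1; case: (boolP (difft L 0 2)) => w2 //=.
- by apply: d3; apply: z.
- by apply: d1; apply: z.
- by apply: d2; apply: z.
Qed.

Lemma spectral_pair_dvdp S L : spectral_pair S L -> p ^ (difft L 1 0 + difft L 2 0) %| #|L|.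
Proof. by case=> <- _ z _; rewrite -sum_ind; apply: dvdp_zerD. Qed.

Lemma spectral_pair_dvdq S L : spectral_pair S L -> q ^ (difft L 0 1 + difft L 0 2) %| #|L|.
Proof. by case=> <- _ z _; rewrite -sum_ind; apply: dvdq_zerD. Qed.

Lemma difft_full L a b : #|L| = p ^ 2 * q ^ (difft L 0 1 + difft L 0 2) ->
  b <= 2 -> sel (difft L 0 1) (difft L 0 2) b -> difft L a 0 -> difft L a b.
Proof.
move=> e b2 sb /difftP[[x y] [[x' y'] /= [xL yL ea /eqP]]]; rewrite ty0 => /eqP yy; subst y'.
have yF : y \in [set y | (x', y) \in L] by rewrite inE.
have [y' y'F tb] := typed_hit q1 (@fib_typed _ _ L x') (fib_full e x') yF b2 sb.
by apply/difftP; exists (x, y), (x', y'); split=> //; rewrite inE in y'F.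
Qed.

(** Divisibility forces equality in the fibre bound, after which every order required by (T2)
    already occurs in L. *)
Lemma good_p2 S L : spectral_pair S L -> difft L 1 0 -> difft L 2 0 -> good L #|L|.
Proof.
move=> sp w1 w2; have [e0 k0 zS _] := sp.
have ke : #|L| = p ^ 2 * q ^ (difft L 0 1 + difft L 0 2).
  apply/eqP; rewrite eqn_leq card_le_fib dvdn_leq //.
  have h := spectral_pair_dvdp sp; rewrite w1 w2 in h.
  by apply: dvd_pow => //; apply: spectral_pair_dvdq sp.
apply: (@good_intro _ _ true true (difft L 0 1) (difft L 0 2)) => // f fk z.
by split; [ | | | | split] => *; apply: z => //; apply: difft_full.
Qed.

Lemma card_inj_le L (Y : finType) (F : X -> Y) :
  {in L &, injective F} -> #|L| <= #|Y|.
Proof. by move=> /card_in_imset <-; apply: max_card. Qed.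

Lemma inj_fst L : ~~ difft L 0 1 -> ~~ difft L 0 2 -> {in L &, injective (fun x => x.1)}.
Proof.
move=> w1 w2 x y xL yL /= e; have := difft_mem xL yL; rewrite e {1}/ty eqxx.
have := ty_le2 x.2 y.2; case t: (ty x.2 y.2) => [|[|[|]]] //=; rewrite ?(negbTE w1) ?(negbTE w2) // => _ _.
move/eqP: t; rewrite ty0 => /eqP; case: x y e {xL yL} => a b [c d] /= -> ->; by [].
Qed.

Lemma inj_snd L : ~~ difft L 1 0 -> ~~ difft L 2 0 -> {in L &, injective (fun x => x.2)}.
Proof.
move=> w1 w2 x y xL yL /= e; have := difft_mem xL yL; rewrite e {2}/ty eqxx.
have := ty_le2 x.1 y.1; case t: (ty x.1 y.1) => [|[|[|]]] //=; rewrite ?(negbTE w1) ?(negbTE w2) // => _ _.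
move/eqP: t; rewrite ty0 => /eqP; case: x y e {xL yL} => a b [c d] /= -> ->; by [].
Qed.

Lemma typed_fst L (b1 b2 : bool) :
  (forall b, difft L 1 b -> b1) -> (forall b, difft L 2 b -> b2) -> typed b1 b2 [set x.1 | x in L].
Proof.
move=> h1 h2 _ _ /imsetP[x xL ->] /imsetP[y yL ->].
have := difft_mem xL yL; have := ty_le2 x.1 y.1; rewrite /sel.
by case: (ty x.1 y.1) => [|[|[|]]] //= _; [apply: h1 | apply: h2].
Qed.

Lemma typed_snd L (b1 b2 : bool) :
  (forall a, difft L a 1 -> b1) -> (forall a, difft L a 2 -> b2) -> typed b1 b2 [set x.2 | x in L].
Proof.
move=> h1 h2 _ _ /imsetP[x xL ->] /imsetP[y yL ->].
have := difft_mem xL yL; have := ty_le2 x.2 y.2; rewrite /sel.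
by case: (ty x.2 y.2) => [|[|[|]]] //= _; [apply: h1 | apply: h2].
Qed.

Lemma fibered_zer1 f a b a0 b0 : a < 2 -> b < 2 -> zer f a.+1 b.+1 -> a0 <= a -> b0 <= b ->
  fibered f a b 1 a0 b0.
Proof. by move=> a2 b2 z h h'; apply: fibered_zer => // x; apply: dvd1n. Qed.

Lemma zerD1 f L b : zerD L f -> difft L 1 b -> zer f 1 b.
Proof. by move=> z; apply: z; case: b. Qed.

Lemma zerD2 f L b : zerD L f -> difft L 2 b -> zer f 2 b.
Proof. by move=> z; apply: z; case: b. Qed.

Lemma difft_le2 L a b : difft L a b -> a <= 2 /\ b <= 2.
Proof. by case/difftP=> x [y [_ _ <- <-]]; rewrite !ty_le2. Qed.

(* If the marginal of f modulo p vanishes at some point, then the relation of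
   order p * q ^ b.+1 degenerates to one of order q ^ b.+1. *)
Lemma zer_vanish f b x0 : b < 2 -> marg f 1 0 x0 = 0 -> zer f 1 b.+1 -> indq f 0 b.
Proof.
move=> b2 c0 z x.
have sub c : marg f 1 c (x0.1, x.2) = 0.
  apply/eqP; rewrite -leqn0; apply: leq_trans (eq_leq c0); rewrite /marg /=.
  rewrite [leqLHS]big_mkcond [leqRHS]big_mkcond; apply: leq_sum => y _ /=.
  by rewrite andbT; case: ifP => [/andP[-> _]|_].
have := z (x0.1, x.2); rewrite !sub muln0 add0n muln0 addn0.
have E c : marg f 0 c x = marg f 0 c (x0.1, x.2) by apply: marg_eqv; rewrite ?eqv_refl.
by rewrite !E => ->.
Qed.

End Tools.

Lemma pow_bool n : (n ^ (true + false) = n) * (n ^ (false + true) = n) *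
  (n ^ (false + false) = 1) * (n ^ (true + true) = n ^ 2).
Proof. by []. Qed.

(** * Exactly one power of p and no power of q among the orders *)

Section Cases.
Variables A B : finType.
Notation X := ((A * A) * (B * B))%type.
Notation p := #|A|.
Notation q := #|B|.
Hypotheses (p_pr : prime p) (q_pr : prime q) (pq : p != q).
Implicit Types (f : X -> nat) (x y : X) (L S : {set X}).

Let p0 : 0 < p := prime_gt0 p_pr.
Let q0 : 0 < q := prime_gt0 q_pr.
Let p1 : 1 < p := prime_gt1 p_pr.
Let q1 : 1 < q := prime_gt1 q_pr.

Lemma dvdq_zer f (b1 b2 : bool) : (b1 -> zer f 0 1) -> (b2 -> zer f 0 2) ->
  q ^ (b1 + b2) %| \sum_x f x.
Proof.
have [d1 d2 d3] := dvd_zerq f.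
by case: b1; case: b2 => // h1 h2; rewrite pow_bool; auto.
Qed.

Lemma exists_difft L a (h : difft L a 1 || difft L a 2) : exists2 b, b < 2 & difft L a b.+1.
Proof. by case/orP: h; [exists 0 | exists 1]. Qed.

Lemma spectral_pair_total S L : spectral_pair S L -> \sum_x ind S x = #|L|.
Proof. by case=> <- _ _ _; rewrite sum_ind. Qed.

Section CaseOnePrime.
Variables S L : {set X}.
Hypotheses (sp : spectral_pair S L) (w01 : ~~ difft L 0 1) (w02 : ~~ difft L 0 2).

Lemma bound_p2 : #|L| <= p ^ 2.
Proof. by rewrite -mulnn -card_prod; apply: card_inj_le (inj_fst w01 w02). Qed.

Lemma difft0 b : difft L 0 b -> b = 0.
Proof.
move=> w; have [_ b2] := difft_le2 w; case: b w b2 => [|[|[|]]] // w.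
  by case/negP: w01.
by case/negP: w02.
Qed.

(** Vanishing at p gives every class modulo p the mass |L|/p <= p. If an order p^2 q^b with b > 0
    occurs, mass p leaves only p-cosets, whence vanishing at p^2, and a mass m < p leaves only
    q-cosets, whence vanishing at q^b. *)
Lemma good_10 : difft L 1 0 -> ~~ difft L 2 0 -> good L #|L|.
Proof.
move=> w10 w20; have [e0 k0 zS _] := sp.
have dp : p %| #|L| by have h := spectral_pair_dvdp sp; rewrite w10 (negbTE w20) in h; exact: h.
have kp2 := bound_p2.
case Bs: (difft L 2 1 || difft L 2 2); last first.
  have kp : #|L| = p.
    apply/eqP; rewrite eqn_leq (dvdn_leq k0 dp) andbT.
    rewrite -(card_in_imset (inj_fst w01 w02)) -[leqRHS]/(p ^ (true + false)).
    apply: typed_bound; apply: typed_fst => // b w.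
    move/norP: Bs => [w21 w22]; have [_ b2] := difft_le2 w.
    case: b w b2 => [|[|[|]]] // w; first by rewrite w in w20.
      by rewrite w in w21.
    by rewrite w in w22.
  apply: (@good_intro _ _ _ _ true false false false); first by rewrite !pow_bool muln1.
  by move=> f fk z; split=> // _; apply: z.
have [k2|kn2] := eqVneq #|L| (p ^ 2).
  apply: (@good_intro _ _ _ _ true true false false); first by rewrite !pow_bool muln1.
  move=> f fk z; have z10 := z 1 0 isT w10; have [b b2 wb] := exists_difft Bs.
  have ip : indp f 1 b.+1.
    apply: (fibered_indp (fibered_zer1 (a := 1) (a0 := 1) (b0 := 0) p_pr q_pr isT b2 (zerD2 z wb) isT isT)) => x al be.
    rewrite mul1n => e; apply: (rep_p p_pr q_pr pq (al := al)); rewrite -e.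
    by have := z10 x; rewrite marg00 fk k2 -mulnn => /eqP; rewrite eqn_pmul2l // => /eqP.
  by split=> // _; apply: indp_zer ip _ _.
have [m km] := dvdnP dp.
have mp : m < p.
  have : m <= p by rewrite -(leq_pmul2r p0) -km mulnn.
  by rewrite leq_eqVlt => /orP[/eqP e|//]; rewrite km e mulnn eqxx in kn2.
have iq f : \sum_x f x = #|L| -> zerD L f -> forall b, b < 2 -> difft L 2 b.+1 -> indq f 2 b.
  move=> fk z b b2 wb.
  apply: (fibered_indq (fibered_zer1 (a := 1) (a0 := 1) (b0 := 0) p_pr q_pr isT b2 (zerD2 z wb) isT isT)) => x al be.
  rewrite mul1n => e; apply: (rep_m p_pr q_pr pq mp (be := be)); rewrite -e.
  have := z 1 0 isT w10 x; rewrite marg00 fk km mulnC => /eqP.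
  by rewrite eqn_pmul2r // => /eqP.
(* Divisibility is the lower bound. For the upper bound, x is determined by its second p-digit and
   the q-part of the representative of its class modulo p. *)
have kE : #|L| = p * q ^ (difft L 2 1 + difft L 2 2).
  apply/eqP; rewrite eqn_leq; apply/andP; split; last first.
    apply: dvdn_leq => //; rewrite -[X in X * _]/(p ^ 1); apply: dvd_pow => //.
    have ii := iq _ (spectral_pair_total sp) zS.
    rewrite -(spectral_pair_total sp); apply: dvdq_zer => w.
      by apply: indq_zer (ii 0 isT w) _ _.
    by apply: indq_zer (ii 1 isT w) _ _.
  (* rep x depends on the class of x modulo p only *)
  pose rep x := odflt x [pick z in L | z.1.1 == x.1.1].
  have repP x : x \in L -> rep x \in L /\ (rep x).1.1 = x.1.1.
    move=> xL; rewrite /rep; case: pickP => [z /andP[zL /eqP zu]|/(_ x)] //=; by rewrite xL eqxx.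
  have repE x y : x \in L -> x.1.1 = y.1.1 -> rep x = rep y.
    by move=> xL e; rewrite /rep e; case: pickP => // /(_ x); rewrite xL e eqxx.
  have Yty : typed (difft L 2 1) (difft L 2 2) [set (rep x).2 | x in L].
    move=> _ _ /imsetP[x xL ->] /imsetP[y yL ->].
    have [rx ex] := repP x xL; have [ry ey] := repP y yL.
    have [e|ne] := eqVneq x.1.1 y.1.1.
      by rewrite (repE x y) // /ty eqxx.
    have := difft_mem rx ry; rewrite {1}/ty ex ey (negbTE ne).
    have -> : ((rep x).1 == (rep y).1) = false.
      by apply/eqP => e; rewrite -ex -ey e eqxx in ne.
    by have := ty_le2 (rep x).2 (rep y).2; case: (ty _ _) => [|[|[|]]].
  apply: leq_trans (leq_mul (leqnn p) (typed_bound Yty)).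
  (* Representatives with equal q-parts in different classes modulo p would differ by order p^2,
     which is excluded. *)
  have Fi : {in L &, injective (fun x => (x.1.2, (rep x).2))}.
    move=> x y xL yL /= [es er].
    have [rx ex] := repP x xL; have [ry ey] := repP y yL.
    have eu : x.1.1 = y.1.1.
      apply/eqP; apply: contraNT w20 => ne; apply/difftP; exists (rep x), (rep y).
      split=> //; last by apply/eqP; rewrite ty0 er.
      rewrite /ty ex ey (negbTE ne); case: eqP => // e.
      by rewrite -ex -ey e eqxx in ne.
    apply: (inj_fst w01 w02) => //.
    by case: (x) (y) eu es => [[u s] ?] [[u' s'] ?] /= -> ->.
  rewrite -(card_in_imset Fi) -cardsT -cardsX.
  apply: subset_leq_card; apply/subsetP => _ /imsetP[x xL ->].
  by rewrite inE /= inE /=; apply/imsetP; exists x.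
apply: (@good_intro _ _ _ _ true false (difft L 2 1) (difft L 2 2)); first by rewrite pow_bool.
move=> f fk z; have ii := iq f fk z.
split=> //; [by move=> _; apply: z | | | split=> // _] => w.
- by apply: indq_zer (ii 0 isT w) _ _.
- by apply: indq_zer (ii 1 isT w) _ _.
- by apply: indq_zer (ii 0 isT w) _ _.
- by apply: indq_zer (ii 1 isT w) _ _.
Qed.

(** Vanishing at p^2 makes the masses modulo p multiples of p. Either all are positive, so |L| = p^2
    and the masses are equal, or a class is empty and [zer_vanish] turns the orders p q^b into
    powers of q. *)
Lemma good_20 : difft L 2 0 -> ~~ difft L 1 0 -> good L #|L|.
Proof.
move=> w20 w10; have [e0 k0 zS _] := sp.
have dp : p %| #|L| by have h := spectral_pair_dvdp sp; rewrite w20 (negbTE w10) in h; exact: h.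
have kp2 := bound_p2.
case Bs: (difft L 1 1 || difft L 1 2); last first.
  have kp : #|L| = p.
    apply/eqP; rewrite eqn_leq (dvdn_leq k0 dp) andbT.
    rewrite -(card_in_imset (inj_fst w01 w02)) -[leqRHS]/(p ^ (false + true)).
    apply: typed_bound; apply: typed_fst => // b w.
    move/norP: Bs => [w21 w22]; have [_ b2] := difft_le2 w.
    case: b w b2 => [|[|[|]]] // w; first by rewrite w in w10.
      by rewrite w in w21.
    by rewrite w in w22.
  apply: (@good_intro _ _ _ _ false true false false); first by rewrite !pow_bool muln1.
  by move=> f fk z; split=> // _; apply: z.
have full f : \sum_x f x = #|L| -> zerD L f -> (forall x, 0 < marg f 1 0 x) ->
    #|L| = p ^ 2 /\ zer f 1 0.
  move=> fk z pos.
  have le x : p <= marg f 1 0 x by rewrite dvdn_leq // -(z 2 0 isT w20) dvdn_mulr.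
  have [x] := inhabited_coords p_pr q_pr.
  have := marg_split_p f 0 x (isT : 0 < 2); rewrite marg00 fk => ks.
  have k2 : #|L| = p * p.
    apply/eqP; rewrite eqn_leq; apply/andP; split; first by rewrite mulnn.
    by rewrite ks -sum_nat_const; apply: leq_sum.
  split; first by rewrite k2 mulnn.
  rewrite k2 in ks; have E := sum_eq_min (fun i => le _) (esym ks).
  move=> y; rewrite marg00 fk k2; congr (_ * _).
  by rewrite -(E y.1.1); apply: marg_eqv => //=.
have iq f : \sum_x f x = #|L| -> zerD L f -> #|L| <> p ^ 2 ->
    forall b, b < 2 -> difft L 1 b.+1 -> indq f 1 b.
  move=> fk z kn b b2 wb.
  have z1 := zerD1 z wb.
  have [x /eqP cx|pos] := pickP (fun x => marg f 1 0 x == 0).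
    by apply: zer_indq => //; apply: zer_vanish cx z1.
  by case: kn; case: (full f fk z) => // x; rewrite lt0n pos.
have [k2|/eqP kn2] := eqVneq #|L| (p ^ 2).
  apply: (@good_intro _ _ _ _ true true false false); first by rewrite !pow_bool muln1.
  move=> f fk z; have [b b2 wb] := exists_difft Bs.
  split=> // _; last exact: z.
  have [x /eqP cx|pos] := pickP (fun x => marg f 1 0 x == 0); last first.
    by case: (full f fk z) => // x; rewrite lt0n pos.
  have i0 := zer_vanish b2 cx (zerD1 z wb).
  have : q %| \sum_x f x.
    have [d1 d2 _] := dvd_zerq f.
    case: b b2 {wb} i0 => [|[|//]] _ i0; [apply: d1 | apply: d2]; exact: indq_zer i0 _ _.
  by rewrite fk k2 Euclid_dvdX // dvdn_prime2 // eq_sym (negbTE pq).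
have kd : p * q ^ (difft L 1 1 + difft L 1 2) %| #|L|.
  rewrite -[X in X * _]/(p ^ 1); apply: dvd_pow => //.
  have ii := iq _ (spectral_pair_total sp) zS kn2.
  rewrite -(spectral_pair_total sp); apply: dvdq_zer => w.
    by apply: indq_zer (ii 0 isT w) _ _.
  by apply: indq_zer (ii 1 isT w) _ _.
(* Inside a class modulo p distinct points differ by order p q^b with b > 0, so their q-parts form a
   typed set; the size of L makes all p of these sets maximal. *)
pose Lu u := [set x in L | x.1.1 == u].
pose Y u := [set x.2 | x in Lu u].
have sameu x y : x \in L -> y \in L -> x.1.1 = y.1.1 -> x != y -> difft L 1 (ty x.2 y.2).
  move=> xL yL eu ne; have := difft_mem xL yL; rewrite {1}/ty eu eqxx; case: eqP => // e.
  move/difft0/eqP; rewrite ty0 => /eqP e2; case/eqP: ne.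
  by case: (x) (y) e e2 => [? ?] [? ?] /= -> ->.
have Yty u : typed (difft L 1 1) (difft L 1 2) (Y u).
  move=> _ _ /imsetP[x + ->] /imsetP[y + ->]; rewrite !inE => /andP[xL /eqP xu] /andP[yL /eqP yu].
  have [->|ne] := eqVneq x y; first by rewrite /ty eqxx.
  have := sameu x y xL yL (etrans xu (esym yu)) ne.
  by have := ty_le2 x.2 y.2; case: (ty _ _) => [|[|[|]]].
have cY u : #|Y u| = #|Lu u|.
  apply: card_in_imset => x y; rewrite !inE => /andP[xL /eqP xu] /andP[yL /eqP yu] e.
  apply/eqP; apply: contraNT w10 => ne.
  have := sameu x y xL yL (etrans xu (esym yu)) ne.
  by rewrite e /ty eqxx.
have sumL : #|L| = \sum_u #|Y u|.
  under eq_bigr do rewrite cY.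
  rewrite -sum1_card (partition_big (fun x : X => x.1.1) predT) //=.
  apply: eq_bigr => u _; rewrite sum1dep_card; congr #|pred_of_set _|.
have leY u : #|Y u| <= q ^ (difft L 1 1 + difft L 1 2) := typed_bound (Yty u).
have kE : #|L| = p * q ^ (difft L 1 1 + difft L 1 2).
  apply/eqP; rewrite eqn_leq (dvdn_leq k0 kd) andbT sumL.
  by rewrite -sum_nat_const; apply: leq_sum => u _; apply: leY.
rewrite sumL in kE; have Yfull := sum_eq_max leY kE.
(* A pair x, y of order p^2 has equal q-parts. The class of y modulo p is full, so it contains a
   point whose q-part differs from that of x by order q^(b+1). *)
have W2 b : b < 2 -> difft L 1 b.+1 -> difft L 2 b.+1.
  move=> b2 wb; case/difftP: w20 => x [y [xL yL exy /eqP]]; rewrite ty0 => /eqP e2.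
  have xY : x.2 \in Y y.1.1.
    by apply/imsetP; exists y => //; rewrite !inE yL eqxx.
  have sb : sel (difft L 1 1) (difft L 1 2) b.+1 by case: b b2 wb => [|[|]].
  have [y' /imsetP[z] ] := typed_hit q1 (Yty y.1.1) (Yfull y.1.1) xY (b2 : b.+1 <= 2) sb.
  rewrite !inE => /andP[zL /eqP zu] -> tz; apply/difftP; exists x, z; split=> //.
  move: exy; rewrite /ty zu; case: eqP => // _; case: eqP => // ne _.
  by case: eqP => // e; case: ne; rewrite e zu.
apply: (@good_intro _ _ _ _ false true (difft L 1 1) (difft L 1 2)); first by rewrite sumL kE pow_bool.
move=> f fk z; have ii := iq f fk z kn2.
split=> //; [by move=> _; apply: z | | | split=> // _] => w.
- by apply: indq_zer (ii 0 isT w) _ _.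
- by apply: indq_zer (ii 1 isT w) _ _.
- by apply: z => //; apply: W2.
- by apply: z => //; apply: W2.
Qed.

End CaseOnePrime.
End Cases.

(** * Sets without differences of order p^2 q^2, and sets that are unions of cosets *)

Section Grids.
Variables A B : finType.
Notation X := ((A * A) * (B * B))%type.
Notation p := #|A|.
Notation q := #|B|.
Hypotheses (p_pr : prime p) (q_pr : prime q) (pq : p != q).
Implicit Types (f : X -> nat) (x y : X) (L S : {set X}).

Let p0 : 0 < p := prime_gt0 p_pr.
Let q0 : 0 < q := prime_gt0 q_pr.
Let p1 : 1 < p := prime_gt1 p_pr.
Let q1 : 1 < q := prime_gt1 q_pr.

(* If no difference has order p ^ 2 * q ^ 2, any two elements agree modulo p or modulo q,
   so they lie on one line of the p x q grid. *)
Lemma grid L : ~~ difft L 2 2 ->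
  (forall x y, x \in L -> y \in L -> x.1.1 = y.1.1) \/
  (forall x y, x \in L -> y \in L -> x.2.1 = y.2.1).
Proof.
move=> w22.
have K x y : x \in L -> y \in L -> (x.1.1 == y.1.1) || (x.2.1 == y.2.1).
  move=> xL yL; apply: contraNT w22; rewrite negb_or => /andP[n1 n2].
  by apply/difftP; exists x, y; split=> //; apply: ty2.
have [h|] := boolP [forall x in L, forall y in L, x.1.1 == y.1.1].
  left=> x y xL yL; apply/eqP.
  by have /forall_inP/(_ x xL)/forall_inP/(_ y yL) := h.
rewrite negb_forall_in => /exists_inP[a aL]; rewrite negb_forall_in => /exists_inP[b bL ab]; right.
have eab : a.2.1 = b.2.1 by have := K a b aL bL; rewrite (negbTE ab) => /eqP.
suff E x : x \in L -> x.2.1 = a.2.1 by move=> x y xL yL; rewrite (E x) ?(E y).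
move=> xL; have := K x a xL aL; have := K x b xL bL.
rewrite -eab; case: (x.2.1 =P a.2.1) => //; rewrite !orbF => _ /eqP e1 /eqP e2.
by rewrite -e1 e2 eqxx in ab.
Qed.

(** The indicator of S is additive on cosets of order p q. If a row contains a point of S at t1 but
    misses t2, additivity puts t1 into every other row too, giving a difference of order p. *)
Lemma indq_of_set S : zer (ind S) 2 2 -> ~~ difft S 1 0 -> indq (ind S) 2 1.
Proof.
move=> z w10 [[u s] [v t]].
have [s' ss'] := other_elt s p1.
have g i j : marg (ind S) 2 2 ((u, i), (v, j)) = (((u, i), (v, j)) \in S).
  rewrite /marg (big_pred1 ((u, i), (v, j))) // => y /=.
  by case: y => y1 y2; rewrite xpair_eqE /= !(eq_sym y1, eq_sym y2).
have key t1 t2 : ((u, s), (v, t1)) \in S -> ((u, s), (v, t2)) \in S.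
  move=> h; apply: contraT => /negbTE n.
  have := @zer_additive _ _ (ind S) 1 1 ((u, s), (v, t)) isT isT p0 q0 z s s' t1 t2.
  rewrite /= !g h n; case h': (((u, s'), (v, t1)) \in S); last by case: (_ \in _).
  case/negP: w10; apply/difftP; exists ((u, s), (v, t1)), ((u, s'), (v, t1)).
  rewrite /ty /= !eqxx xpair_eqE eqxx /= eq_sym (negbTE ss'); by split.
rewrite (@marg_split_q _ _ _ 2 1) // g /=.
under eq_bigr => j _ do rewrite g.
have [h|/negbTE h] := boolP (((u, s), (v, t)) \in S).
  by rewrite muln1 -sum1_card; apply: eq_bigr => j _; rewrite (key t j h).
rewrite muln0 big1 // => j _; apply/eqP; rewrite eqb0; apply/negP => h'.
by rewrite (key j t h') in h.
Qed.

End Grids.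

Lemma indp_of_set (A B : finType) (S : {set (A * A) * (B * B)}) :
  prime #|A| -> prime #|B| -> zer (ind S) 2 2 -> ~~ difft S 0 1 -> indp (ind S) 1 2.
Proof.
move=> p_pr q_pr z w x.
have z' : zer (ind [set sw y | y in S]) 2 2.
  by apply: eq_zer (fun y => esym (ind_sw S y)) _; apply/zer_sw.
have w' : ~~ difft [set sw y | y in S] 1 0 by rewrite difft_sw.
have := indq_of_set q_pr p_pr z' w' (sw x).
have E a b : marg (ind [set sw y | y in S]) a b (sw x) = marg (ind S) b a x.
  by rewrite -[RHS]marg_sw; apply: eq_bigr => y _; rewrite ind_sw.
by rewrite !E.
Qed.

(** * No prime power among the orders, p < q *)

Section CaseNoPrimePower.
Variables A B : finType.
Notation X := ((A * A) * (B * B))%type.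
Notation p := #|A|.
Notation q := #|B|.
Hypotheses (p_pr : prime p) (q_pr : prime q) (ltpq : p < q).
Implicit Types (f : X -> nat) (x y : X) (L S : {set X}).

Let p0 : 0 < p := prime_gt0 p_pr.
Let q0 : 0 < q := prime_gt0 q_pr.
Let p1 : 1 < p := prime_gt1 p_pr.
Let q1 : 1 < q := prime_gt1 q_pr.
Let pq : p != q. Proof. by rewrite neq_ltn ltpq. Qed.

Variables S L : {set X}.
Hypothesis sp : spectral_pair S L.
Hypotheses (w10 : ~~ difft L 1 0) (w20 : ~~ difft L 2 0) (w01 : ~~ difft L 0 1) (w02 : ~~ difft L 0 2).

Lemma difft_fst a b : 0 < a -> difft L a b -> 0 < b.
Proof.
move=> a0 w; case: b w => // w; have [a2 _] := difft_le2 w.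
case: a w a0 a2 => [|[|[|]]] // w; first by case/negP: w10.
by case/negP: w20.
Qed.

Lemma difft_snd a b : 0 < b -> difft L a b -> 0 < a.
Proof.
move=> a0 w; case: a w => // w; have [_ a2] := difft_le2 w.
case: b w a0 a2 => [|[|[|]]] // w; first by case/negP: w01.
by case/negP: w02.
Qed.

Lemma difft_or_snd a b : 0 < a -> difft L a b -> difft L a 1 || difft L a 2.
Proof.
move=> a0 w; have b0 := difft_fst a0 w; have [_ b2] := difft_le2 w.
by case: b w b0 b2 => [|[|[|]]] // w _ _; rewrite w ?orbT.
Qed.

Lemma difft_or_fst a b : 0 < b -> difft L a b -> difft L 1 b || difft L 2 b.
Proof.
move=> a0 w; have b0 := difft_snd a0 w; have [b2 _] := difft_le2 w.
by case: a w b0 b2 => [|[|[|]]] // w _ _; rewrite w ?orbT.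
Qed.

Let kp2 := bound_p2 w01 w02.
Let k0 : 0 < #|L|. Proof. by case: sp. Qed.
Let occp a := difft L a 1 || difft L a 2.
Let occq b := difft L 1 b || difft L 2 b.

Lemma bound_fst : #|L| <= p ^ (occp 1 + occp 2).
Proof.
rewrite -(card_in_imset (inj_fst w01 w02)); apply: typed_bound; apply: typed_fst => b w.
  exact: difft_or_snd w.
exact: difft_or_snd w.
Qed.

Lemma bound_snd : #|L| <= q ^ (occq 1 + occq 2).
Proof.
rewrite -(card_in_imset (inj_snd w10 w20)); apply: typed_bound; apply: typed_snd => b w.
  exact: difft_or_fst w.
exact: difft_or_fst w.
Qed.

Lemma zerDS f a b : zerD L f -> difft L a.+1 b -> zer f a.+1 b.
Proof. by move=> z; apply: z. Qed.

Lemma indp_lt f a b : \sum_x f x < q -> zerD L f -> a < 2 -> b < 2 -> difft L a.+1 b.+1 -> indp f a b.+1.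
Proof.
move=> lt z a2 b2 w.
apply: (fibered_indp (fibered_zer1 (a0 := 0) (b0 := 0) p_pr q_pr a2 b2 (zerDS z w) (leq0n a) (leq0n b))) => x al be.
rewrite mul1n marg00 => e; move: lt; rewrite e; case: be {e} => // be; rewrite mulSn => h.
by have := leq_ltn_trans (leq_trans (leq_addr (be * q) q) (leq_addl (al * p) _)) h; rewrite ltnn.
Qed.

Lemma indp_p2 f a b : \sum_x f x = p ^ 2 -> zerD L f -> a < 2 -> b < 2 -> difft L a.+1 b.+1 -> indp f a b.+1.
Proof.
move=> lt z a2 b2 w.
apply: (fibered_indp (fibered_zer1 (a0 := 0) (b0 := 0) p_pr q_pr a2 b2 (zerDS z w) (leq0n a) (leq0n b))) => x al be.
by rewrite mul1n marg00 lt => e; apply: rep_pp e.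
Qed.

Lemma indp_zer0 f a b : indp f a b.+1 -> b < 2 -> zer f a.+1 0.
Proof. by move=> h b2; apply: indp_zer h _ _. Qed.

Lemma good_occ_p2 : #|L| = p ^ 2 -> occp 1 -> occp 2 -> good L #|L|.
Proof.
move=> k2 w1 w2; apply: (@good_intro _ _ _ _ true true false false); first by rewrite !pow_bool muln1.
move=> f fk z; rewrite k2 in fk; have [b1 b12 wb1] := exists_difft w1; have [b2 b22 wb2] := exists_difft w2.
split=> // _.
  exact: indp_zer0 (indp_p2 (a := 0) fk z isT b12 wb1) b12.
exact: indp_zer0 (indp_p2 (a := 1) fk z isT b22 wb2) b22.
Qed.

(** The dual half of the pair enters here. If S had differences of orders p and q, p q would divide
    |L| <= p^2. Otherwise S is a union of p-cosets or of q-cosets, and |L| is p or q times a number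
    al p + be q; the only positive value up to p^2 is p times p. *)
Lemma case00_S : difft L 2 2 -> occp 1 -> occq 1 -> #|L| = p ^ 2.
Proof.
move=> w22 w1 w1'; have [eSL _ zS zL] := sp.
have fk := spectral_pair_total sp.
have z22 := zS 2 2 isT w22.
have [ws10|ws10] := boolP (difft S 1 0).
  have [ws01|ws01] := boolP (difft S 0 1).
    have dp : p ^ 1 %| #|L| by rewrite -sum_ind; apply: dvd_zer10 (zL 1 0 isT ws10).
    have dq : q ^ 1 %| #|L|.
      have [d1 _ _] := dvd_zerq (ind L).
      by rewrite -sum_ind; apply: d1 (zL 0 1 isT ws01).
    have := dvdn_leq k0 (dvd_pow p_pr q_pr pq dp dq); rewrite !expn1 => le.
    by have := leq_trans le kp2; rewrite -mulnn leq_pmul2l // leqNgt ltpq.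
  have ip := indp_of_set p_pr q_pr z22 ws01.
  have ip1 := indp_pred (isT : 1 < 2) ip.
  have [b b2 wb] := exists_difft w1.
  have dv x : p %| marg (ind S) 1 b.+1 x.
    by case: b b2 {wb} => [|[|//]] _; [rewrite -ip1 | rewrite -ip]; apply: dvdn_mulr.
  have [x] := inhabited_coords p_pr q_pr.
  have [al [be [e _ _]]] := fibered_zer (a := 0) (a0 := 0) (b0 := 0) isT b2 p0 p0 q0 dv (zerDS zS wb) isT (leq0n b) x.
  rewrite marg00 fk in e.
  have be0 : be = 0.
    case: be e => // be e; have := kp2; rewrite e -mulnn leq_pmul2l // mulSn.
    move=> h; have : q <= p by apply: leq_trans h; rewrite addnCA leq_addr.
    by rewrite leqNgt ltpq.
  have := kp2; have := k0; rewrite e be0 -mulnn addn0 leq_pmul2l //.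
  rewrite !muln_gt0 => /andP[_ /andP[al0 _]]; rewrite -{2}[p]mul1n leq_pmul2r // => al1.
  by have -> : al = 1; [apply/eqP; rewrite eqn_leq al1 | rewrite mul1n].
have iq := indq_of_set p_pr q_pr z22 ws10.
have iq1 := indq_pred (isT : 1 < 2) iq.
have [a a2 wa] : exists2 a, a < 2 & difft L a.+1 1 by case/orP: w1'; [exists 0 | exists 1].
have dv x : q %| marg (ind S) a.+1 1 x.
  by case: a a2 {wa} => [|[|//]] _; [rewrite -iq1 | rewrite -iq]; apply: dvdn_mulr.
have [x] := inhabited_coords p_pr q_pr.
have [al [be [e _ _]]] := fibered_zer (b := 0) (a0 := 0) (b0 := 0) a2 isT q0 p0 q0 dv (zerDS zS wa) (leq0n a) isT x.
rewrite marg00 fk in e.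
have lt : p * p < q * p by rewrite ltn_pmul2r.
have ltq : p * p < q * q by apply: ltn_trans lt _; rewrite ltn_pmul2l.
have := kp2; have := k0; rewrite e -mulnn mulnDr => /lt0n_neq0 k00 le.
exfalso; case: (posnP al) => [al0|al0]; last first.
  have : q * p <= p * p.
    by apply: leq_trans le; apply: leq_trans (leq_addr _ _); rewrite leq_pmul2l // leq_pmull.
  by rewrite leqNgt lt.
case: (posnP be) => [be0|be0]; first by move: k00; rewrite al0 be0 !mul0n muln0.
have : q * q <= p * p.
  by apply: leq_trans le; apply: leq_trans (leq_addl _ _); rewrite leq_pmul2l // leq_pmull.
by rewrite leqNgt ltq.
Qed.

Lemma good_00 : good L #|L|.
Proof.
case w1: (occp 1); case w2: (occp 2); last first.
- have k1 : #|L| = 1.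
    by apply/eqP; rewrite eqn_leq k0 andbT; have := bound_fst; rewrite w1 w2.
  by apply: (@good_intro _ _ _ _ false false false false); rewrite ?k1 // => f _ _; split.
- have kp : #|L| <= p by have := bound_fst; rewrite w1 w2.
  have [b b2 wb] := exists_difft w2.
  have lt : #|L| < q by apply: leq_ltn_trans kp ltpq.
  have zf f : \sum_x f x = #|L| -> zerD L f -> zer f 2 0.
    by move=> fk z; apply: indp_zer0 (b2); apply: indp_lt z _ _ wb => //; rewrite fk.
  have dp : p %| #|L|.
    by rewrite -(spectral_pair_total sp); apply: dvd_zer20; apply: zf (spectral_pair_total sp) _; case: sp.
  apply: (@good_intro _ _ _ _ false true false false).
    by rewrite !pow_bool muln1; apply/eqP; rewrite eqn_leq kp dvdn_leq.
  by move=> f fk z; split=> // _; apply: zf.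
- have kp : #|L| <= p by have := bound_fst; rewrite w1 w2.
  have [b b2 wb] := exists_difft w1.
  have lt : #|L| < q by apply: leq_ltn_trans kp ltpq.
  have zf f : \sum_x f x = #|L| -> zerD L f -> zer f 1 0.
    by move=> fk z; apply: indp_zer0 (b2); apply: indp_lt z _ _ wb => //; rewrite fk.
  have dp : p %| #|L|.
    by rewrite -(spectral_pair_total sp); apply: dvd_zer10; apply: zf (spectral_pair_total sp) _; case: sp.
  apply: (@good_intro _ _ _ _ true false false false).
    by rewrite !pow_bool muln1; apply/eqP; rewrite eqn_leq kp dvdn_leq.
  by move=> f fk z; split=> // _; apply: zf.
(* [2 - b] is the exponent other than [b.+1]. Orders involving p also involve q, so if only one
   power of q occurs, it accompanies both p and p^2. *)
have single b : b < 2 -> occq b.+1 = true -> ~~ occq (2 - b) -> difft L 1 b.+1 && difft L 2 b.+1.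
  move=> b2 wb nb.
  have [c c2 wc] := exists_difft w1; have [d d2 wd] := exists_difft w2.
  have h1 : difft L 1 (2 - b) = false by apply: contraNF nb => h; rewrite /occq h.
  have h2 : difft L 2 (2 - b) = false by apply: contraNF nb => h; rewrite /occq h orbT.
  case: b b2 {wb nb} h1 h2 => [|[|//]] _ h1 h2; case: c c2 wc => [|[|//]] _ wc;
    case: d d2 wd => [|[|//]] _ wd; rewrite /= in h1 h2; by rewrite ?wc ?wd // in h1 h2 *.
(* Mass q leaves only q-cosets. Below q no q-coset fits, so vanishing at both p and p^2 forces |L| =
   p^2. *)
have one b : b < 2 -> occq b.+1 = true -> ~~ occq (2 - b) -> #|L| <= q -> good L #|L|.
  move=> b2 wb nb kq; have /andP[wa wc] := single b b2 wb nb.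
  have [kq'|ne] := eqVneq #|L| q.
    apply: (@good_intro _ _ _ _ false false (b == 0) (b == 1)).
      by rewrite kq' pow_bool mul1n; case: b b2 {wb nb wa wc} => [|[|]].
    move=> f fk z; have i : indq f 1 b.
      apply: (fibered_indq (fibered_zer1 (a := 0) (a0 := 0) (b0 := 0) p_pr q_pr isT b2 (zerDS z wa) isT (leq0n b))) => x al be.
      by rewrite mul1n marg00 fk kq' => e; apply: rep_q e.
    have zb : zer f 0 b.+1 by apply: indq_zer i _ _.
    by split=> // /eqP e; rewrite e in zb.
  have lt : #|L| < q by rewrite ltn_neqAle ne.
  apply: good_occ_p2 => //.
  apply/eqP; rewrite eqn_leq kp2 dvdn_leq //.
  have fk := spectral_pair_total sp; have lt' : \sum_x ind S x < q by rewrite fk.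
  have [_ _ zS _] := sp.
  rewrite -fk; apply: dvd_zer1020.
    exact: indp_zer0 (indp_lt (a := 0) lt' zS isT b2 wa) b2.
  exact: indp_zer0 (indp_lt (a := 1) lt' zS isT b2 wc) b2.
case v1: (occq 1); case v2: (occq 2).
- apply: good_occ_p2 => //; apply: case00_S => //.
  (* Without order p^2 q^2 all points agree modulo p or all agree modulo q, against [w2] or [v2]. *)
  apply: contraT => w22; have [h|h] := grid w22.
    have [b b2 /difftP[x [y [xL yL]]]] := exists_difft w2.
    by rewrite {1}/ty (h x y xL yL) eqxx; case: ifP.
  have [a _ /difftP[x [y [xL yL _]]]] : exists2 a, a < 2 & difft L a.+1 2 by case/orP: v2; [exists 0 | exists 1].
  by rewrite /ty (h x y xL yL) eqxx; case: ifP.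
- by apply: (one 0) => //; [rewrite v2 | have := bound_snd; rewrite v1 v2].
- by apply: (one 1) => //; [rewrite v1 | have := bound_snd; rewrite v1 v2].
- case/exists_difft: w1 => b b2 wb; case: b b2 wb => [|[|//]] _ wb.
    by rewrite /occq wb in v1.
  by rewrite /occq wb in v2.
Qed.

End CaseNoPrimePower.

(** * One power of p and one power of q among the orders *)

Section CaseBothPrimes.
Variables A B : finType.
Notation X := ((A * A) * (B * B))%type.
Notation p := #|A|.
Notation q := #|B|.
Hypotheses (p_pr : prime p) (q_pr : prime q) (pq : p != q).
Implicit Types (f : X -> nat) (L S : {set X}).

Let p0 : 0 < p := prime_gt0 p_pr.
Let q0 : 0 < q := prime_gt0 q_pr.
Let p1 : 1 < p := prime_gt1 p_pr.
Let q1 : 1 < q := prime_gt1 q_pr.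

Section Big.
Variables S L : {set X}.
Hypotheses (ltpq : p < q) (sp : spectral_pair S L) (kE : #|L| = p ^ 2 * q).

Lemma marg10 f x : \sum_x f x = #|L| -> zer f 1 0 -> marg f 1 0 x = p * q.
Proof.
move=> fk /(_ x); rewrite marg00 fk kE -mulnn -mulnA => /eqP.
by rewrite eqn_pmul2l // => /eqP.
Qed.

Lemma marg01 f x : \sum_x f x = #|L| -> indq f 0 0 -> marg f 0 1 x = p ^ 2.
Proof.
move=> fk /(_ x); rewrite marg00 fk kE mulnC => /eqP.
by rewrite eqn_pmul2r // => /eqP.
Qed.

Section B1.
Hypotheses (w01 : difft L 0 1) (w02 : ~~ difft L 0 2).

Let kE1 : #|L| = p ^ 2 * q ^ (difft L 0 1 + difft L 0 2).
Proof. by rewrite kE w01 (negbTE w02). Qed.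

Let fibT x : typed true false [set y | (x, y) \in L].
Proof. by have := @fib_typed _ _ L x; rewrite w01 (negbTE w02). Qed.

Let fibC x : #|[set y | (x, y) \in L]| = q.
Proof. by rewrite (fib_full kE1) w01 (negbTE w02). Qed.

Lemma fib_ex1 x : exists y, (x, y) \in L.
Proof.
have /card_gt0P[y] : 0 < #|[set y | (x, y) \in L]| by rewrite fibC.
by rewrite inE => h; exists y.
Qed.

Lemma fib_line x x' y y' : (x, y) \in L -> (x', y') \in L -> y.1 = y'.1 -> (x', y) \in L.
Proof.
move=> h h' e; have h2 : y' \in [set y | (x', y) \in L] by rewrite inE.
have := typed_full y.2 (@fibT x') (fibC x') h2.
by rewrite inE -e -surjective_pairing.
Qed.

(** The fibres over Z_(p^2) are whole cosets of order q. Two fibres in the same class modulo q have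
    equal q-parts, so if order p^a is missing they lie in different classes. *)
Lemma difft_line (x x' : A * A) a : ty x x' = a -> ~~ difft L a 0 -> difft L a 2.
Proof.
move=> t n; have [y yL] := fib_ex1 x; have [y' yL'] := fib_ex1 x'.
have [e|ne] := eqVneq y.1 y'.1.
  case/negP: n; apply/difftP; exists (x, y), (x', y); split=> //=; first exact: fib_line yL yL' e.
  by apply/eqP; rewrite ty0.
by apply/difftP; exists (x, y), (x', y'); split=> //=; apply: ty2.
Qed.

(** The relations at p, q and p q give every class modulo p q the mass p, where order p^2 q^2 allows
    only p-cosets. *)
Lemma big_11 : difft L 1 0 -> ~~ difft L 2 0 -> good L #|L|.
Proof.
move=> w10 w20; have w11 : difft L 1 1 by apply: (difft_full q_pr kE1); rewrite // ?w01.
have w22 : difft L 2 2.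
  have [a _] := card_gt0P p0; have [a' aa'] := other_elt a p1.
  by apply: (@difft_line (a', a) (a, a)) => //; apply: ty2.
apply: (@good_intro _ _ _ _ true true true false); first by rewrite !pow_bool kE.
move=> f fk z; have z10 := z 1 0 isT w10; have z01 := z 0 1 isT w01.
have z11 := z 1 1 isT w11; have z22 := z 2 2 isT w22.
have ip : indp f 1 2.
  apply: (fibered_indp (fibered_zer1 (a := 1) (b := 1) (a0 := 1) (b0 := 1) p_pr q_pr isT isT z22 isT isT)) => x al be.
  rewrite mul1n => e; apply: (rep_p p_pr q_pr pq (al := al)); rewrite -e.
  have e1 : p * marg f 1 0 x = marg f 0 0 x := z10 x.
  have e2 : q * marg f 0 1 x = marg f 0 0 x := z01 x.
  have e3 : p * q * marg f 1 1 x + marg f 0 0 x = q * marg f 0 1 x + p * marg f 1 0 x := z11 x.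
  move: e3; rewrite e1 e2 => /addIn; rewrite marg00 fk kE -mulnn mulnAC => /eqP.
  by rewrite eqn_pmul2r // eqn_pmul2l // => /eqP.
split=> //; last split=> // _ _.
- by move=> _; apply: (indp_zer (b := 2) ip).
- by apply: (indp_zer (b := 2) ip).
Qed.

Lemma big_21 : difft L 2 0 -> ~~ difft L 1 0 -> good L #|L|.
Proof.
move=> w20 w10; have w21 : difft L 2 1 by apply: (difft_full q_pr kE1); rewrite // ?w01.
have w12 : difft L 1 2.
  have [a _] := card_gt0P p0; have [a' aa'] := other_elt a p1.
  by apply: (@difft_line (a, a') (a, a)) => //; apply: ty1; rewrite // xpair_eqE eqxx.
apply: (@good_intro _ _ _ _ true true true false); first by rewrite !pow_bool kE.
move=> f fk z; have z20 := z 2 0 isT w20; have z01 := z 0 1 isT w01.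
have z21 := z 2 1 isT w21; have z12 := z 1 2 isT w12.
have ip : indp f 0 2.
  apply: (fibered_indp (fibered_zer1 (a := 0) (b := 1) (a0 := 0) (b0 := 1) p_pr q_pr isT isT z12 isT isT)) => x al be.
  by rewrite mul1n marg01 // => e; apply: rep_pp e.
split=> //; last split=> // _ _.
- by move=> _; apply: (indp_zer (b := 2) ip).
- by apply: (indp_zer (b := 2) ip).
Qed.

End B1.

Section B2.
Hypotheses (w01 : ~~ difft L 0 1) (w02 : difft L 0 2).

Let kE1 : #|L| = p ^ 2 * q ^ (difft L 0 1 + difft L 0 2).
Proof. by rewrite kE w02 (negbTE w01). Qed.

Let fibT x : typed false true [set y | (x, y) \in L].
Proof. by have := @fib_typed _ _ L x; rewrite w02 (negbTE w01). Qed.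

Let fibC x : #|[set y | (x, y) \in L]| = q.
Proof. by rewrite (fib_full kE1) w02 (negbTE w01). Qed.

Lemma fib_ex2 x : exists y, (x, y) \in L.
Proof.
have /card_gt0P[y] : 0 < #|[set y | (x, y) \in L]| by rewrite fibC.
by rewrite inE => h; exists y.
Qed.

(** The fibres are now transversals of the classes modulo q: each has points inside and outside the
    class of a given y. *)
Lemma difft_trans2 (x x' : A * A) : difft L (ty x x') 2.
Proof.
have [y yL] := fib_ex2 x.
have [y' + t] := typed_hit2 (b1 := false) y q1 (@fibT x') (fibC x').
by rewrite inE => yL'; apply/difftP; exists (x, y), (x', y').
Qed.

Lemma difft_trans1 (x x' : A * A) : ~~ difft L (ty x x') 0 -> difft L (ty x x') 1.
Proof.
move=> n; have [y yL] := fib_ex2 x.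
have [y' + e] := typed_transversal y.1 (@fibT x') (fibC x').
rewrite inE => yL'; have [ey|ne] := eqVneq y y'.
  case/negP: n; apply/difftP; exists (x, y), (x', y'); split=> //=.
  by apply/eqP; rewrite ty0 ey.
by apply/difftP; exists (x, y), (x', y'); split=> //=; apply: ty1.
Qed.

(** Equidistribution from q^2 climbs through p q^2 and p^2 q^2, so q divides all masses modulo p^2
    q. Taking n = q in [fibered] then reduces the mass p q of a class modulo p to p. *)
Lemma big_12 : difft L 1 0 -> ~~ difft L 2 0 -> good L #|L|.
Proof.
move=> w10 w20.
have [a _] := card_gt0P p0; have [a' aa'] := other_elt a p1.
have t1 : ty (a, a') (a, a) = 1 by apply: ty1; rewrite // xpair_eqE eqxx.
have t2 : ty (a', a) (a, a) = 2 by apply: ty2.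
have w12 : difft L 1 2 by have := difft_trans2 (a, a') (a, a); rewrite t1.
have w22 : difft L 2 2 by have := difft_trans2 (a', a) (a, a); rewrite t2.
have w21 : difft L 2 1 by have := @difft_trans1 (a', a) (a, a); rewrite t2; apply.
apply: (@good_intro _ _ _ _ true true false true); first by rewrite !pow_bool kE.
move=> f fk z; have z10 := z 1 0 isT w10; have z02 := z 0 2 isT w02.
have z21 := z 2 1 isT w21; have z12 := z 1 2 isT w12; have z22 := z 2 2 isT w22.
have iq := zer_indq p0 z22 (zer_indq p0 z12 (z02 : indq f 0 1)).
have dv x : q %| marg f 2 1 x by rewrite -iq dvdn_mulr.
have ip : indp f 1 1.
  apply: (fibered_indp (fibered_zer (a := 1) (b := 0) (a0 := 1) (b0 := 0) isT isT q0 p0 q0 dv z21 isT isT)) => x al be.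
  rewrite marg10 // mulnC => /eqP; rewrite eqn_pmul2l // => /eqP e.
  exact: rep_p e.
split; [by move=> _; apply: z10 | move=> _ | by [] | by move=> _; apply: z02 |].
  by apply: (indp_zer (b := 1) ip).
by split.
Qed.

Lemma big_22 : difft L 2 0 -> ~~ difft L 1 0 -> good L #|L|.
Proof.
move=> w20 w10.
have [a _] := card_gt0P p0; have [a' aa'] := other_elt a p1.
have t1 : ty (a, a') (a, a) = 1 by apply: ty1; rewrite // xpair_eqE eqxx.
have t2 : ty (a', a) (a, a) = 2 by apply: ty2.
have w12 : difft L 1 2 by have := difft_trans2 (a, a') (a, a); rewrite t1.
have w22 : difft L 2 2 by have := difft_trans2 (a', a) (a, a); rewrite t2.
have w11 : difft L 1 1 by have := @difft_trans1 (a, a') (a, a); rewrite t1; apply.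
apply: (@good_intro _ _ _ _ true true false true); first by rewrite !pow_bool kE.
move=> f fk z; have z20 := z 2 0 isT w20; have z02 := z 0 2 isT w02.
have z11 := z 1 1 isT w11; have z12 := z 1 2 isT w12; have z22 := z 2 2 isT w22.
have iq := zer_indq p0 z12 (z02 : indq f 0 1).
have dv x : q %| marg f 1 1 x by rewrite -iq dvdn_mulr.
have ip : indp f 0 1.
  apply: (fibered_indp (fibered_zer (a := 0) (b := 0) (a0 := 0) (b0 := 0) isT isT q0 p0 q0 dv z11 isT isT)) => x al be.
  rewrite marg00 fk kE mulnC => /eqP; rewrite eqn_pmul2l // => /eqP e.
  exact: rep_pp e.
split; [move=> _ | by move=> _; apply: z20 | by [] | by move=> _; apply: z02 |].
  by apply: (indp_zer (b := 1) ip).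
by split.
Qed.

End B2.
End Big.

Section Small.
Variables S L : {set X}.
Hypotheses (sp : spectral_pair S L).
Hypotheses (klt : #|L| < p ^ 2 * q) (klt' : #|L| < p * q ^ 2).
Hypotheses (dp : p %| #|L|) (dq : q %| #|L|).

Let k0 : 0 < #|L|. Proof. by case: sp. Qed.

Lemma small_m : exists m, [/\ #|L| = p * q * m, 0 < m, m < p & m < q].
Proof.
have /dvdnP[m km] : p * q %| #|L|.
  by rewrite -[p]expn1 -[q]expn1; apply: dvd_pow.
exists m; split; first by rewrite mulnC.
- by rewrite lt0n; apply: contraTneq k0 => m0; rewrite km m0.
- by have := klt; rewrite km -mulnn -mulnA ltn_pmul2r // muln_gt0 p0.
- by have := klt'; rewrite km -mulnn [X in _ < X]mulnCA ltn_pmul2r // muln_gt0 p0.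
Qed.

Lemma kpqE : #|L| <= p * q -> #|L| = p * q.
Proof.
move=> h; apply/eqP; rewrite eqn_leq h dvdn_leq //.
by rewrite -[p]expn1 -[q]expn1; apply: dvd_pow.
Qed.

Lemma not_q2 : q ^ 2 %| #|L| -> False.
Proof.
move=> d; have : p ^ 1 * q ^ 2 %| #|L| by apply: dvd_pow; rewrite ?expn1.
by move/(dvdn_leq k0); rewrite expn1 leqNgt klt'.
Qed.

(** A class modulo p has mass q m with m < p; q m = al p + be q makes q divide al, hence al = 0. *)
Lemma indq_small f b : \sum_x f x = #|L| -> zer f 1 0 -> b < 2 -> zer f 2 b.+1 -> indq f 2 b.
Proof.
move=> fk z10 b2 z; have [m [km _ mp mq]] := small_m.
apply: (fibered_indq (fibered_zer1 (a := 1) (a0 := 1) (b0 := 0) p_pr q_pr isT b2 z isT isT)) => x al be.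
rewrite mul1n => e; apply: (rep_qm p_pr q_pr pq mp (be := be)); rewrite -e.
have := z10 x; rewrite marg00 fk km -mulnA => /eqP.
by rewrite eqn_pmul2l // => /eqP.
Qed.

Lemma no_z12 f : \sum_x f x = #|L| -> zer f 0 1 -> zer f 0 2 -> False.
Proof.
move=> fk z z'; apply: not_q2; rewrite -fk.
by have [_ _] := dvd_zerq f; apply.
Qed.

Lemma small_pw : [/\ #|L| = p * q, ~~ difft L 2 0 & ~~ difft L 0 1] ->
  difft L 1 0 -> difft L 0 2 -> (forall f, \sum_x f x = #|L| -> zerD L f -> zer f 1 2) -> good L #|L|.
Proof.
case=> kE w20 w01 w10 w02 h.
apply: (@good_intro _ _ _ _ true false false true); first by rewrite !pow_bool kE.
move=> f fk z; split=> //; first by move=> _; apply: z.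
  by move=> _; apply: z.
by split=> // _ _; apply: h.
Qed.

(** Order p^2 q would yield vanishing at q besides q^2, too much for the size. Without it the first
    q-digit and second p-digit determine a point, so |L| = p q and all such pairs occur. Two points
    differing in both entries have a difference of order p q^2 or p^2 q^2, and either gives
    vanishing at p q^2. *)
Lemma small_12 : difft L 1 0 -> difft L 0 2 -> ~~ difft L 2 0 -> ~~ difft L 0 1 -> good L #|L|.
Proof.
move=> w10 w02 w20 w01; have [_ _ zS _] := sp; have fk := spectral_pair_total sp.
have w21 : ~~ difft L 2 1.
  apply/negP => w; apply: (no_z12 fk); last exact: zS.
  have iq := indq_small (b := 0) fk (zS 1 0 isT w10) isT (zS 2 1 isT w).
  by apply: (indq_zer (c := 0) iq).
have inj : {in L &, injective (fun x => (x.2.1, x.1.2))}.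
  move=> x y xL yL /= [ev es]; have := difft_mem xL yL.
  have [e2|n2] := eqVneq x.2 y.2.
    rewrite e2 {2}/ty eqxx; have [eu|nu] := eqVneq x.1.1 y.1.1; last first.
      by rewrite (ty2 nu) (negbTE w20).
    by case: (x) (y) eu es e2 => [[u s] ?] [[u' s'] ?] /= -> -> ->.
  rewrite (ty1 ev n2); have [eu|nu] := eqVneq x.1.1 y.1.1; last first.
    by rewrite (ty2 nu) (negbTE w21).
  have -> : ty x.1 y.1 = 0.
    by apply/eqP; rewrite ty0; case: (x.1) (y.1) eu es => [? ?] [? ?] /= -> ->.
  by rewrite (negbTE w01).
have kE : #|L| = p * q by apply: kpqE; rewrite mulnC -card_prod; apply: card_inj_le inj.
apply: small_pw => // f gk z.
have sur : (fun x : X => (x.2.1, x.1.2)) @: L = [set: B * A].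
  by apply/eqP; rewrite eqEcard subsetT cardsT card_prod (card_in_imset inj) kE mulnC leqnn.
have [l /[dup] lL _] := card_gt0P k0.
have [v' vv'] := other_elt l.2.1 q1; have [s' ss'] := other_elt l.1.2 p1.
have : (v', s') \in (fun x : X => (x.2.1, x.1.2)) @: L by rewrite sur inE.
case/imsetP=> l' lL' [ev es]; have := difft_mem lL lL'.
rewrite [ty l.2 _]ty2; last by rewrite -ev eq_sym.
have [eu|nu] := eqVneq l.1.1 l'.1.1.
  rewrite ty1 //; first by move=> w; apply: z.
  by apply: contraNneq ss' => e; rewrite es e.
rewrite (ty2 nu) => w.
have iq := indq_small (b := 1) gk (z 1 0 isT w10) isT (z 2 2 isT w).
by apply: (indq_zer (c := 1) iq).
Qed.

(** If order p q occurred, all masses modulo p and modulo q would be multiples of p q; the size then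
    leaves an empty class of each kind, where the relation reads |L| = 0. Without it the first
    digits determine a point, and two points differing in both have order p^2 q^2. *)
Lemma small_22 : difft L 2 0 -> difft L 0 2 -> ~~ difft L 1 0 -> ~~ difft L 0 1 -> good L #|L|.
Proof.
move=> w20 w02 w10 w01; have [_ _ zS _] := sp; have fk := spectral_pair_total sp.
have [m [km m0 mp mq]] := small_m.
have w11 : ~~ difft L 1 1.
  apply/negP => w; set f := ind S in fk zS.
  have z20 := zS 2 0 isT w20; have z02 := zS 0 2 isT w02; have z11 := zS 1 1 isT w.
  have dc1 x : q %| marg f 1 0 x /\ p %| marg f 0 1 x.
    have := z11 x => /=; rewrite marg00 fk km => e.
    have e1 : p * marg f 2 0 x = marg f 1 0 x := z20 x.
    have e2 : q * marg f 0 2 x = marg f 0 1 x := z02 x.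
    split.
      have : q %| p * marg f 1 0 x.
        rewrite -(dvdn_addr _ (dvdn_mulr (marg f 0 1 x) (dvdnn q))) -e.
        by rewrite dvdn_add // -?mulnA dvdn_mull // dvdn_mulr.
      by rewrite Gauss_dvdr // coprime_sym coprime_pq.
    have : p %| q * marg f 0 1 x.
      rewrite -(dvdn_addl _ (dvdn_mulr (marg f 1 0 x) (dvdnn p))) -e.
      by rewrite dvdn_add // -?mulnA dvdn_mulr.
    by rewrite Gauss_dvdr // coprime_pq.
  have dpq x : p * q %| marg f 1 0 x /\ p * q %| marg f 0 1 x.
    have [d1 d2] := dc1 x; split.
      by rewrite Gauss_dvd ?coprime_pq // d1 -(z20 x) dvdn_mulr.
    by rewrite Gauss_dvd ?coprime_pq // d2 -(z02 x) dvdn_mulr.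
  have [x0] := inhabited_coords p_pr q_pr.
  have [x /eqP cx|pos] := pickP (fun x => marg f 1 0 x == 0); last first.
    have : p * (p * q) <= #|L|.
      rewrite -fk -(marg00 f x0) marg_split_p // -sum_nat_const; apply: leq_sum => i _.
      by apply: dvdn_leq; [rewrite lt0n pos | case: (dpq (upd 0 x0.1 i, x0.2))].
    by rewrite mulnA mulnn leqNgt klt.
  have [y /eqP cy|pos] := pickP (fun x => marg f 0 1 x == 0); last first.
    have : q * (p * q) <= #|L|.
      rewrite -fk -(marg00 f x0) marg_split_q // -sum_nat_const; apply: leq_sum => i _.
      by apply: dvdn_leq; [rewrite lt0n pos | case: (dpq (x0.1, upd 0 x0.2 i))].
    by rewrite mulnCA mulnn leqNgt klt'.
  have := z11 (x.1, y.2) => /=.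
  rewrite [marg f 0 1 _](@marg_eqv _ _ f 0 1 _ y) ?eqv_refl // cy.
  rewrite [marg f 1 0 _](@marg_eqv _ _ f 1 0 _ x) ?eqv_refl // cx !muln0 marg00 fk => /eqP.
  by rewrite addn_eq0 => /andP[_ /eqP k00]; have := k0; rewrite k00.
have inj : {in L &, injective (fun x => (x.1.1, x.2.1))}.
  move=> x y xL yL /= [eu ev]; have := difft_mem xL yL.
  have [e2|n2] := eqVneq x.2 y.2.
    rewrite e2 {2}/ty eqxx; have [e1|n1] := eqVneq x.1 y.1; last first.
      by rewrite (ty1 eu n1) (negbTE w10).
    by case: (x) (y) e1 e2 => [? ?] [? ?] /= -> ->.
  rewrite (ty1 ev n2); have [e1|n1] := eqVneq x.1 y.1; last first.
    by rewrite (ty1 eu n1) (negbTE w11).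
  by rewrite e1 /ty eqxx (negbTE w01).
have kE : #|L| = p * q by apply: kpqE; rewrite -card_prod; apply: card_inj_le inj.
have sur : (fun x : X => (x.1.1, x.2.1)) @: L = [set: A * B].
  by apply/eqP; rewrite eqEcard subsetT cardsT card_prod (card_in_imset inj) kE leqnn.
have w22 : difft L 2 2.
  have [l /[dup] lL _] := card_gt0P k0.
  have [v' vv'] := other_elt l.2.1 q1; have [u' uu'] := other_elt l.1.1 p1.
  have : (u', v') \in (fun x : X => (x.1.1, x.2.1)) @: L by rewrite sur inE.
  case/imsetP=> l' lL' [eu ev]; have := difft_mem lL' lL.
  by rewrite !ty2 // -?ev -?eu.
apply: (@good_intro _ _ _ _ false true false true); first by rewrite !pow_bool kE.
move=> f gk z; split=> //; [by move=> _; apply: z | by move=> _; apply: z |].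
by split=> // _ _; apply: z.
Qed.

(** [sym] is [indq_small] with p and q exchanged, supplied by the caller from the swapped pair.
    Order p^2 q^2 would give vanishing at q^2; without it [grid] makes the second digits determine a
    point. *)
Lemma small_11 : (forall f, \sum_x f x = #|L| -> zer f 0 1 -> zer f 1 2 -> zer f 1 1) ->
  difft L 1 0 -> difft L 0 1 -> ~~ difft L 2 0 -> ~~ difft L 0 2 -> good L #|L|.
Proof.
move=> sym w10 w01 w20 w02; have [_ _ zS _] := sp; have fk := spectral_pair_total sp.
have w22 : ~~ difft L 2 2.
  apply/negP => w; apply: (no_z12 fk); first exact: zS.
  have iq := indq_small (b := 1) fk (zS 1 0 isT w10) isT (zS 2 2 isT w).
  by apply: (indq_zer (c := 0) iq).
have inj : {in L &, injective (fun x => (x.1.2, x.2.2))}.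
  move=> x y xL yL /= [es et]; have := difft_mem xL yL; case: (grid w22) => h.
    have eu := h x y xL yL; have e1 : x.1 = y.1.
      by case: (x.1) (y.1) eu es => [? ?] [? ?] /= -> ->.
    rewrite e1 {1}/ty eqxx; have [ev|nv] := eqVneq x.2.1 y.2.1; last first.
      by rewrite (ty2 nv) (negbTE w02).
    by case: (x) (y) e1 ev et => [? [? ?]] [? [? ?]] /= -> -> ->.
  have ev := h x y xL yL; have e2 : x.2 = y.2.
    by case: (x.2) (y.2) ev et => [? ?] [? ?] /= -> ->.
  rewrite e2 {2}/ty eqxx; have [eu|nu] := eqVneq x.1.1 y.1.1; last first.
    by rewrite (ty2 nu) (negbTE w20).
  by case: (x) (y) e2 eu es => [[? ?] ?] [[? ?] ?] /= -> -> ->.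
have kE : #|L| = p * q by apply: kpqE; rewrite -card_prod; apply: card_inj_le inj.
(* Otherwise any two points agree in the p-part or in the q-part; a pair of order p then forces one
   common q-part, excluding order q. *)
have some : [|| difft L 1 1, difft L 1 2 | difft L 2 1].
  apply: contraT; rewrite !negb_or => /and3P[w11 w12 w21].
  have K x y : x \in L -> y \in L -> (x.1 == y.1) || (x.2 == y.2).
    move=> xL yL; have := difft_mem xL yL; rewrite -!ty0.
    have := ty_le2 x.1 y.1; have := ty_le2 x.2 y.2.
    by case: (ty x.1 y.1) => [|[|[|]]] //; case: (ty x.2 y.2) => [|[|[|]]] // _ _; apply: contraTT.
  case/difftP: w10 => a [b [aL bL tab /eqP]]; rewrite ty0 => /eqP e2.
  have nab : a.1 != b.1 by rewrite -ty0 tab.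
  have E x : x \in L -> x.2 = a.2.
    move=> xL; have := K x a xL aL; have := K x b xL bL; rewrite -e2.
    case: (x.2 =P a.2) => // _; rewrite !orbF => /eqP h1 /eqP h2.
    by rewrite -h2 h1 eqxx in nab.
  case/difftP: w01 => c [d [cL dL _]]; rewrite (E c cL) (E d dL).
  by rewrite /ty eqxx.
apply: (@good_intro _ _ _ _ true false true false); first by rewrite !pow_bool kE.
move=> f gk z; have z10 := z 1 0 isT w10; have z01 := z 0 1 isT w01.
split=> //; split=> // _ _.
case/or3P: some => w; first exact: z.
  by apply: sym => //; apply: z.
have iq := indq_small (b := 0) gk z10 isT (z 2 1 isT w).
by apply: (indq_zer (c := 1) iq).
Qed.

End Small.
End CaseBothPrimes.

(** * Assembling the cases *)

Section Combine.
Variables A B : finType.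
Notation X := ((A * A) * (B * B))%type.
Notation p := #|A|.
Notation q := #|B|.
Hypotheses (p_pr : prime p) (q_pr : prime q) (pq : p != q).
Variables S L : {set X}.
Hypothesis sp : spectral_pair S L.

Let qp : q != p. Proof. by rewrite eq_sym. Qed.

Lemma card_sw (T : {set X}) : #|[set sw x | x in T]| = #|T|.
Proof. by apply: card_imset; apply: sw_inj. Qed.

Lemma good_small : #|L| < p ^ 2 * q -> #|L| < p * q ^ 2 ->
  difft L 1 0 != difft L 2 0 -> difft L 0 1 != difft L 0 2 -> good L #|L|.
Proof.
move=> klt klt' occp occq; have sp' := spectral_pair_sw sp.
have klt1 : #|[set sw x | x in L]| < q ^ 2 * p by rewrite card_sw mulnC.
have klt2 : #|[set sw x | x in L]| < q * p ^ 2 by rewrite card_sw mulnC.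
have dp : p %| #|L| by have := spectral_pair_dvdp sp; move: occp; case: (difft L 1 0); case: (difft L 2 0).
have dq : q %| #|L| by have := spectral_pair_dvdq sp; move: occq; case: (difft L 0 1); case: (difft L 0 2).
have dp' : p %| #|[set sw x | x in L]| by rewrite card_sw.
have dq' : q %| #|[set sw x | x in L]| by rewrite card_sw.
case w10: (difft L 1 0); case w20: (difft L 2 0); rewrite ?w10 ?w20 // in occp;
  case w01: (difft L 0 1); case w02: (difft L 0 2); rewrite ?w01 ?w02 // in occq.
- apply: (small_11 p_pr q_pr pq sp klt klt' dp dq); rewrite ?w10 ?w01 ?w20 ?w02 // => f fk z z'.
  apply/zer_sw.
  have fk' : \sum_x fsw f x = #|[set sw x | x in L]| by rewrite sum_fsw card_sw.
  have iq : indq (fsw f) 2 0.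
    by apply: (indq_small q_pr p_pr qp sp' klt1 klt2 dq' dp' fk') => //; apply/zer_sw.
  by apply: (indq_zer iq).
- by apply: (small_12 p_pr q_pr pq sp klt klt' dp dq); rewrite ?w10 ?w01 ?w20 ?w02.
- apply: good_sw; rewrite -(card_sw L).
  by apply: (small_12 q_pr p_pr qp sp' klt1 klt2 dq' dp'); rewrite difft_sw ?w10 ?w01 ?w20 ?w02.
- by apply: (small_22 p_pr q_pr pq sp klt klt' dp dq); rewrite ?w10 ?w01 ?w20 ?w02.
Qed.

End Combine.

Lemma good_big (A B : finType) (S L : {set (A * A) * (B * B)}) :
  prime #|A| -> prime #|B| -> #|A| < #|B| -> spectral_pair S L ->
  #|A| ^ 2 * #|B| <= #|L| -> difft L 1 0 != difft L 2 0 -> difft L 0 1 != difft L 0 2 -> good L #|L|.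
Proof.
move=> p_pr q_pr lt sp le occp occq.
have pq : #|A| != #|B| by rewrite neq_ltn lt.
have kE : #|L| = #|A| ^ 2 * #|B|.
  apply/eqP; rewrite eqn_leq le andbT; have := card_le_fib L.
  by move: occq; case: (difft L 0 1); case: (difft L 0 2).
case w10: (difft L 1 0); case w20: (difft L 2 0); rewrite ?w10 ?w20 // in occp;
  case w01: (difft L 0 1); case w02: (difft L 0 2); rewrite ?w01 ?w02 // in occq.
- by apply: big_11; rewrite ?w10 ?w01 ?w20 ?w02.
- by apply: big_12; rewrite ?w10 ?w01 ?w20 ?w02.
- by apply: big_21; rewrite ?w10 ?w01 ?w20 ?w02.
- by apply: big_22; rewrite ?w10 ?w01 ?w20 ?w02.
Qed.

Lemma good_11_lt (A B : finType) (S L : {set (A * A) * (B * B)}) :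
  prime #|A| -> prime #|B| -> #|A| < #|B| -> spectral_pair S L ->
  difft L 1 0 != difft L 2 0 -> difft L 0 1 != difft L 0 2 -> good L #|L|.
Proof.
move=> p_pr q_pr lt sp occp occq.
have [le|klt] := leqP (#|A| ^ 2 * #|B|) #|L|; first exact: good_big sp le occp occq.
have klt' : #|L| < #|A| * #|B| ^ 2.
  apply: ltn_trans klt _; rewrite -!mulnn -mulnA ltn_pmul2l ?prime_gt0 //.
  by rewrite ltn_pmul2r ?prime_gt0.
by apply: (good_small p_pr q_pr _ sp klt klt' occp occq); rewrite neq_ltn lt.
Qed.

Lemma spectral_good (A B : finType) (S L : {set (A * A) * (B * B)}) :
  prime #|A| -> prime #|B| -> #|A| != #|B| -> spectral_pair S L -> good L #|L|.
Proof.
move=> p_pr q_pr pq sp.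
have qp : #|B| != #|A| by rewrite eq_sym.
have sp' := spectral_pair_sw sp.
have swap : good [set sw x | x in L] #|[set sw x | x in L]| -> good L #|L|.
  by rewrite card_sw; apply: good_sw.
have [w12|w12] := boolP (difft L 1 0 && difft L 2 0).
  by case/andP: w12 => w10 w20; apply: good_p2 sp w10 w20.
have [v12|v12] := boolP (difft L 0 1 && difft L 0 2).
  by case/andP: v12 => w01 w02; apply: swap; apply: good_p2 sp' _ _; rewrite // difft_sw.
have [occp|occp] := eqVneq (difft L 1 0) (difft L 2 0); have [occq|occq] := eqVneq (difft L 0 1) (difft L 0 2).
- rewrite occp andbb in w12; rewrite occq andbb in v12; rewrite -occp in w12; rewrite -occq in v12.
  have w20 : ~~ difft L 2 0 by rewrite -occp.
  have w02 : ~~ difft L 0 2 by rewrite -occq.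
  case: (ltngtP #|A| #|B|) => [lt|lt|e]; last by rewrite e eqxx in pq.
    exact: (good_00 p_pr q_pr lt sp).
  by apply: swap; apply: (good_00 q_pr p_pr lt sp'); rewrite // difft_sw.
- have w20 : ~~ difft L 2 0 by move: w12; rewrite occp andbb.
  have w10 : ~~ difft L 1 0 by rewrite occp.
  case w01: (difft L 0 1); case w02: (difft L 0 2); rewrite ?w01 ?w02 // in occq.
    by apply: swap; apply: (good_10 q_pr p_pr qp sp'); rewrite // difft_sw // w02.
  by apply: swap; apply: (good_20 q_pr p_pr qp sp'); rewrite // difft_sw // w01.
- have w02 : ~~ difft L 0 2 by move: v12; rewrite occq andbb.
  have w01 : ~~ difft L 0 1 by rewrite occq.
  case w10: (difft L 1 0); case w20: (difft L 2 0); rewrite ?w10 ?w20 // in occp.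
    by apply: (good_10 p_pr q_pr pq sp); rewrite // w20.
  by apply: (good_20 p_pr q_pr pq sp); rewrite // w10.
- case: (ltngtP #|A| #|B|) => [lt|lt|e]; last by rewrite e eqxx in pq.
    exact: good_11_lt lt sp occp occq.
  by apply: swap; apply: good_11_lt lt sp' _ _; rewrite // !difft_sw.
Qed.

(** * Layers modulo r *)

Section Kernel.
Local Open Scope ring_scope.

(* kap a is the Ramanujan sum of order #|A| ^ a, as a function of the class of x - y. *)
Definition kap (A : finType) (a : nat) (x y : A * A) : int :=
  if a is a'.+1 then (#|A| ^ a')%:Z * (#|A|%:Z * (eqv a x y)%:Z - (eqv a' x y)%:Z) else 1.

Definition kapr (C : finType) (c : bool) (i j : C) : int :=
  if c then #|C|%:Z * (i == j)%:Z - 1 else 1.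

Definition ker5 (A B C : finType) a b c (x y : (A * A) * (B * B) * C) : int :=
  kap a x.1.1 y.1.1 * kap b x.1.2 y.1.2 * kapr c x.2 y.2.

Definition zer5 (A B C : finType) (S : {set (A * A) * (B * B) * C}) a b c :=
  forall x, \sum_(y in S) ker5 a b c x y = 0.

End Kernel.

(* (T1) and (T2) of Coven and Meyerowitz. *)
Definition CM5 (A B C : finType) (S : {set (A * A) * (B * B) * C}) :=
  exists P1 P2 Q1 Q2 R1 : bool,
  #|S| = #|A| ^ (P1 + P2) * #|B| ^ (Q1 + Q2) * #|C| ^ R1 /\
  forall a b c, a <= 2 -> b <= 2 -> (0 < a + b) || c ->
    sel P1 P2 a -> sel Q1 Q2 b -> (c -> R1) -> zer5 S a b c.

Definition spectral5 (A B C : finType) (S L : {set (A * A) * (B * B) * C}) :=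
  [/\ #|S| = #|L|, 0 < #|L|,
      forall x y, x \in L -> y \in L -> x != y ->
        zer5 S (ty x.1.1 y.1.1) (ty x.1.2 y.1.2) (x.2 != y.2) &
      forall x y, x \in S -> y \in S -> x != y ->
        zer5 L (ty x.1.1 y.1.1) (ty x.1.2 y.1.2) (x.2 != y.2)].

Section Layers.
Variables A B C : finType.
Notation X := ((A * A) * (B * B))%type.
Notation p := #|A|.
Notation q := #|B|.
Notation r := #|C|.
Hypotheses (p_pr : prime p) (q_pr : prime q) (r0 : 0 < r).
Implicit Types (f : X -> nat) (S L : {set X * C}).
Local Open Scope ring_scope.

Definition Rk f a b (x : X) : int := \sum_y kap a x.1 y.1 * kap b x.2 y.2 * (f y)%:Z.

Lemma marg_int f a b x : (marg f a b x)%:Z = \sum_y (eqv a x.1 y.1)%:Z * (eqv b x.2 y.2)%:Z * (f y)%:Z.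
Proof.
rewrite /marg big_mkcond /= -natz natr_sum; apply: eq_bigr => y _; rewrite natz.
by case: (eqv a _ _); case: (eqv b _ _); rewrite ?mul1r ?mul0r ?mulr0.
Qed.

Lemma Rk00 f x : Rk f 0 0 x = (marg f 0 0 x)%:Z.
Proof. by rewrite marg_int; apply: eq_bigr => y _; rewrite !mul1r. Qed.

Lemma RkS0 f a x : Rk f a.+1 0 x = (p ^ a)%:Z * (p%:Z * (marg f a.+1 0 x)%:Z - (marg f a 0 x)%:Z).
Proof.
rewrite !marg_int mulr_sumr -sumrB mulr_sumr; apply: eq_bigr => y _.
by rewrite /kap -[(eqv 0 x.2 y.2)%:Z]/(1 : int); ring.
Qed.

Lemma Rk0S f b x : Rk f 0 b.+1 x = (q ^ b)%:Z * (q%:Z * (marg f 0 b.+1 x)%:Z - (marg f 0 b x)%:Z).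
Proof.
rewrite !marg_int mulr_sumr -sumrB mulr_sumr; apply: eq_bigr => y _.
by rewrite /kap -[(eqv 0 x.1 y.1)%:Z]/(1 : int); ring.
Qed.

Lemma RkSS f a b x : Rk f a.+1 b.+1 x = (p ^ a)%:Z * (q ^ b)%:Z *
  ((p * q * marg f a.+1 b.+1 x + marg f a b x)%N%:Z - (q * marg f a b.+1 x + p * marg f a.+1 b x)%N%:Z).
Proof.
rewrite !PoszD !PoszM !marg_int !mulr_sumr -!big_split /= -sumrB mulr_sumr.
by apply: eq_bigr => y _; rewrite /kap; ring.
Qed.

(** [zer] is the vanishing of these integer sums after removing nonzero factors and moving the
    negative terms to the other side. *)
Lemma Rk_zer f a b : (forall x, Rk f a b x = 0) <-> zer f a b.
Proof.
have p0 n : (p ^ n)%:Z != 0 by rewrite -lt0n expn_gt0 prime_gt0.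
have q0 n : (q ^ n)%:Z != 0 by rewrite -lt0n expn_gt0 prime_gt0.
have E (u : int) (m n : nat) : u != 0 -> (u * (m%:Z - n%:Z) == 0) = (m == n).
  by move=> u0; rewrite mulf_eq0 (negbTE u0) /= subr_eq0 eqz_nat.
split=> h x; have := h x; case: a {h} => [|a]; case: b => [|b] /=.
- by rewrite Rk00 => -[].
- by rewrite Rk0S -PoszM => /eqP; rewrite E // => /eqP.
- by rewrite RkS0 -PoszM => /eqP; rewrite E // => /eqP.
- by rewrite RkSS => /eqP; rewrite E ?mulf_neq0 // => /eqP.
- by rewrite Rk00 => ->.
- by rewrite Rk0S -PoszM => e; apply/eqP; rewrite E //; apply/eqP.
- by rewrite RkS0 -PoszM => e; apply/eqP; rewrite E //; apply/eqP.
- by rewrite RkSS => e; apply/eqP; rewrite E ?mulf_neq0 //; apply/eqP.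
Qed.

Definition layer S (j : C) (x : X) : nat := (x, j) \in S.
Definition proj S (x : X) : nat := (\sum_j layer S j x)%N.

Lemma sum_layers S (F : X -> C -> int) :
  \sum_(y in S) F y.1 y.2 = \sum_j \sum_x F x j * (layer S j x)%:Z.
Proof.
rewrite big_mkcond /= exchange_big pair_bigA /=; apply: eq_bigr => -[x j] _ /=.
by rewrite /layer; case: (_ \in S); rewrite ?mulr1 ?mulr0.
Qed.

Lemma zer5F S a b x :
  \sum_(y in S) ker5 a b false x y = \sum_j Rk (layer S j) a b x.1.
Proof.
rewrite (@sum_layers S (fun y j => kap a x.1.1 y.1 * kap b x.1.2 y.2 * 1)).
by apply: eq_bigr => j _; apply: eq_bigr => y _; rewrite mulr1.
Qed.

Lemma zer5T S a b x :
  \sum_(y in S) ker5 a b true x y = r%:Z * Rk (layer S x.2) a b x.1 - \sum_j Rk (layer S j) a b x.1.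
Proof.
rewrite (@sum_layers S (fun y j => kap a x.1.1 y.1 * kap b x.1.2 y.2 * (r%:Z * (x.2 == j)%:Z - 1))).
transitivity (\sum_j (r%:Z * (x.2 == j)%:Z - 1) * Rk (layer S j) a b x.1).
  by apply: eq_bigr => j _; rewrite mulr_sumr; apply: eq_bigr => y _; ring.
under eq_bigr => j _ do rewrite mulrBl mul1r.
rewrite sumrB; congr (_ - _); rewrite (bigD1 x.2) //= eqxx mulr1 big1 ?addr0 // => j ne.
by rewrite eq_sym (negbTE ne) mulr0 mul0r.
Qed.

Lemma zer5_proj S a b : zer5 S a b false <-> zer (proj S) a b.
Proof.
have E x : \sum_j Rk (layer S j) a b x = Rk (proj S) a b x.
  rewrite exchange_big; apply: eq_bigr => y _ /=.
  rewrite -mulr_sumr; congr (_ * _); rewrite /proj -natz natr_sum.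
  by apply: eq_bigr => j _; rewrite natz.
rewrite -Rk_zer; split=> h x.
  by have [j _] := card_gt0P r0; have := h (x, j); rewrite zer5F E.
by rewrite zer5F E.
Qed.

(** The first hypothesis cancels the sum over all layers in the second, leaving r times the
    transform of one layer. *)
Lemma zer5_layers S a b : zer5 S a b false -> zer5 S a b true -> forall j, zer (layer S j) a b.
Proof.
move=> hF hT j; apply/Rk_zer => x; have := hF (x, j); have := hT (x, j).
rewrite zer5F zer5T /= => + e; rewrite e subr0 => /eqP; rewrite mulf_eq0 => /orP[|/eqP//].
by rewrite -[0]/(0%:Z) eqz_nat (gtn_eqF r0).
Qed.

Lemma layers_zer5 S a b c : (forall j, zer (layer S j) a b) -> zer5 S a b c.
Proof.
move=> h x; have R0 j y : Rk (layer S j) a b y = 0 by move: y; apply/Rk_zer.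
by case: c; rewrite ?zer5F ?zer5T ?R0 big1 ?mulr0 ?subr0 // => j _; rewrite R0.
Qed.

Definition empty_layer S := exists j, forall x, (x, j) \notin S.

(** Evaluated on the empty layer, the relation with factor r in the order reduces to the one without
    it. *)
Lemma empty_layers S a b : empty_layer S -> zer5 S a b true -> forall j, zer (layer S j) a b.
Proof.
case=> j0 e0 hT; apply: zer5_layers => // -[x j]; have := hT (x, j0).
rewrite zer5F zer5T /= [Rk (layer S j0) _ _ _]big1 ?mulr0 ?sub0r => [/eqP|y _]; last first.
  by rewrite /layer (negbTE (e0 y)) mulr0.
by rewrite oppr_eq0 => /eqP.
Qed.

Lemma empty_proj S a b c : empty_layer S -> zer5 S a b c -> zer (proj S) a b.
Proof.
move=> e; case: c => h; last exact/zer5_proj.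
by apply/zer5_proj; apply: layers_zer5; apply: empty_layers.
Qed.

Lemma sum_layer S j : (\sum_x layer S j x)%N = #|[set x | (x, j) \in S]|.
Proof.
by rewrite -sum1_card [RHS]big_mkcond; apply: eq_bigr => x _; rewrite inE /layer; case: (_ \in S).
Qed.

Lemma sum_proj S : (\sum_x proj S x)%N = #|S|.
Proof.
rewrite -sum1_card [RHS]big_mkcond /= pair_bigA /=; apply: eq_bigr => -[x j] _ /=.
by rewrite /layer; case: (_ \in S).
Qed.

Lemma zer5_00 S : zer5 S 0 0 true <-> forall j, (r * #|[set x | (x, j) \in S]|)%N = #|S|.
Proof.
have E x : \sum_(y in S) ker5 0 0 true x y = (r * #|[set y | (y, x.2) \in S]|)%N%:Z - #|S|%:Z.
  rewrite zer5T Rk00 marg00 sum_layer PoszM; congr (_ - _).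
  have -> : #|S| = (\sum_j \sum_x layer S j x)%N by rewrite -sum_proj exchange_big.
  rewrite -natz natr_sum.
  by apply: eq_bigr => j _; rewrite Rk00 marg00 natz.
have [x0] := inhabited_coords p_pr q_pr.
split=> [h j|h x]; last by rewrite E h subrr.
by have := h (x0, j); rewrite E => /eqP; rewrite subr_eq0 eqz_nat => /eqP.
Qed.

End Layers.

(** * Spectral sets satisfy (T1) and (T2) *)

Section SpectralCM.
Variables A B C : finType.
Notation X := ((A * A) * (B * B))%type.
Notation p := #|A|.
Notation q := #|B|.
Notation r := #|C|.
Hypotheses (p_pr : prime p) (q_pr : prime q) (pq : p != q).
Hypothesis ltr : p ^ 2 * q ^ 2 < r.
Implicit Types (S L : {set X * C}).

Let r0 : 0 < r := leq_ltn_trans (leq0n _) ltr.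

Lemma cardX : #|{: X}| = p ^ 2 * q ^ 2.
Proof. by rewrite card_prod !card_prod -!mulnn. Qed.

Lemma empty_layer_small S : #|S| < r -> empty_layer S.
Proof.
move=> lt; have [/forallP h|] := boolP [forall j, [exists x, (x, j) \in S]].
  have : [set: C] \subset [set x.2 | x in S].
    apply/subsetP => j _; have /existsP[x xS] := h j.
    by apply/imsetP; exists (x, j).
  move/subset_leq_card; rewrite cardsT leqNgt.
  by rewrite (leq_ltn_trans (leq_imset_card _ _) lt).
rewrite negb_forall => /existsP[j]; rewrite negb_exists => /forallP h.
by exists j.
Qed.

(** Two points of L over the same first component differ by order r; then all layers of S have the
    size of its empty layer. *)
Lemma fst_inj S L : 0 < #|L| -> empty_layer S -> empty_layer L ->
  #|S| = #|L| ->
  (forall x y, x \in L -> y \in L -> x != y ->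
        zer5 S (ty x.1.1 y.1.1) (ty x.1.2 y.1.2) (x.2 != y.2)) ->
  {in L &, injective (fun x => x.1)}.
Proof.
move=> L0 [j0 e0] eL e h x y xL yL /= exy; apply/eqP; apply: contraT => nxy.
have := h x y xL yL nxy; rewrite exy /ty !eqxx.
have -> : x.2 != y.2.
  by apply: contraNneq nxy => e2; case: (x) (y) exy e2 => [? ?] [? ?] /= -> ->.
move/(zer5_00 p_pr q_pr)/(_ j0).
rewrite (_ : [set x | _] = set0) ?cards0 ?muln0; last first.
  by apply/setP => z; rewrite !inE (negbTE (e0 z)).
by move=> e1; rewrite -e -e1 in L0.
Qed.

Lemma ind_fst S : {in S &, injective (fun x => x.1)} ->
  forall x, ind [set y.1 | y in S] x = proj S x.
Proof.
move=> inj x; rewrite /ind /proj /layer.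
case: (boolP (x \in _)) => [/imsetP[[z j] zS ->]|n] /=.
  rewrite (bigD1 j) //= zS big1 // => i ij; apply/eqP; rewrite eqb0.
  apply: contraNN ij => iS; apply/eqP; have := inj (z, j) (z, i) zS iS (erefl _).
  by case.
rewrite big1 // => j _; apply/eqP; rewrite eqb0; apply: contraNN n => h.
by apply/imsetP; exists (x, j).
Qed.

Lemma zerD_fst S L : empty_layer S ->
  {in S &, injective (fun x => x.1)} -> {in L &, injective (fun x => x.1)} ->
  (forall x y, x \in L -> y \in L -> x != y ->
        zer5 S (ty x.1.1 y.1.1) (ty x.1.2 y.1.2) (x.2 != y.2)) ->
  zerD [set x.1 | x in L] (ind [set x.1 | x in S]).
Proof.
move=> eS iS iL h a b ab /difftP[_ [_ [/imsetP[x xL ->] /imsetP[y yL ->] ea eb]]].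
apply: eq_zer (fun x => esym (ind_fst iS x)) _.
have nxy : x != y.
  by apply: contraTneq ab => e; rewrite -ea -eb e /ty !eqxx.
have := h x y xL yL nxy; rewrite ea eb.
exact: empty_proj.
Qed.

Lemma spectral_small S L : spectral5 S L -> #|S| < r -> CM5 S.
Proof.
case=> e L0 hS hL lt.
have S0 : 0 < #|S| by rewrite e.
have eS := empty_layer_small lt; have eL : empty_layer L by apply: empty_layer_small; rewrite -e.
have iL := fst_inj L0 eS eL e hS; have iS := fst_inj S0 eL eS (esym e) hL.
pose S' := [set x.1 | x in S]; pose L' := [set x.1 | x in L].
have zS : zerD L' (ind S') by apply: zerD_fst.
have sp : spectral_pair S' L'.
  split; rewrite ?(card_in_imset iS) ?(card_in_imset iL) //.
  exact: zerD_fst.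
have [P1 [P2 [Q1 [Q2 [ke h]]]]] := spectral_good p_pr q_pr pq sp.
exists P1, P2, Q1, Q2, false; split.
  by rewrite e -(card_in_imset iL) muln1.
move=> a b [] a2 b2 /=; rewrite ?orbT ?orbF => ab sa sb nc; first by have := nc isT.
apply/zer5_proj => //; apply: eq_zer (ind_fst iS) _; apply: h => //.
by rewrite sum_ind (card_in_imset iS) (card_in_imset iL).
Qed.

Lemma big_collision L : r <= #|L| -> exists x y, [/\ x \in L, y \in L, x != y & x.1 = y.1].
Proof.
move=> le; have : ~~ dinjectiveb (fun x : X * C => x.1) L.
  apply: contraL le => /dinjectiveP inj.
  rewrite -ltnNge -(card_in_imset inj); apply: leq_ltn_trans ltr.
  by rewrite -cardX max_card.
by case/dinjectivePn => x xL [y /andP[yx yL] exy]; exists x, y; split=> //; rewrite eq_sym.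
Qed.

(* Fewer than r layers contain a point that lies in no other layer. *)
Lemma good_layer L : exists i, forall x, (x, i) \in L -> exists2 j, j != i & (x, j) \in L.
Proof.
have [/forallP h|] := boolP [forall i, [exists x, ((x, i) \in L) && [forall j, (j != i) ==> ((x, j) \notin L)]]].
  have /fin_all_exists[g gP] : forall i, exists x : X, ((x, i) \in L) && [forall j, (j != i) ==> ((x, j) \notin L)].
    by move=> i; apply/existsP.
  have inj : injective g.
    move=> i j e; have /andP[iL _] := gP i; have /andP[_ /forallP/(_ i)] := gP j.
    by rewrite -e iL implybF negbK => /eqP.
  have := leq_card g inj; rewrite leqNgt -/r.
  by rewrite [X in X < _](_ : _ = p ^ 2 * q ^ 2) ?ltr // -cardX.
rewrite negb_forall => /existsP[i]; rewrite negb_exists => /forallP h; exists i => x xL.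
have := h x; rewrite xL /= negb_forall => /existsP[j]; rewrite negb_imply negbK => /andP[ji jL].
by exists j.
Qed.

(** Moving x to its copy in another layer adds the factor r to the order of x - y; vanishing with
    and without r gives it on every layer. *)
Lemma good_layer_zer S L i :
  (forall x y, x \in L -> y \in L -> x != y ->
        zer5 S (ty x.1.1 y.1.1) (ty x.1.2 y.1.2) (x.2 != y.2)) ->
  (forall x, (x, i) \in L -> exists2 j, j != i & (x, j) \in L) ->
  forall j, zerD [set x | (x, i) \in L] (layer S j).
Proof.
move=> h gi j a b ab /difftP[x [y [xL yL ea eb]]]; rewrite !inE in xL yL.
have nxy : x != y by apply: contraTneq ab => e; rewrite -ea -eb e /ty !eqxx.
apply: zer5_layers => //.
  have := h (x, i) (y, i) xL yL; rewrite /= ea eb eqxx; apply.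
  by apply: contraNneq nxy => -[->].
have [k ki kL] := gi x xL; have := h (x, k) (y, i) kL yL; rewrite /= ea eb ki; apply.
by apply: contraNneq nxy => -[->].
Qed.

Lemma spectral_large S L : spectral5 S L -> r <= #|S| -> CM5 S.
Proof.
case=> e L0 hS hL le.
have zS00 : zer5 S 0 0 true.
  have [x [y [xL yL nxy exy]]] : exists x y, [/\ x \in L, y \in L, x != y & x.1 = y.1].
    by apply: big_collision; rewrite -e.
  have := hS x y xL yL nxy; rewrite exy /ty !eqxx.
  suff -> : x.2 != y.2 by [].
  by apply: contraNneq nxy => e2; case: (x) (y) exy e2 => [? ?] [? ?] /= -> ->.
have zL00 : zer5 L 0 0 true.
  have [x [y [xL yL nxy exy]]] := big_collision le.
  have := hL x y xL yL nxy; rewrite exy /ty !eqxx.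
  suff -> : x.2 != y.2 by [].
  by apply: contraNneq nxy => e2; case: (x) (y) exy e2 => [? ?] [? ?] /= -> ->.
have cS := (zer5_00 p_pr q_pr S).1 zS00; have cL := (zer5_00 p_pr q_pr L).1 zL00.
have [i gi] := good_layer L; have [j gj] := good_layer S.
have zS := good_layer_zer hS gi; have zL := good_layer_zer hL gj.
set Li := [set x | (x, i) \in L] in zS; set Sj := [set x | (x, j) \in S] in zL.
have marg k : #|[set x | (x, k) \in S]| = #|Li|.
  by apply/eqP; rewrite -(eqn_pmul2l r0) cS cL e.
have Li0 : 0 < #|Li| by rewrite lt0n; apply: contraTneq L0 => h; rewrite -(cL i) -/Li h muln0.
have E (T : {set X * C}) k x : layer T k x = ind [set x | (x, k) \in T] x by rewrite /ind inE.
(* [Li] is orthogonal for every layer of S, but its dual relation is known for [Sj] alone; this pair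
   suffices to determine the exponents. *)
have sp : spectral_pair Sj Li.
  split=> //; first exact: marg.
    by move=> a b ab w; apply: eq_zer (E S j) _; apply: zS.
  by move=> a b ab w; apply: eq_zer (E L i) _; apply: zL.
have [P1 [P2 [Q1 [Q2 [ke h]]]]] := spectral_good p_pr q_pr pq sp.
exists P1, P2, Q1, Q2, true; split.
  by rewrite e -(cL i) -/Li ke mulnC.
move=> a b c a2 b2 abc sa sb _.
have [ab|] := boolP (0 < a + b); last first.
  rewrite -leqNgt leqn0 addn_eq0 => /andP[/eqP a0 /eqP b0].
  by rewrite a0 b0 /= in abc *; rewrite abc.
apply: layers_zer5 => // k; apply: h => //.
by rewrite sum_layer marg.
Qed.

Lemma spectral_CM5 S L : spectral5 S L -> CM5 S.
Proof.
move=> sp; have [le|lt] := leqP r #|S|; first exact: spectral_large sp le.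
exact: spectral_small sp lt.
Qed.

End SpectralCM.

(** * Tiles *)

Section TileCore.
Variables A B : finType.
Notation X := ((A * A) * (B * B))%type.
Notation p := #|A|.
Notation q := #|B|.
Hypotheses (p_pr : prime p) (q_pr : prime q) (pq : p != q).
Implicit Types (f g : X -> nat).

Let p0 : 0 < p := prime_gt0 p_pr.
Let q0 : 0 < q := prime_gt0 q_pr.

Lemma zer_decidable f a b : exists c : bool, c <-> zer f a b.
Proof.
exists [forall x, Rk f a b x == 0%R]; rewrite -Rk_zer //; split.
  by move/forallP=> h x; apply/eqP.
by move=> h; apply/forallP => x; rewrite h.
Qed.

Lemma zer_fam_decidable (I : finType) (F : I -> X -> nat) a b :
  exists c : bool, c <-> forall i, zer (F i) a b.
Proof.
have /fin_all_exists[c cP] : forall i, exists c : bool, c <-> zer (F i) a b.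
  by move=> i; apply: zer_decidable.
exists [forall i, c i]; split; first by move/forallP=> h i; apply/cP.
by move=> h; apply/forallP => i; apply/cP.
Qed.

Lemma dvdp_zer f (b1 b2 : bool) : (b1 -> zer f 1 0) -> (b2 -> zer f 2 0) ->
  p ^ (b1 + b2) %| \sum_x f x.
Proof.
case: b1; case: b2 => // h1 h2; rewrite pow_bool.
- by apply: dvd_zer1020; auto.
- by apply: dvd_zer10; auto.
- by apply: dvd_zer20; auto.
Qed.

Lemma no_p3 : p ^ 3 %| p ^ 2 * q ^ 2 -> False.
Proof.
rewrite expnSr dvdn_pmul2l ?expn_gt0 ?p0 // Euclid_dvdX // dvdn_prime2 //.
by rewrite (negbTE pq).
Qed.

Lemma no_q3 : q ^ 3 %| p ^ 2 * q ^ 2 -> False.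
Proof.
rewrite expnSr mulnC dvdn_pmul2r ?expn_gt0 ?q0 // Euclid_dvdX // dvdn_prime2 //.
by rewrite eq_sym (negbTE pq).
Qed.

(** Each of p and p^2 is already taken by f or g, so a power taken by both would put p^3 into the
    product of the sizes. *)
Lemma exclusive_p f g a : (\sum_x f x) * (\sum_x g x) = p ^ 2 * q ^ 2 ->
  (forall a, 0 < a <= 2 -> zer f a 0 \/ zer g a 0) -> 0 < a <= 2 -> zer f a 0 -> zer g a 0 -> False.
Proof.
move=> e h a2 zf zg; apply: no_p3; rewrite -e.
have [f1 F1] := zer_decidable f 1 0; have [f2 F2] := zer_decidable f 2 0.
have [g1 G1] := zer_decidable g 1 0; have [g2 G2] := zer_decidable g 2 0.
have df := dvdp_zer F1.1 F2.1; have dg := dvdp_zer G1.1 G2.1.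
apply: dvdn_trans (dvdn_mul df dg); rewrite -expnD dvdn_exp2l //.
have h1 : f1 || g1 by case: (h 1 isT) => [/F1->|/G1->]; rewrite ?orbT.
have h2 : f2 || g2 by case: (h 2 isT) => [/F2->|/G2->]; rewrite ?orbT.
case: a a2 zf zg => [|[|[|a]]] // _ zf zg.
  by rewrite (F1.2 zf) (G1.2 zg) {df dg}; case: f2 g2 h2 {F2 G2} => [] [].
by rewrite (F2.2 zf) (G2.2 zg) {df dg}; case: f1 g1 h1 {F1 G1} => [] [].
Qed.

Lemma exclusive_q f g b : (\sum_x f x) * (\sum_x g x) = p ^ 2 * q ^ 2 ->
  (forall b, 0 < b <= 2 -> zer f 0 b \/ zer g 0 b) -> 0 < b <= 2 -> zer f 0 b -> zer g 0 b -> False.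
Proof.
move=> e h a2 zf zg; apply: no_q3; rewrite -e.
have [f1 F1] := zer_decidable f 0 1; have [f2 F2] := zer_decidable f 0 2.
have [g1 G1] := zer_decidable g 0 1; have [g2 G2] := zer_decidable g 0 2.
have df := dvdq_zer F1.1 F2.1; have dg := dvdq_zer G1.1 G2.1.
apply: dvdn_trans (dvdn_mul df dg); rewrite -expnD dvdn_exp2l //.
have h1 : f1 || g1 by case: (h 1 isT) => [/F1->|/G1->]; rewrite ?orbT.
have h2 : f2 || g2 by case: (h 2 isT) => [/F2->|/G2->]; rewrite ?orbT.
case: b a2 zf zg => [|[|[|a]]] // _ zf zg.
  by rewrite (F1.2 zf) (G1.2 zg) {df dg}; case: f2 g2 h2 {F2 G2} => [] [].
by rewrite (F2.2 zf) (G2.2 zg) {df dg}; case: f1 g1 h1 {F1 G1} => [] [].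
Qed.

Lemma rep_pq i j al be : i <= 1 -> j <= 1 -> p ^ i * q ^ j = al * p + be * q -> al = 0 \/ be = 0.
Proof.
have p1 := prime_gt1 p_pr; have q1 := prime_gt1 q_pr.
case: i => [|[|//]]; case: j => [|[|//]] _ _; rewrite ?expn0 ?expn1 ?mul1n ?muln1 => e.
- case: al e => [|al]; first by left.
  rewrite mulSn => e; have : p <= 1 by rewrite {1}e -addnA leq_addr.
  by rewrite leqNgt p1.
- by left; apply: (rep_q p_pr q_pr pq e).
- by right; apply: (rep_p p_pr q_pr pq e).
- have : q %| al * p.
    by rewrite -(dvdn_addl _ (dvdn_mull be (dvdnn q))) -e dvdn_mull.
  rewrite Gauss_dvdl; last by rewrite coprime_sym coprime_pq.
  case/dvdnP=> c ea; rewrite {}ea in e *.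
  case: c e => [|c] e; [by left | right].
  case: be e => // be; rewrite !mulSn => e.
  have : p * q + 0 < p * q + q by rewrite ltn_add2l.
  rewrite addn0 {1}e mulnDl [q * p]mulnC -!addnA ltn_add2l.
  by rewrite addnCA -[ltnRHS]addn0 ltn_add2l ltn0.
Qed.

Variables (I J : finType) (F : I -> X -> nat) (G : J -> X -> nat) (k l : nat).
Hypotheses (Fk : forall i, \sum_x F i x = k) (Gl : forall j, \sum_x G j x = l).
Hypothesis kl : k * l = p ^ 2 * q ^ 2.
Hypothesis FG : forall a b, a <= 2 -> b <= 2 -> 0 < a + b ->
  (forall i, zer (F i) a b) \/ (forall j, zer (G j) a b).
Variables (i0 : I) (j0 : J).

(** The prime powers are divided between F and G, which fixes both sizes. If (T2) failed for F at
    p^a q^b, G would vanish there. As F owns p^a and q^b, the size of G has exponents at most 1, so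
    G consists of cosets of one kind and vanishes at p^a or q^b, against exclusivity. *)
Lemma tile_core : exists P1 P2 Q1 Q2 : bool, k = p ^ (P1 + P2) * q ^ (Q1 + Q2) /\
  forall a b, a <= 2 -> b <= 2 -> 0 < a + b -> sel P1 P2 a -> sel Q1 Q2 b ->
  forall i, zer (F i) a b.
Proof.
have [P1 P1P] := zer_fam_decidable F 1 0; have [P2 P2P] := zer_fam_decidable F 2 0.
have [Q1 Q1P] := zer_fam_decidable F 0 1; have [Q2 Q2P] := zer_fam_decidable F 0 2.
have fg : (\sum_x F i0 x) * (\sum_x G j0 x) = p ^ 2 * q ^ 2 by rewrite Fk Gl.
have hp a : 0 < a <= 2 -> zer (F i0) a 0 \/ zer (G j0) a 0.
  by case/andP=> a0 a2; case: (@FG a 0) => // [|h|h]; rewrite ?addn0; auto.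
have hq b : 0 < b <= 2 -> zer (F i0) 0 b \/ zer (G j0) 0 b.
  by case/andP=> a0 a2; case: (@FG 0 b) => // [h|h]; auto.
have ng (c : bool) a b : a <= 2 -> b <= 2 -> 0 < a + b -> (c <-> forall i, zer (F i) a b) ->
    ~~ c -> zer (G j0) a b.
  by move=> a2 b2 ab cP nc; case: (FG a2 b2 ab) => // /cP c1; rewrite c1 in nc.
have df : p ^ (P1 + P2) * q ^ (Q1 + Q2) %| k.
  rewrite -(Fk i0); apply: dvd_pow => //.
    by apply: dvdp_zer => [/P1P|/P2P]; apply.
  by apply: dvdq_zer => [/Q1P|/Q2P]; apply.
have dg : p ^ (~~ P1 + ~~ P2) * q ^ (~~ Q1 + ~~ Q2) %| l.
  rewrite -(Gl j0); apply: dvd_pow => //.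
    by apply: dvdp_zer => h; [apply: (ng P1) | apply: (ng P2)].
  by apply: dvdq_zer => h; [apply: (ng Q1) | apply: (ng Q2)].
have kl0 : 0 < k * l by rewrite kl muln_gt0 !expn_gt0 p0 q0.
have [k0 l0] : 0 < k /\ 0 < l by move: kl0; rewrite muln_gt0 => /andP[].
have pos i j : 0 < p ^ i * q ^ j by rewrite muln_gt0 !expn_gt0 p0 q0.
have prod : (p ^ (P1 + P2) * q ^ (Q1 + Q2)) * (p ^ (~~ P1 + ~~ P2) * q ^ (~~ Q1 + ~~ Q2)) = k * l.
  rewrite kl mulnACA -!expnD; congr (_ ^ _ * _ ^ _).
    by case: (P1); case: (P2).
  by case: (Q1); case: (Q2).
have kE : k = p ^ (P1 + P2) * q ^ (Q1 + Q2).
  apply/eqP; rewrite eqn_leq (dvdn_leq k0 df) andbT.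
  rewrite -(leq_pmul2r l0) -prod leq_mul2l; apply/orP; right; exact: dvdn_leq.
have lE : l = p ^ (~~ P1 + ~~ P2) * q ^ (~~ Q1 + ~~ Q2).
  by apply/eqP; rewrite -(eqn_pmul2l k0) -prod {1}kE.
exists P1, P2, Q1, Q2; split=> // a b a2 b2 ab sa sb.
have zp : 0 < a -> forall i, zer (F i) a 0.
  by case: a a2 ab sa => [|[|[|a]]] //= _ _ h _; [apply/P1P | apply/P2P].
have zq : 0 < b -> forall i, zer (F i) 0 b.
  by case: b b2 ab sb => [|[|[|b]]] //= _ _ h _; [apply/Q1P | apply/Q2P].
case: (FG a2 b2 ab) => // zG.
have [a0|a0] := posnP a; first by subst a; apply: zq; rewrite add0n in ab.
have [b0|b0] := posnP b; first by subst b; apply: zp.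
have ea : ~~ P1 + ~~ P2 <= 1.
  by case: a a0 a2 sa {ab zG zp} => [|[|[|a]]] //= _ _ ->; case: (P1); case: (P2).
have eb : ~~ Q1 + ~~ Q2 <= 1.
  by case: b b0 b2 sb {ab zG zq} => [|[|[|b]]] //= _ _ ->; case: (Q1); case: (Q2).
exfalso; have [x] := inhabited_coords p_pr q_pr.
case: a a0 a2 {sa ab} zp zG => // a _ a2 zp zG; case: b b0 b2 {sb} zq zG => // b _ b2 zq zG.
have d := fibered_zer1 p_pr q_pr a2 b2 (zG j0) (leq0n a) (leq0n b).
have [al [be [e h1 h2]]] := d x; move: e; rewrite mul1n marg00 Gl lE => e.
case: (rep_pq ea eb e) => [/h1 iq|/h2 ip].
  have iq' : indq (G j0) a.+1 b by move=> y; apply: iq.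
  apply: (exclusive_q fg hq (b := b.+1)) => //; first exact: zq.
  exact: indq_zer iq' _ _.
have ip' : indp (G j0) a b.+1 by move=> y; apply: ip.
apply: (exclusive_p fg hp (a := a.+1)) => //; first exact: zp.
exact: indp_zer ip' _ _.
Qed.

End TileCore.

(** The set of size prime to r enters through its projection, the other through its layers; the
    Tijdeman hypotheses supply the vanishing at orders divisible by r that separating the layers
    requires. *)
Lemma tile_CM5 (A B C : finType) (S T : {set (A * A) * (B * B) * C}) :
  prime #|A| -> prime #|B| -> prime #|C| -> #|A| != #|B| -> #|A| != #|C| -> #|B| != #|C| ->
  #|S| * #|T| = #|A| ^ 2 * #|B| ^ 2 * #|C| ->
  (forall a b c, a <= 2 -> b <= 2 -> (0 < a + b) || c -> zer5 S a b c \/ zer5 T a b c) ->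
  (~~ (#|C| %| #|S|) -> forall a b, a <= 2 -> b <= 2 -> 0 < a + b ->
     zer5 S a b false \/ zer5 T a b true) ->
  (~~ (#|C| %| #|T|) -> forall a b, a <= 2 -> b <= 2 -> 0 < a + b ->
     zer5 T a b false \/ zer5 S a b true) ->
  CM5 S.
Proof.
move=> p_pr q_pr r_pr pq pr qr card Z Zs Zt; have r0 := prime_gt0 r_pr.
have [j0 _] := card_gt0P r0.
have cardlayer (U V : {set (A * A) * (B * B) * C}) : #|U| * #|V| = #|A| ^ 2 * #|B| ^ 2 * #|C| ->
    zer5 V 0 0 true -> forall j, #|U| * #|[set x | (x, j) \in V]| = #|A| ^ 2 * #|B| ^ 2.
  move=> e /(zer5_00 p_pr q_pr) h j; apply/eqP.
  by rewrite -(eqn_pmul2r r0) -e -mulnA [_ * #|C|]mulnC h.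
have ndvd (U : {set (A * A) * (B * B) * C}) : zer5 U 0 0 true -> #|C| %| #|U|.
  by move/(zer5_00 p_pr q_pr)/(_ j0) <-; apply: dvdn_mulr.
have [rS|rS] := boolP (#|C| %| #|S|).
  have [rT|rT] := boolP (#|C| %| #|T|); last first.
    have S00 : zer5 S 0 0 true by case: (Z 0 0 true) => // /ndvd h; rewrite h in rT.
    have cS := (zer5_00 p_pr q_pr S).1 S00.
    have FG a b : a <= 2 -> b <= 2 -> 0 < a + b ->
        (forall j, zer (layer S j) a b) \/ (forall i : unit, zer (proj T) a b).
      move=> a2 b2 ab; case: (Zt rT a b a2 b2 ab) => [h|h]; first by right=> _; apply/zer5_proj.
      case: (Z a b false a2 b2); rewrite ?ab // => h'; first by left; apply: zer5_layers.
      by right=> _; apply/zer5_proj.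
    have Fk j : \sum_x layer S j x = #|[set x | (x, j0) \in S]|.
      by apply/eqP; rewrite sum_layer -(eqn_pmul2l r0) !cS.
    have kl : #|[set x | (x, j0) \in S]| * #|T| = #|A| ^ 2 * #|B| ^ 2.
      by rewrite mulnC; apply: cardlayer => //; rewrite mulnC.
    have [P1 [P2 [Q1 [Q2 [ke h]]]]] := tile_core p_pr q_pr pq Fk (fun _ => sum_proj T) kl FG j0 tt.
    exists P1, P2, Q1, Q2, true; split; first by rewrite -(cS j0) ke mulnC.
    move=> a b c a2 b2 abc sa sb _; have [ab|] := boolP (0 < a + b).
      by apply: (layers_zer5 p_pr q_pr) => j; apply: h.
    rewrite -leqNgt leqn0 addn_eq0 => /andP[/eqP a0 /eqP b0].
    by rewrite a0 b0 /= in abc *; rewrite abc.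
  have := dvdn_mul rS rT; rewrite card dvdn_pmul2r // Euclid_dvdM // !Euclid_dvdX // !dvdn_prime2 //.
  by rewrite eq_sym (negbTE pr) eq_sym (negbTE qr).
have T00 : zer5 T 0 0 true by case: (Z 0 0 true) => // /ndvd h; rewrite h in rS.
have cT := (zer5_00 p_pr q_pr T).1 T00.
have FG a b : a <= 2 -> b <= 2 -> 0 < a + b ->
    (forall i : unit, zer (proj S) a b) \/ (forall j, zer (layer T j) a b).
  move=> a2 b2 ab; case: (Zs rS a b a2 b2 ab) => [h|h]; first by left=> _; apply/zer5_proj.
  case: (Z a b false a2 b2); rewrite ?ab // => h'; last by right; apply: zer5_layers.
  by left=> _; apply/zer5_proj.
have Gl j : \sum_x layer T j x = #|[set x | (x, j0) \in T]|.
  by apply/eqP; rewrite sum_layer -(eqn_pmul2l r0) !cT.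
have kl := cardlayer S T card T00 j0.
have [P1 [P2 [Q1 [Q2 [ke h]]]]] := tile_core p_pr q_pr pq (fun _ => sum_proj S) Gl kl FG tt j0.
exists P1, P2, Q1, Q2, false; split; first by rewrite ke muln1.
move=> a b [] a2 b2 abc sa sb nc; first by have := nc isT.
by apply/zer5_proj => //; apply: h => //; rewrite orbF in abc.
Qed.

(** * Characters of Z_n *)

Section Chars.
Variable n : nat.
Hypothesis n1 : (1 < n)%N.
Local Open Scope ring_scope.
Implicit Types (S T L : {set 'Z_n}) (l x y g s t : 'Z_n).

Let n0 : (0 < n)%N := ltnW n1.
Let om := omega_prim n1.

Lemma ZpD (x y : 'Z_n) : (x + y : 'Z_n) = ((x + y) %% n)%N :> nat.
Proof. by congr (_ %% _)%N; apply: Zp_cast. Qed.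

Lemma Zp_lt (x : 'Z_n) : (x < n)%N.
Proof. by have := ltn_ord x; rewrite [X in (_ < X)%N](Zp_cast n1). Qed.

Lemma chrD l x y : chr l (x + y) = chr l x * chr l y.
Proof.
by rewrite /chr ZpD -exprD -mulnDr -(prim_expr_mod om) modnMmr (prim_expr_mod om).
Qed.

Lemma chrC l x : chr l x = chr x l.
Proof. by rewrite /chr mulnC. Qed.

Lemma chr0 l : chr l 0 = 1.
Proof. by rewrite /chr muln0. Qed.

Lemma chr_neq0 l x : chr l x != 0.
Proof. by rewrite expf_neq0 // (prim_root_eq0 om) -lt0n. Qed.

Lemma chrN l x : chr l (- x) = (chr l x)^-1.
Proof.
by apply: (mulfI (chr_neq0 l x)); rewrite -chrD subrr chr0 mulfV // chr_neq0.
Qed.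

Lemma chr_conj l x : (chr l x)^* = (chr l x)^-1.
Proof.
apply: (mulfI (chr_neq0 l x)); rewrite -normCK mulfV ?chr_neq0 //.
rewrite (@norm_unity _ n) ?expr1n // /chr -exprM mulnC exprM (prim_expr_order om).
by rewrite expr1n normr1.
Qed.

Lemma chr_sum l : \sum_(x : 'Z_n) chr l x = if l == 0 then n%:R else 0.
Proof.
have -> : \sum_(x : 'Z_n) chr l x = \sum_(x < n) (omega n ^+ l) ^+ x.
  rewrite -(big_mkord xpredT (fun i => (omega n ^+ l) ^+ i)) -[X in index_iota 0 X](Zp_cast n1) big_mkord.
  by apply: eq_bigr => x _; rewrite /chr exprM.
rewrite sum_unity; last by rewrite -exprM mulnC exprM (prim_expr_order om) expr1n.
congr (if _ then _ else _); rewrite -(prim_order_dvd om).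
apply/idP/eqP => [d|->]; last exact: dvdn0.
apply/val_inj => /=; apply/eqP; apply: contraTT d => l0.
by rewrite gtnNdvd ?Zp_lt // lt0n.
Qed.

Definition hat S (l : 'Z_n) : algC := \sum_(s in S) chr l s.

Lemma hat0 S : hat S 0 = #|S|%:R.
Proof.
by rewrite /hat; under eq_bigr => s _ do rewrite chrC chr0; rewrite sumr_const.
Qed.

Lemma ipS_hat S l l' : ipS S (chr l) (chr l') = hat S (l - l').
Proof.
by apply: eq_bigr => s _; rewrite chr_conj !(chrC _ s) chrD chrN.
Qed.

Lemma sum_setX S T (F : 'Z_n * 'Z_n -> algC) :
  \sum_(u in setX S T) F u = \sum_(s in S) \sum_(t in T) F (s, t).
Proof. by rewrite pair_big /=; apply: eq_big => -[s t] //; rewrite inE. Qed.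

Lemma tile_inj S T : (forall g, exists! st : 'Z_n * 'Z_n, [/\ st.1 \in S, st.2 \in T & st.1 + st.2 = g]) ->
  {in setX S T &, injective (fun u => u.1 + u.2)} /\
  (fun u => u.1 + u.2) @: setX S T = [set: 'Z_n].
Proof.
move=> h; split=> [u v|].
  rewrite !inE => /andP[u1 u2] /andP[v1 v2] e; have [w [_ difft]] := h (u.1 + u.2).
  by rewrite -(difft u) // -(difft v).
apply/setP => g; rewrite inE; have [w [[w1 w2 <-] _]] := h g.
by apply/imsetP; exists w; rewrite // inE w1 w2.
Qed.

Lemma tile_hat S T : (forall g, exists! st : 'Z_n * 'Z_n, [/\ st.1 \in S, st.2 \in T & st.1 + st.2 = g]) ->
  (#|S| * #|T|)%N = n /\ forall l, l != 0 -> hat S l * hat T l = 0.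
Proof.
move=> /tile_inj[inj im]; split.
  by rewrite -cardsX -(card_in_imset inj) im cardsT card_ord Zp_cast.
move=> l l0; have := chr_sum l; rewrite (negbTE l0) => <-.
transitivity (\sum_(u in setX S T) chr l (u.1 + u.2)).
  rewrite big_distrl sum_setX /=; apply: eq_bigr => s _; rewrite big_distrr /=.
  by apply: eq_bigr => t _; rewrite chrD.
rewrite -(big_imset (chr l) inj) /= im; by apply: eq_bigl => x; rewrite inE.
Qed.

(** Fourier inversion: n times the number of representations of g is a sum over characters in which
    only the trivial one survives, contributing |S| |T| = n. *)
Lemma hat_tile S T : (#|S| * #|T|)%N = n ->
  (forall l, l != 0 -> hat S l = 0 \/ hat T l = 0) -> tile S.
Proof.
move=> card h; exists T => g.
pose c := #|[set u in setX S T | u.1 + u.2 == g]|.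
have : (n * c)%:R = n%:R :> algC.
  transitivity (\sum_(u in setX S T) \sum_l chr l (u.1 + u.2 - g)).
    under eq_bigr => u _ do under eq_bigr => l _ do rewrite chrC.
    under eq_bigr => u _ do rewrite chr_sum subr_eq0.
    rewrite -big_mkcondr /= sumr_const natrM mulr_natr; congr (_ *+ _).
    by apply: eq_card => u; rewrite !inE [RHS]unfold_in /= inE.
  rewrite exchange_big (bigD1 0) // [X in _ + X = _]big1 ?addr0.
    transitivity (\sum_(u in setX S T) 1 : algC); last by rewrite sumr_const cardsX card.
    by apply: eq_bigr => u _; rewrite chrC chr0.
  move=> l l0; under eq_bigr => u _ do rewrite !chrD.
  rewrite -big_distrl /= sum_setX /=.
  under eq_bigr => s _ do rewrite -big_distrr /=.
  rewrite -big_distrl /= -/(hat S l) -/(hat T l).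
  by case: (h l l0) => ->; rewrite ?mulr0 !mul0r.
move/eqP; rewrite eqr_nat -{2}[n]muln1 eqn_pmul2l // => /cards1P[u uE].
have : u \in [set u in setX S T | u.1 + u.2 == g] by rewrite uE inE.
rewrite !inE => /andP[/andP[u1 u2] /eqP ug].
exists u; split=> // v [v1 v2 vg]; apply/esym/eqP.
by rewrite -in_set1 -uE !inE v1 v2 vg eqxx.
Qed.

Section Dual.
Variables S L : {set 'Z_n}.
Hypothesis S0 : (0 < #|S|)%N.
Hypothesis orth : forall l l', l \in L -> l' \in L -> l != l' -> hat S (l - l') = 0.

Let k : algC := #|S|%:R.
Let k0 : k != 0. Proof. by rewrite pnatr_eq0 -lt0n. Qed.

Definition cmx : 'M[algC]_(#|L|, #|S|) := \matrix_(i, j) chr (enum_val i) (enum_val j).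
Definition cmxV : 'M[algC]_(#|S|, #|L|) :=
  \matrix_(j, i) (k^-1 * chr (enum_val i) (- enum_val j)).

Lemma cmxK : cmx *m cmxV = 1%:M.
Proof.
apply/matrixP => i i'; rewrite !mxE.
transitivity (k^-1 * hat S (enum_val i - enum_val i')).
  rewrite /hat big_distrr [RHS]big_enum_val /=; apply: eq_bigr => j _; rewrite !mxE.
  rewrite mulrCA; congr (_ * _).
  by rewrite chrN !(chrC _ (enum_val j)) chrD chrN.
have [->|ne] := eqVneq i i'; first by rewrite subrr hat0 mulVf.
by rewrite orth ?mulr0 ?enum_valP // (inj_eq enum_val_inj).
Qed.

Lemma mulmx1C_rect (R : comNzRingType) (m m' : nat) (M : 'M[R]_(m, m')) (M' : 'M[R]_(m', m)) :
  m = m' -> M *m M' = 1%:M -> M' *m M = 1%:M.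
Proof. by move=> e; subst m'; apply: mulmx1C. Qed.

Hypothesis card : #|L| = #|S|.

(** The scaled conjugate transpose is a right inverse of the square character matrix, hence a left
    inverse, which is orthogonality with S and L exchanged. *)
Lemma dual_orth s s' : s \in S -> s' \in S -> s != s' -> hat L (s - s') = 0.
Proof.
move=> sS s'S ne; have := mulmx1C_rect card cmxK => /matrixP.
move/(_ (enum_rank_in s'S s') (enum_rank_in sS s)); rewrite !mxE.
rewrite -(inj_eq enum_val_inj) !enum_rankK_in // eq_sym (negbTE ne) => /= h.
apply: (mulfI (invr_neq0 k0)); rewrite mulr0; apply: etrans h.
rewrite /hat big_distrr [LHS]big_enum_val /=; apply: eq_bigr => j _; rewrite !mxE !enum_rankK_in //.
by rewrite -mulrA; congr (_ * _); rewrite chrC chrD mulrC.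
Qed.

Lemma orth_basis : orth_basis_on S L.
Proof.
split.
- by move=> l l' lL l'L ne; rewrite ipS_hat orth.
- move=> c h l lL; apply: (mulfI k0); rewrite mulr0.
  transitivity (\sum_(s in S) (\sum_(l' in L) c l' * chr l' s) * chr l (- s)); last first.
    by rewrite big1 // => s sS; rewrite h // mul0r.
  under eq_bigr => s _ do rewrite big_distrl /=.
  rewrite exchange_big (bigD1 l) //= [X in _ = _ + X]big1 ?addr0.
    transitivity (\sum_(s in S) c l); first by rewrite sumr_const mulr_natl.
    by apply: eq_bigr => s _; rewrite -mulrA -chrD subrr chr0 mulr1.
  move=> l' /andP[l'L ne].
  transitivity (c l' * hat S (l' - l)); last by rewrite orth ?mulr0.
  rewrite /hat big_distrr; apply: eq_bigr => s _ /=.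
  by rewrite -mulrA chrN !(chrC _ s) chrD chrN.
- move=> f; exists (fun l => k^-1 * \sum_(s in S) f s * chr l (- s)) => s sS.
  transitivity (\sum_(s' in S) k^-1 * f s' * hat L (s - s')).
    rewrite (bigD1 s) //= subrr hat0 card mulrAC mulVf // mul1r big1 ?addr0 // => s' /andP[s'S ne].
    by rewrite dual_orth ?mulr0 // eq_sym.
  under eq_bigr => s' _ do rewrite /hat big_distrr /=.
  rewrite exchange_big /=; apply: eq_bigr => l _.
  rewrite -mulrA big_distrl big_distrr /=; apply: eq_bigr => s' _.
  by rewrite chrC chrD !(chrC l); ring.
Qed.

End Dual.

(** Orthogonality gives the character matrix a right inverse, so |L| <= |S|; expanding the
    indicators of points in characters gives a left inverse. *)
Lemma orth_basis_card S L : (0 < #|S|)%N -> orth_basis_on S L ->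
  #|L| = #|S| /\ forall l l', l \in L -> l' \in L -> l != l' -> hat S (l - l') = 0.
Proof.
move=> S0 [o _ span].
have orth l l' : l \in L -> l' \in L -> l != l' -> hat S (l - l') = 0.
  by move=> lL l'L ne; rewrite -ipS_hat o.
split=> //; apply/eqP; rewrite eqn_leq; apply/andP; split.
  exact: mulmx1_min (cmxK S0 orth).
have /fin_all_exists[D DP] : forall s0 : 'Z_n, exists c : 'Z_n -> algC,
    forall s, s \in S -> (s == s0)%:R = \sum_(l in L) c l * chr l s by move=> s0; apply: span.
pose M : 'M[algC]_(#|S|, #|L|) := \matrix_(j, i) D (enum_val j) (enum_val i).
apply: (@mulmx1_min _ _ _ M (cmx S L)).
apply/matrixP => j j'; rewrite !mxE.
transitivity ((enum_val j' == enum_val j)%:R : algC); last by rewrite (inj_eq enum_val_inj) eq_sym.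
rewrite DP ?enum_valP // [RHS]big_enum_val /=.
by apply: eq_bigr => i _; rewrite !mxE.
Qed.

End Chars.

(** * Standard tiling complements and spectra *)

Section Boxes.
Variable A : finType.
Variable a0 : A.

Definition half (b : bool) : {set A} := if b then [set a0] else [set: A].

(** Complement for the prime powers given by b1, b2: a digit runs freely exactly when its prime
    power is absent, and a free digit makes the transform vanish at that order. *)
Definition box (b1 b2 : bool) : {set A * A} := setX (half b1) (half b2).

Lemma card_half b : #|half b| = #|A| ^ (~~ b).
Proof. by case: b; rewrite /half /= ?cards1 ?cardsT ?expn0 ?expn1. Qed.

Lemma card_box b1 b2 : #|box b1 b2| = #|A| ^ (~~ b1 + ~~ b2).
Proof. by rewrite cardsX !card_half expnD. Qed.

Lemma half_eq b x y : x \in half b -> y \in half b -> x != y -> ~~ b.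
Proof. by case: b => //; rewrite !inE => /eqP-> /eqP->; rewrite eqxx. Qed.

(** For differences the digits change roles: a free first digit produces order p^2, a free second
    digit order p. A spectrum is therefore a box with reversed arguments. *)
Lemma typed_box b1 b2 : typed (~~ b2) (~~ b1) (box b1 b2).
Proof.
move=> x y; rewrite !inE => /andP[x1 x2] /andP[y1 y2].
have [e1|n1] := eqVneq x.1 y.1; last by rewrite (ty2 n1); apply: half_eq n1.
have [e|n] := eqVneq x y; first by rewrite e /ty eqxx.
rewrite (ty1 e1 n); apply: half_eq x2 y2 _.
by apply: contraNneq n => e2; case: (x) (y) e1 e2 => [? ?] [? ?] /= -> ->.
Qed.

Local Open Scope ring_scope.

Lemma sum_bool (I : finType) (i : I) : \sum_(j : I) (i == j)%:Z = 1 :> int.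
Proof. by rewrite (bigD1 i) //= eqxx big1 ?addr0 // => j ne; rewrite eq_sym (negbTE ne). Qed.

Lemma kap_box b1 b2 a x : (0 < a <= 2)%N -> ~~ sel b1 b2 a ->
  \sum_(y in box b1 b2) kap a x y = 0.
Proof.
case: a => [|[|[|//]]] // _ /= nb; rewrite /kap.
  rewrite /box (negbTE nb).
  transitivity (\sum_(y2 in half b2) \sum_y1 (#|A|%:Z * (x.1 == y1)%:Z - 1)).
    rewrite exchange_big pair_big /=; apply: eq_big => [[y1 y2]|[y1 y2] _] /=.
      by rewrite !inE.
    by rewrite expn0 mul1r.
  rewrite big1 // => y2 _; rewrite sumrB -mulr_sumr sum_bool mulr1 sumr_const.
  by rewrite cardT -cardE natz subrr.
rewrite /box (negbTE nb).
transitivity (\sum_(y1 in half b1) \sum_y2 #|A|%:Z * ((#|A|%:Z * (x.2 == y2)%:Z - 1) * (x.1 == y1)%:Z)).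
  rewrite pair_big /=; apply: eq_big => [[y1 y2]|[y1 y2] _] /=.
    by rewrite !inE andbT.
  rewrite expn1; congr (_ * _); case: x => x1 x2 /=; rewrite xpair_eqE.
  by case: (x1 == y1); case: (x2 == y2); rewrite /= ?(mulr1, mulr0).
rewrite big1 // => y1 _; rewrite -mulr_sumr -mulr_suml sumrB -mulr_sumr sum_bool mulr1 sumr_const.
by rewrite cardT -cardE natz subrr mul0r mulr0.
Qed.

Lemma kapr_half x : \sum_(j in half false) kapr true x j = 0.
Proof.
transitivity (\sum_j (#|A|%:Z * (x == j)%:Z - 1)); first by apply: eq_bigl => j; rewrite inE.
by rewrite sumrB -mulr_sumr sum_bool mulr1 sumr_const cardT -cardE natz subrr.
Qed.

End Boxes.

Section Boxes5.
Variables A B C : finType.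
Variables (a0 : A) (b0 : B) (c0 : C).
Variables P1 P2 Q1 Q2 R1 : bool.
Local Open Scope ring_scope.

Definition box5 : {set (A * A) * (B * B) * C} :=
  setX (setX (box a0 P1 P2) (box b0 Q1 Q2)) (half c0 R1).

Lemma card_box5 : #|box5| = (#|A| ^ (~~ P1 + ~~ P2) * #|B| ^ (~~ Q1 + ~~ Q2) * #|C| ^ (~~ R1))%N.
Proof. by rewrite /box5 cardsX cardsX !card_box card_half. Qed.

Lemma ker_box5 a b c x :
  \sum_(y in box5) ker5 a b c x y = (\sum_(y in box a0 P1 P2) kap a x.1.1 y) *
    (\sum_(y in box b0 Q1 Q2) kap b x.1.2 y) * (\sum_(j in half c0 R1) kapr c x.2 j).
Proof.
rewrite [X in _ = X * _]big_distrlr /= pair_big big_distrlr /= pair_big /=.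
by apply: eq_bigl => -[[y1 y2] j]; rewrite !inE.
Qed.

Lemma zer_box5 a b c : (a <= 2)%N -> (b <= 2)%N ->
  ~~ [&& sel P1 P2 a, sel Q1 Q2 b & c ==> R1] -> zer5 box5 a b c.
Proof.
move=> a2 b2; rewrite !negb_and => h x; rewrite ker_box5.
case/or3P: h => h.
- by rewrite kap_box ?mul0r //; case: a h a2.
- by rewrite [X in _ * X * _]kap_box ?mul0r ?mulr0 ?mul0r //; case: b h b2.
- move: h; rewrite negb_imply => /andP[-> nR]; rewrite (negbTE nR).
  by rewrite kapr_half mulr0.
Qed.

Lemma typed_box5 x y : x \in box5 -> y \in box5 ->
  [/\ sel (~~ P2) (~~ P1) (ty x.1.1 y.1.1), sel (~~ Q2) (~~ Q1) (ty x.1.2 y.1.2) &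
      x.2 != y.2 -> ~~ R1].
Proof.
case: x => [[x1 x2] x3]; case: y => [[y1 y2] y3] /=.
rewrite /box5 !in_setX => /andP[/andP[h1 h2] h3] /andP[/andP[k1 k2] k3].
split; last exact: half_eq h3 k3.
  exact: typed_box h1 k1.
exact: typed_box h2 k2.
Qed.

End Boxes5.

(** * Tijdeman's theorem *)

Section Tijdeman.
Variables n r : nat.
Hypotheses (n1 : 1 < n) (r_pr : prime r).
Local Open Scope ring_scope.
Implicit Types (S T : {set 'Z_n}).

(** Polynomials modulo X^n - 1 over the field of r elements are the group algebra of Z_n; [msk S] is
    the indicator of S in it. *)
Let K := 'F_r.
Let D : {poly K} := 'X^n - 1.
Let eqm (P Q : {poly K}) := D %| P - Q.
Let msk S : {poly K} := \sum_(s in S) 'X^s.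

Lemma eqm_refl P : eqm P P.
Proof. by rewrite /eqm subrr dvdp0. Qed.

Lemma eqm_trans Q P R : eqm P Q -> eqm Q R -> eqm P R.
Proof. by move=> h h'; rewrite /eqm -(subrK Q P) -addrA dvdp_add. Qed.

Lemma eqm_mul C P Q : eqm P Q -> eqm (C * P) (C * Q).
Proof. by move=> h; rewrite /eqm -mulrBr dvdp_mull. Qed.

Lemma eqm_sum (I : finType) (A : pred I) (F G : I -> {poly K}) :
  (forall i, A i -> eqm (F i) (G i)) -> eqm (\sum_(i | A i) F i) (\sum_(i | A i) G i).
Proof.
move=> h; rewrite /eqm -sumrB; apply: (big_ind (fun P => D %| P)) => //.
by move=> P Q; apply: dvdp_add.
Qed.

Lemma eqm_Xmod a : eqm 'X^a 'X^(a %% n).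
Proof.
rewrite /eqm {1}(divn_eq a n) addnC exprD -{2}['X^(a %% n)]mulr1 -mulrBr dvdp_mull //.
by rewrite mulnC exprM subrX1 dvdp_mulr.
Qed.

Lemma eqm_XD (x y : 'Z_n) : eqm ('X^x * 'X^y) 'X^((x + y)%R : 'Z_n).
Proof. by rewrite -exprD (ZpD n1); apply: eqm_Xmod. Qed.

Definition allX : {poly K} := \sum_(g : 'Z_n) 'X^g.

Lemma eqm_mulJ S : eqm (msk S * allX) (#|S|%:R * allX).
Proof.
rewrite /msk big_distrl /= mulr_natl -sumr_const; apply: eqm_sum => s _.
rewrite [X in eqm _ X](reindex_inj (addrI s)) big_distrr.
by apply: eqm_sum => g _; apply: eqm_XD.
Qed.

Lemma eqm_powJ S k : eqm (msk S ^+ k * allX) ((#|S| ^ k)%N%:R * allX).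
Proof.
elim: k => [|k IH]; first by rewrite !expr0 expn0 eqm_refl.
rewrite exprS -mulrA; apply: eqm_trans (eqm_mul _ IH) _.
rewrite mulrCA expnS mulnC natrM -mulrA; apply: eqm_mul; exact: eqm_mulJ.
Qed.

Lemma msk_frob S : msk S ^+ r = \sum_(s in S) 'X^(s * r).
Proof.
have ch : r \in [pchar {poly K}] by rewrite pchar_poly; apply: pchar_Fp.
rewrite -(pFrobenius_autE ch) rmorph_sum; apply: eq_bigr => s _ /=.
by rewrite pFrobenius_autE -exprM.
Qed.

Definition tiling S T :=
  forall g, exists! st : 'Z_n * 'Z_n, [/\ st.1 \in S, st.2 \in T & st.1 + st.2 = g].

Lemma eqm_tiling S T : tiling S T -> eqm (msk S * msk T) allX.
Proof.
move=> /tile_inj[inj im].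
have -> : allX = \sum_(u in setX S T) 'X^((u.1 + u.2)%R : 'Z_n).
  rewrite -(big_imset (fun g : 'Z_n => 'X^g) inj) /= im.
  by apply: eq_bigl => x; rewrite inE.
rewrite /msk big_distrlr /= pair_big /=.
rewrite [X in eqm _ X](eq_bigl (fun u => (u.1 \in S) && (u.2 \in T))); last first.
  by move=> [s t]; rewrite inE.
by apply: eqm_sum => u _; apply: eqm_XD.
Qed.

(* Frobenius in characteristic r turns S(X)^r T(X) into S(X^r) T(X); modulo X^n - 1
   it is also #|S|^(r-1) (1 + X + ... + X^(n-1)), which has no zero coefficient. *)
Lemma tijdeman_surj S T : tiling S T -> ~~ (r %| #|S|)%N ->
  forall g, exists s t, [/\ s \in S, t \in T & s *+ r + t = g].
Proof.
move=> tST ndv g.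
have r0 := prime_gt0 r_pr.
have h1 : eqm (msk S ^+ r * msk T) ((#|S| ^ r.-1)%N%:R * allX).
  have -> : msk S ^+ r = msk S ^+ r.-1 * msk S by rewrite -exprSr; congr (_ ^+ _); rewrite (prednK r0).
  rewrite -mulrA.
  exact: eqm_trans (eqm_mul _ (eqm_tiling tST)) (eqm_powJ _ _).
have h2 : eqm (msk S ^+ r * msk T) (\sum_(u in setX S T) 'X^((u.1 *+ r + u.2)%R : 'Z_n)).
  rewrite msk_frob /msk big_distrlr /= pair_big /=.
  rewrite [X in eqm _ X](eq_bigl (fun u => (u.1 \in S) && (u.2 \in T))); last first.
    by move=> [s t]; rewrite inE.
  apply: eqm_sum => u _; rewrite -exprD; apply: eqm_trans (eqm_Xmod _) _.
  suff -> : ((u.1 * r + u.2) %% n = (u.1 *+ r + u.2 : 'Z_n)%R)%N by apply: eqm_refl.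
  have e : (u.1 *+ r : 'Z_n)%R = (u.1 * r %% n)%N :> nat.
    by rewrite Zp_mulrn; congr (_ %% _)%N; apply: Zp_cast.
  by rewrite (ZpD n1) e modnDml.
(* Both terms have degree below n, so divisibility by X^n - 1 forces Q = 0 and coefficients can be
   compared. *)
pose Q := \sum_(u in setX S T) 'X^((u.1 *+ r + u.2)%R : 'Z_n) - (#|S| ^ r.-1)%N%:R * allX.
have dQ : D %| Q.
  have -> : Q = (msk S ^+ r * msk T - (#|S| ^ r.-1)%N%:R * allX) -
    (msk S ^+ r * msk T - \sum_(u in setX S T) 'X^((u.1 *+ r + u.2)%R : 'Z_n)).
    by rewrite /Q; ring.
  by rewrite dvdp_sub.
have sX (x : 'Z_n) : (size ('X^x : {poly K}) <= n)%N by rewrite size_polyXn Zp_lt.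
have sQ : (size Q <= n)%N.
  apply: leq_trans (size_polyD _ _) _; rewrite size_polyN geq_max; apply/andP; split.
    by apply: leq_trans (size_sum _ _ _) _; apply/bigmax_leqP => u _.
  rewrite mulr_natl; apply/leq_sizeP => j nj; rewrite coefMn nth_default ?mul0rn //.
  by apply: leq_trans nj; apply: leq_trans (size_sum _ _ _) _; apply/bigmax_leqP => u _.
have Q0 : Q = 0.
  apply/eqP; apply: contraT => nz; have := dvdp_leq nz dQ.
  by rewrite size_XnsubC ?(ltnW n1) // => h; have := leq_trans h sQ; rewrite ltnn.
have J : allX`_g = 1.
  rewrite coef_sum (bigD1 g) //= coefXn eqxx big1 ?addr0 // => x xg.
  by rewrite coefXn; case: eqP => // e; case/eqP: xg; apply: ord_inj.
have := congr1 (fun P : {poly K} => P`_g) Q0.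
rewrite /Q coefB coef0 => /eqP; rewrite subr_eq0 coef_sum mulr_natl coefMn J.
have [/existsP[u /and3P[u1 u2 /eqP e]]|no] :=
  boolP [exists u : 'Z_n * 'Z_n, [&& u.1 \in S, u.2 \in T & u.1 *+ r + u.2 == g]].
  by move=> _; exists u.1, u.2.
rewrite big1 => [|u]; last first.
  rewrite inE => /andP[u1 u2]; rewrite coefXn; case: eqP => // e.
  case/negP: no; apply/existsP; exists u; rewrite u1 u2 /=.
  by apply/eqP/val_inj.
have ch : r \in [pchar K] by apply: pchar_Fp.
by rewrite eq_sym -(dvdn_pcharf ch) Euclid_dvdX // (negbTE ndv).
Qed.

Lemma chrM l (s : 'Z_n) k : chr (l *+ k) s = chr l (s *+ k).
Proof.
elim: k => [|k IH]; first by rewrite !mulr0n chr0 chrC chr0.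
by rewrite !mulrS (chrD n1) -IH !(chrC _ s) (chrD n1) (chrC s l).
Qed.

(** By counting, the surjection (s, t) to r s + t is a bijection, so the character sum over the
    group factors; the transform of r S at l is that of S at r l. *)
Lemma tijdeman_hat S T : tiling S T -> ~~ (r %| #|S|)%N ->
  forall l, l != 0 -> hat S (l *+ r) * hat T l = 0.
Proof.
move=> tST ndv l l0; have [card _] := tile_hat n1 tST.
have im : (fun u : 'Z_n * 'Z_n => u.1 *+ r + u.2) @: setX S T = [set: 'Z_n].
  apply/setP => g; rewrite inE; have [s [t [sS tT <-]]] := tijdeman_surj tST ndv g.
  by apply/imsetP; exists (s, t); rewrite // inE sS tT.
have inj : {in setX S T &, injective (fun u : 'Z_n * 'Z_n => u.1 *+ r + u.2)}.
  by apply/imset_injP; rewrite im cardsT cardsX card card_ord (Zp_cast n1).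
have := chr_sum n1 l; rewrite (negbTE l0) => <-.
transitivity (\sum_(u in setX S T) chr l (u.1 *+ r + u.2)).
  rewrite big_distrl sum_setX /=; apply: eq_bigr => s _; rewrite big_distrr /=.
  by apply: eq_bigr => t _; rewrite chrM -(chrD n1).
rewrite -(big_imset (chr l) inj) /= im.
by apply: eq_bigl => x; rewrite inE.
Qed.

End Tijdeman.

Lemma gcdn_mul_coprime k m n : coprime m n -> gcdn k (m * n) = gcdn k m * gcdn k n.
Proof.
move=> mn; apply/eqP; rewrite eqn_dvd; apply/andP; split.
  have gk := dvdn_gcdl k (m * n).
  by rewrite muln_gcdl !muln_gcdr !dvdn_gcd dvdn_gcdr ?(dvdn_mulr _ gk) ?(dvdn_mull _ gk).
rewrite dvdn_gcd dvdn_mul ?dvdn_gcdr // Gauss_dvd ?dvdn_gcdl //.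
apply: coprime_dvdl (dvdn_gcdr k m) _; apply: coprime_dvdr (dvdn_gcdr k n) mn.
Qed.

Lemma gcdn_pfactor p e x y : prime p ->
  (forall i, i <= e -> (p ^ i %| x) = (p ^ i %| y)) -> gcdn x (p ^ e) = gcdn y (p ^ e).
Proof.
move=> p_pr h; have half u v : (forall i, i <= e -> (p ^ i %| u) = (p ^ i %| v)) ->
    gcdn u (p ^ e) %| gcdn v (p ^ e).
  move=> uv; have [i ie gE] : exists2 i, i <= e & gcdn u (p ^ e) = p ^ i.
    by apply/dvdn_pfactor; rewrite ?dvdn_gcdr.
  by rewrite dvdn_gcd dvdn_gcdr andbT gE -uv // -gE dvdn_gcdl.
by apply/eqP; rewrite eqn_dvd !half // => i ie; rewrite h.
Qed.

(** * The group Z_(p^2 q^2 r) *)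

Section Digits.
Variable m : nat.
Hypothesis m0 : 0 < m.

Definition digits (x : nat) : 'I_m * 'I_m :=
  (Ordinal (ltn_pmod x m0), Ordinal (ltn_pmod (x %/ m) m0)).

Lemma eqv_digits a x y : a <= 2 -> eqv a (digits x) (digits y) = (x == y %[mod m ^ a]).
Proof.
case: a => [|[|[|a]]] //= _; rewrite ?modn1 ?eqxx //.
rewrite xpair_eqE -!(inj_eq val_inj) /= !modn_divl -mulnn.
apply/andP/eqP => [[/eqP e1 /eqP e2]|e].
  rewrite (divn_eq (x %% (m * m)) m) (divn_eq (y %% (m * m)) m) e2.
  by rewrite !(modn_dvdm _ (dvdn_mulr m (dvdnn m))) e1.
by rewrite e -(modn_dvdm x (dvdn_mulr m (dvdnn m))) -(modn_dvdm y (dvdn_mulr m (dvdnn m))) e.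
Qed.

End Digits.

Section Coordinates.
Variables p q r : nat.
Hypotheses (p_pr : prime p) (q_pr : prime q) (r_pr : prime r).
Hypotheses (pq : p != q) (qr : q != r) (pr : p != r).

Notation N := (p ^ 2 * q ^ 2 * r).
Notation X5 := ((('I_p * 'I_p) * ('I_q * 'I_q)) * 'I_r)%type.

Let p0 : 0 < p := prime_gt0 p_pr.
Let q0 : 0 < q := prime_gt0 q_pr.
Let r0 : 0 < r := prime_gt0 r_pr.

Lemma N_gt1 : 1 < N.
Proof.
have p1 := prime_gt1 p_pr; have r1 := prime_gt1 r_pr.
apply: leq_trans r1 _; rewrite -{1}[r]mul1n leq_pmul2r // muln_gt0 !expn_gt0 p0 q0 //.
Qed.
Let N1 := N_gt1.

Definition coord (x : 'Z_N) : X5 :=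
  (digits p0 x, digits q0 x, Ordinal (ltn_pmod x r0)).

Lemma cop_pq i j : coprime (p ^ i) (q ^ j).
Proof. by apply: coprimeXl; apply: coprimeXr; rewrite prime_coprime // dvdn_prime2. Qed.
Lemma cop_pr i j : coprime (p ^ i) (r ^ j).
Proof. by apply: coprimeXl; apply: coprimeXr; rewrite prime_coprime // dvdn_prime2. Qed.
Lemma cop_qr i j : coprime (q ^ i) (r ^ j).
Proof. by apply: coprimeXl; apply: coprimeXr; rewrite prime_coprime // dvdn_prime2. Qed.
Lemma cop_pqr i j k : coprime (p ^ i * q ^ j) (r ^ k).
Proof. by rewrite coprimeMl cop_pr cop_qr. Qed.

Lemma coord_inj : injective coord.
Proof.
move=> x y [e1 e2 e3 e4 e5].
have ep : x = y %[mod p ^ 2].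
  apply/eqP; rewrite -(eqv_digits p0) //=; apply/eqP.
  by congr pair; apply: val_inj.
have eq' : x = y %[mod q ^ 2].
  apply/eqP; rewrite -(eqv_digits q0) //=; apply/eqP.
  by congr pair; apply: val_inj.
apply/val_inj => /=; rewrite -(modn_small (Zp_lt N1 x)) -(modn_small (Zp_lt N1 y)).
apply/eqP; rewrite chinese_remainder; last by have := cop_pqr 2 2 1; rewrite expn1.
by rewrite e5 eqxx andbT chinese_remainder ?cop_pq // ep eq' !eqxx.
Qed.

Lemma coord_card : #|{: X5}| = #|{: 'Z_N}|.
Proof. by rewrite !card_prod !card_ord (Zp_cast N1) -!mulnn. Qed.

Lemma coord_bij : bijective coord.
Proof. by apply: inj_card_bij coord_inj _; rewrite coord_card. Qed.

Lemma mod_Zp_sub d (x y : 'Z_N) : d %| N -> (d %| (x - y)%R) = (x == y %[mod d]).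
Proof.
move=> dN; have E (u v : 'Z_N) : ((u + v)%R : 'Z_N) = (u + v)%N %[mod d].
  by rewrite (ZpD N1) modn_dvdm.
have e : x = (x - y)%R + y %[mod d] by rewrite -E subrK.
by rewrite e -[X in _ == X %[mod d]]add0n eqn_modDr mod0n.
Qed.

Lemma dvdN a b c : a <= 2 -> b <= 2 -> c <= 1 -> p ^ a * q ^ b * r ^ c %| N.
Proof.
by move=> a2 b2 c1; rewrite -{2}[r]expn1 !dvdn_mul // dvdn_exp2l.
Qed.

Lemma dvdN_p a : a <= 2 -> p ^ a %| N.
Proof. by move=> a2; have := @dvdN a 0 0 a2 isT isT; rewrite !muln1. Qed.
Lemma dvdN_q a : a <= 2 -> q ^ a %| N.
Proof. by move=> a2; have := @dvdN 0 a 0 isT a2 isT; rewrite muln1 mul1n. Qed.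
Lemma dvdN_r c : c <= 1 -> r ^ c %| N.
Proof. by move=> a2; have := @dvdN 0 0 c isT isT a2; rewrite !mul1n. Qed.

Lemma eqv_p a (x y : 'Z_N) : a <= 2 -> eqv a (coord x).1.1 (coord y).1.1 = (p ^ a %| (x - y)%R).
Proof. by move=> a2; rewrite mod_Zp_sub ?dvdN_p // -(eqv_digits p0). Qed.
Lemma eqv_q a (x y : 'Z_N) : a <= 2 -> eqv a (coord x).1.2 (coord y).1.2 = (q ^ a %| (x - y)%R).
Proof. by move=> a2; rewrite mod_Zp_sub ?dvdN_q // -(eqv_digits q0). Qed.
Lemma eqv_r (x y : 'Z_N) : ((coord x).2 == (coord y).2) = (r %| (x - y)%R).
Proof. by rewrite mod_Zp_sub ?(dvdN_r (c := 1)) // -{1}[r]expn1 ?(dvdN_r (c := 1)). Qed.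

(** l has order p^a q^b r^c, expressed in coordinates to match the types of differences. *)
Definition has_type a b (c : bool) (l : 'Z_N) : bool :=
  [&& ty (coord l).1.1 (coord 0%R).1.1 == a, ty (coord l).1.2 (coord 0%R).1.2 == b &
      ((coord l).2 != (coord 0%R).2) == c].

Lemma ty_eqv (A : finType) (x y x' y' : A * A) :
  (forall a, a <= 2 -> eqv a x y = eqv a x' y') -> ty x y = ty x' y'.
Proof.
move=> h; have /= h2 := h 2 isT; have /= h1 := h 1 isT.
by rewrite /ty h2 h1.
Qed.

Lemma has_type_sub (x y : 'Z_N) :
  has_type (ty (coord x).1.1 (coord y).1.1) (ty (coord x).1.2 (coord y).1.2)
    ((coord x).2 != (coord y).2) (x - y)%R.
Proof.
rewrite /has_type; apply/and3P; split.
- by apply/eqP/ty_eqv => a a2; rewrite !eqv_p // subr0.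
- by apply/eqP/ty_eqv => a a2; rewrite !eqv_q // subr0.
- by rewrite !eqv_r subr0.
Qed.

Lemma eqv_of_ty (A : finType) (x y x' y' : A * A) a :
  a <= 2 -> ty x y = ty x' y' -> eqv a x y = eqv a x' y'.
Proof. by move=> a2 e; rewrite !eqv_ty // e. Qed.

Lemma type_gcd a b c l l' : has_type a b c l -> has_type a b c l' -> gcdn l N = gcdn l' N.
Proof.
case/and3P=> /eqP ep /eqP eq' /eqP er /and3P[/eqP ep' /eqP eq'' /eqP er'].
have cr : coprime (p ^ 2 * q ^ 2) r by have := cop_pqr 2 2 1; rewrite expn1.
rewrite !(gcdn_mul_coprime _ cr) !(gcdn_mul_coprime _ (cop_pq 2 2)).
congr (_ * _ * _).
- apply: gcdn_pfactor => // i i2; have := eqv_of_ty i2 (etrans ep (esym ep')).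
  by rewrite !eqv_p // !subr0.
- apply: gcdn_pfactor => // i i2; have := eqv_of_ty i2 (etrans eq' (esym eq'')).
  by rewrite !eqv_q // !subr0.
- have := @gcdn_pfactor r 1 l l' r_pr; rewrite !expn1; apply=> -[|[|//]] // _; rewrite ?expn0 ?dvd1n // expn1.
  have := etrans er (esym er'); rewrite !eqv_r !subr0.
  by case: (_ %| _); case: (_ %| _).
Qed.

(** omega^l and omega^l' are primitive roots of unity of the same order, so a field morphism raising
    such roots to a power prime to the order carries one sum to the other. *)
Lemma hat_conj S a b c l l' : has_type a b c l -> has_type a b c l' ->
  hat S l = 0%R -> hat S l' = 0%R.
Proof.
move=> hl hl' h0.
have om := omega_prim N1.
have w := exp_prim_root om l; have w' := exp_prim_root om l'.
rewrite -(type_gcd hl hl') in w'.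
have [i wi] := prim_rootP w (prim_expr_order w').
have cop : coprime i (N %/ gcdn l N) by rewrite -(prim_root_exp_coprime i w) -wi.
have [u uE] := Qn_aut_exists cop.
have : u (hat S l) = hat S l'.
  rewrite rmorph_sum; apply: eq_bigr => s _ /=.
  by rewrite /chr !exprM rmorphXn /= uE ?wi // (prim_expr_order w).
by rewrite h0 rmorph0.
Qed.

Lemma exists_type a b c : a <= 2 -> b <= 2 -> exists l, has_type a b c l.
Proof.
move=> a2 b2; have [g gK Kg] := coord_bij.
have pick (A : finType) (x : A * A) (A1 : 1 < #|A|) e : e <= 2 -> exists y, ty y x = e.
  have [t tx] := other_elt x.1 A1; have [t' tx'] := other_elt x.2 A1.
  case: e => [|[|[|//]]] _.
  - by exists x; apply/eqP; rewrite ty0.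
  - exists (x.1, t'); apply: ty1 => //; case: (x) tx' => x1 x2 /= ne.
    by rewrite xpair_eqE (negbTE ne) andbF.
  - by exists (t, t'); apply: ty2.
have [y ey] := pick _ (coord 0%R).1.1 (eq_ind_r (fun k => 1 < k) (prime_gt1 p_pr) (card_ord p)) a a2.
have [z ez] := pick _ (coord 0%R).1.2 (eq_ind_r (fun k => 1 < k) (prime_gt1 q_pr) (card_ord q)) b b2.
have [t tne] := other_elt (coord 0%R).2 (eq_ind_r (fun k => 1 < k) (prime_gt1 r_pr) (card_ord r)).
exists (g (y, z, if c then t else (coord 0%R).2)); rewrite /has_type Kg /= ey ez !eqxx /=.
by case: c; rewrite ?tne ?eqxx.
Qed.


(** * Ramanujan sums in coordinates *)

Section Ramanujan.
Local Open Scope ring_scope.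

Lemma sum_mult (D d : nat) (y : 'Z_N) : (D * d = N)%N ->
  \sum_(l : 'Z_N | (D %| l)%N) chr l y = if (d %| y)%N then d%:R else 0.
Proof.
move=> Dd; have om := omega_prim N1; have N0 := ltnW N1.
have D0 : (0 < D)%N by move: N0; rewrite -Dd muln_gt0 => /andP[].
pose h (i : 'I_d) : 'Z_N := inZp (D * i).
have hE i : h i = (D * i)%N :> nat.
  rewrite /h /= modn_small // [X in (_ < X)%N](Zp_cast N1) -Dd ltn_pmul2l //.
have h_inj : {in [set: 'I_d] &, injective h}.
  move=> i j _ _ e; have := hE i; rewrite e hE => /eqP; rewrite eqn_pmul2l // => /eqP e'.
  exact/val_inj/esym.
have im : [set l : 'Z_N | (D %| l)%N] = h @: [set: 'I_d].
  apply/setP => l; rewrite inE; apply/idP/imsetP => [/dvdnP[k lk]|[i _ ->]]; last by rewrite hE dvdn_mulr.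
  have kd : (k < d)%N by rewrite -(ltn_pmul2l D0) Dd mulnC -lk Zp_lt.
  have e : l = h (Ordinal kd) :> nat by rewrite hE lk; apply: mulnC.
  by exists (Ordinal kd) => //; apply/val_inj.
transitivity (\sum_(l in [set l : 'Z_N | (D %| l)%N]) chr l y).
  by apply: eq_bigl => l; rewrite inE.
rewrite im big_imset //=.
transitivity (\sum_(i < d) (omega N ^+ (D * y)) ^+ i).
  apply: eq_big => [i|i _]; first by rewrite inE.
  by rewrite /chr hE -exprM; congr (_ ^+ _); apply: mulnAC.
rewrite sum_unity; last by rewrite -exprM (mulnAC D y d) Dd exprM (prim_expr_order om) expr1n.
by rewrite -(prim_order_dvd om) -{1}Dd dvdn_pmul2l.
Qed.

(** The complementary exponents appear because p^(2-a) divides l exactly when the p-part of the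
    order of l divides p^a. *)
Lemma sum_mult3 a b c (y : 'Z_N) : (a <= 2)%N -> (b <= 2)%N -> (c <= 1)%N ->
  \sum_(l : 'Z_N) (p ^ (2 - a) %| l)%N%:R * (q ^ (2 - b) %| l)%N%:R * (r ^ (1 - c) %| l)%N%:R * chr l y =
  (p ^ a * (p ^ a %| y))%N%:R * (q ^ b * (q ^ b %| y))%N%:R * (r ^ c * (r ^ c %| y))%N%:R.
Proof.
move=> a2 b2 c1.
have dv i j k (z : nat) : (p ^ i %| z)%N && (q ^ j %| z)%N && (r ^ k %| z)%N = (p ^ i * q ^ j * r ^ k %| z)%N.
  by rewrite !Gauss_dvd ?cop_pqr ?cop_pq.
transitivity (\sum_(l : 'Z_N | (p ^ (2 - a) * q ^ (2 - b) * r ^ (1 - c) %| l)%N) chr l y).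
  rewrite [RHS]big_mkcond; apply: eq_bigr => l _; rewrite -dv.
  by do 3!case: (_ %| _)%N; rewrite ?(mul1r, mul0r, mulr0).
rewrite (@sum_mult _ (p ^ a * q ^ b * r ^ c)%N); last first.
  by rewrite mulnACA (mulnACA (p ^ _)%N) -!expnD !subnK // expn1.
rewrite -dv -!natrM.
by do 3!case: (_ %| _)%N; rewrite ?(muln1, muln0, mul0n).
Qed.

Lemma expand8 (I : finType) (e e' f f' g g' h : I -> algC) (u v w : algC) :
  \sum_i (e i - u * e' i) * (f i - v * f' i) * (g i - w * g' i) * h i =
  \sum_i e i * f i * g i * h i - w * (\sum_i e i * f i * g' i * h i)
  - v * (\sum_i e i * f' i * g i * h i) + v * w * (\sum_i e i * f' i * g' i * h i)
  - u * (\sum_i e' i * f i * g i * h i) + u * w * (\sum_i e' i * f i * g' i * h i)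
  + u * v * (\sum_i e' i * f' i * g i * h i) - u * v * w * (\sum_i e' i * f' i * g' i * h i).
Proof.
rewrite !mulr_sumr -!sumrN -!big_split /=; apply: eq_bigr => i _; ring.
Qed.

(** Order exactly p^a is order dividing p^a but not p^(a-1); the factor 0 < a removes the second
    term at a = 0, where [a.-1] is again 0. *)
Lemma ty_indicator (A : finType) (x y : A * A) a : (a <= 2)%N ->
  (ty x y == a)%:R = (eqv (2 - a) x y)%:R - (0 < a)%N%:R * (eqv (2 - a.-1) x y)%:R :> algC.
Proof.
move=> a2; rewrite !eqv_ty; try by case: a a2 => [|[|[|]]].
have := ty_le2 x y; case: (ty x y) => [|[|[|//]]] _; case: a a2 => [|[|[|//]]] _ /=;
  by rewrite ?mul0r ?mul1r ?mulr0 ?subr0 ?subrr.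
Qed.

Lemma kap_alg (m : nat) (x y : 'I_m * 'I_m) a : (a <= 2)%N ->
  (kap a x y)%:~R = (m ^ a * eqv a x y)%N%:R - (0 < a)%N%:R * (m ^ a.-1 * eqv a.-1 x y)%N%:R :> algC.
Proof.
case: a => [|a] _; first by rewrite /= mul0r subr0 muln1.
rewrite /kap card_ord mul1r rmorphM rmorphB rmorphM /= !natrM expnS natrM.
rewrite -!pmulrn; ring.
Qed.

Lemma kapr_alg (i j : 'I_r) (c : bool) :
  (kapr c i j)%:~R = (r ^ c * ((r ^ c == 1)%N || (i == j)))%N%:R - c%:R :> algC.
Proof.
case: c; last by rewrite /kapr /= subr0 expn0 muln1.
rewrite /kapr card_ord expn1 rmorphB rmorphM /= natrM -!pmulrn.
by rewrite (gtn_eqF (prime_gt1 r_pr)).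
Qed.

(** Writing the three exact-order conditions as differences of divisibility conditions gives eight
    sums over subgroups, which reassemble into the product kernel. *)
Lemma ramanujan a b (c : bool) (x s : 'Z_N) : (a <= 2)%N -> (b <= 2)%N ->
  \sum_(l | has_type a b c l) chr l (s - x) = (ker5 a b c (coord x) (coord s))%:~R.
Proof.
move=> a2 b2; have a2' : (a.-1 <= 2)%N by case: a a2 => // a; apply: ltnW.
have b2' : (b.-1 <= 2)%N by case: b b2 => // b; apply: ltnW.
transitivity (\sum_(l : 'Z_N)
  ((p ^ (2 - a) %| l)%N%:R - (0 < a)%N%:R * (p ^ (2 - a.-1) %| l)%N%:R) *
  ((q ^ (2 - b) %| l)%N%:R - (0 < b)%N%:R * (q ^ (2 - b.-1) %| l)%N%:R) *
  ((r ^ (1 - c) %| l)%N%:R - c%:R * (r ^ (1 - 0) %| l)%N%:R) * chr l (s - x)).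
  rewrite big_mkcond; apply: eq_bigr => l _.
  have E1 := ty_indicator (coord l).1.1 (coord 0).1.1 a2.
  have E2 := ty_indicator (coord l).1.2 (coord 0).1.2 b2.
  rewrite !eqv_p ?leq_subr // subr0 in E1; rewrite !eqv_q ?leq_subr // subr0 in E2.
  rewrite -E1 -E2 /has_type eqv_r subr0.
  have -> : (r ^ (1 - c) %| l)%N%:R - c%:R * (r ^ (1 - 0) %| l)%N%:R = (~~ (r %| l)%N == c)%:R :> algC.
    case: c => /=; rewrite ?expn0 ?expn1 ?dvd1n; case: (r %| l)%N;
      by rewrite ?mul0r ?mul1r ?subr0 ?subrr.
  by do 3!case: (_ == _); rewrite ?(mul1r, mul0r, mulr0).
have c1 : (c <= 1)%N by case: c.
rewrite expand8 !sum_mult3 // /ker5 !rmorphM /= !kap_alg // kapr_alg.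
rewrite ![eqv _ (coord x).1.1 _]eqv_sym ![eqv _ (coord x).1.2 _]eqv_sym !eqv_p // !eqv_q //.
rewrite [(coord x).2 == _]eq_sym eqv_r !expn0 mul1n dvd1n.
have -> : (r ^ c == 1)%N || (r %| (s - x)%R)%N = (r ^ c %| (s - x)%R)%N.
  by case: c {c1}; rewrite ?expn0 ?dvd1n // expn1 (gtn_eqF (prime_gt1 r_pr)).
rewrite -[1%N%:R]/(1 : algC); ring.
Qed.

(** The kernel sum at x is the part of the Fourier series of S carried by the characters of this
    type. It is zero if one coefficient is, by [hat_conj]; Fourier inversion recovers the
    coefficients from it. *)
Lemma hat_zer5 S a b c l : (a <= 2)%N -> (b <= 2)%N -> has_type a b c l ->
  hat S l = 0 <-> zer5 [set coord x | x in S] a b c.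
Proof.
move=> a2 b2 hl; have [g gK Kg] := coord_bij.
have zE x : \sum_(y in [set coord z | z in S]) ker5 a b c (coord x) y = \sum_(s in S) ker5 a b c (coord x) (coord s).
  by rewrite big_imset //=; apply: in2W; apply: coord_inj.
have RE x : (\sum_(s in S) ker5 a b c (coord x) (coord s))%:~R =
    \sum_(l | has_type a b c l) chr l (- x) * hat S l.
  rewrite rmorph_sum /=; under eq_bigr => s _ do rewrite -ramanujan //.
  rewrite exchange_big /=; apply: eq_bigr => l' _; rewrite /hat mulr_sumr.
  by apply: eq_bigr => s _; rewrite (chrD N1) mulrC.
split=> [h0 x|z].
  rewrite -[x]Kg zE; apply/eqP; rewrite -(intr_eq0 algC) RE big1 // => l' hl'.
  by rewrite (hat_conj hl hl' h0) mulr0.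
have Nn0 : (N%:R : algC) != 0 by rewrite pnatr_eq0 -lt0n ltnW // N1.
apply: (mulfI Nn0); rewrite mulr0.
transitivity (\sum_x chr l x * (\sum_(l | has_type a b c l) chr l (- x) * hat S l)).
  under [RHS]eq_bigr => x _ do rewrite mulr_sumr.
  rewrite exchange_big /= (bigD1 l) //= [X in _ = _ + X]big1 ?addr0.
    transitivity (\sum_(x : 'Z_N) hat S l).
      by rewrite sumr_const card_ord (Zp_cast N1) mulr_natl.
    by apply: eq_bigr => x _; rewrite mulrA -(chrD N1) subrr chr0 mul1r.
  move=> l' /andP[_ ne]; transitivity ((\sum_x chr (l - l') x) * hat S l').
    rewrite mulr_suml; apply: eq_bigr => x _.
    by rewrite (chrN N1) !(chrC _ x) (chrD N1) (chrN N1) mulrA.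
  by rewrite (chr_sum N1) subr_eq0 eq_sym (negbTE ne) mul0r.
rewrite big1 // => x _; rewrite -RE -zE z mulr0 //.
Qed.

End Ramanujan.

(** * Spectral sets, tiles and the Coven-Meyerowitz conditions *)

Section Equivalence.
Local Open Scope ring_scope.
Implicit Types (S T L : {set 'Z_N}).

Lemma card_coord S : #|[set coord x | x in S]| = #|S|.
Proof. by apply: card_imset; apply: coord_inj. Qed.

Lemma type_exists (l : 'Z_N) : exists a b c, [/\ has_type a b c l, (a <= 2)%N, (b <= 2)%N & (l != 0 -> (0 < a + b)%N || c)].
Proof.
exists (ty (coord l).1.1 (coord 0).1.1), (ty (coord l).1.2 (coord 0).1.2), ((coord l).2 != (coord 0).2).
split; rewrite ?ty_le2 //; first by rewrite /has_type !eqxx.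
apply: contraR; rewrite negb_or negbK -leqNgt leqn0 addn_eq0 !ty0 => /andP[/andP[/eqP e1 /eqP e2] /eqP e3].
by apply/eqP/coord_inj; case: (coord l) (coord 0) e1 e2 e3 => [[? ?] ?] [[? ?] ?] /= -> -> ->.
Qed.

Definition coord_preim (U : {set X5}) : {set 'Z_N} := [set x | coord x \in U].

Lemma in_coord_preim U x : (x \in coord_preim U) = (coord x \in U).
Proof. by rewrite inE. Qed.

Lemma coord_coord_preim U : [set coord x | x in coord_preim U] = U.
Proof.
have [g gK Kg] := coord_bij; apply/setP => y; apply/imsetP/idP => [[x + ->]|yU].
  by rewrite inE.
by exists (g y); rewrite ?inE Kg.
Qed.

Lemma card_coord_preim U : #|coord_preim U| = #|U|.
Proof. by rewrite -card_coord coord_coord_preim. Qed.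

Lemma has_type_neq0 a b c l : has_type a b c l -> (0 < a + b)%N || c -> l != 0.
Proof.
case/and3P=> /eqP<- /eqP<- /eqP<-; apply: contraTneq => ->.
by rewrite /ty !eqxx.
Qed.

Lemma CM5_tile S : CM5 [set coord x | x in S] -> tile S.
Proof.
case=> P1 [P2 [Q1 [Q2 [R1 [card h]]]]]; rewrite card_coord !card_ord in card.
pose U := box5 (Ordinal p0) (Ordinal q0) (Ordinal r0) P1 P2 Q1 Q2 R1.
apply: (hat_tile N1 (T := coord_preim U)).
  rewrite card card_coord_preim card_box5 !card_ord mulnACA (mulnACA (p ^ _)%N) -!expnD.
  by case: (P1); case: (P2); case: (Q1); case: (Q2); case: (R1); rewrite ?expn1.
move=> l l0; have [a [b [c [hl a2 b2 abc]]]] := type_exists l.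
have [/and3P[sa sb sc]|n] := boolP [&& sel P1 P2 a, sel Q1 Q2 b & c ==> R1].
  left; apply/(hat_zer5 _ a2 b2 hl); apply: h => //; first exact: abc.
  by apply/implyP.
by right; apply/(hat_zer5 _ a2 b2 hl); rewrite coord_coord_preim; apply: zer_box5.
Qed.

Lemma CM5_spectral S : S != set0 -> CM5 [set coord x | x in S] -> spectral S.
Proof.
move=> S0 [P1 [P2 [Q1 [Q2 [R1 [card h]]]]]]; split=> //.
rewrite card_coord !card_ord in card.
pose U := box5 (Ordinal p0) (Ordinal q0) (Ordinal r0) (~~ P2) (~~ P1) (~~ Q2) (~~ Q1) (~~ R1).
exists (coord_preim U); apply: (orth_basis N1); first by rewrite card_gt0.
  move=> l l'; rewrite !in_coord_preim => lU l'U ne.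
  have [s1 s2 s3] := typed_box5 lU l'U; rewrite !negbK in s1 s2 s3.
  apply/(hat_zer5 _ _ _ (has_type_sub l l')); rewrite ?ty_le2 //.
  apply: h; rewrite ?ty_le2 //.
  have : l - l' != 0 by rewrite subr_eq0.
  apply: contraR; rewrite negb_or negbK -leqNgt leqn0 addn_eq0 !ty0 => /andP[/andP[/eqP e1 /eqP e2] /eqP e3].
  rewrite subr_eq0; apply/eqP/coord_inj.
  by case: (coord l) (coord l') e1 e2 e3 => [[? ?] ?] [[? ?] ?] /= -> -> ->.
rewrite card_coord_preim card_box5 !card_ord card !negbK.
by rewrite (addnC P2) (addnC Q2).
Qed.

Lemma spectral_CM S : (p ^ 2 * q ^ 2 < r)%N -> spectral S -> CM5 [set coord x | x in S].
Proof.
move=> lt [S0 [L basis]]; have S0' : (0 < #|S|)%N by rewrite card_gt0.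
have [card orth] := orth_basis_card N1 S0' basis.
have dual := dual_orth N1 S0' orth card.
apply: (@spectral_CM5 _ _ _ _ _ _ _ _ [set coord x | x in L]); rewrite ?card_ord //.
split; rewrite ?card_coord ?card //.
  move=> _ _ /imsetP[l lL ->] /imsetP[l' l'L ->]; rewrite (inj_eq coord_inj) => ne.
  by apply/(hat_zer5 _ _ _ (has_type_sub l l')); rewrite ?ty_le2 //; apply: orth.
move=> _ _ /imsetP[l lL ->] /imsetP[l' l'L ->]; rewrite (inj_eq coord_inj) => ne.
by apply/(hat_zer5 _ _ _ (has_type_sub l l')); rewrite ?ty_le2 //; apply: dual.
Qed.

(** Multiplication by r kills the r-part and is invertible on the rest, r being prime to p q. *)
Lemma has_type_mulr a b l : (a <= 2)%N -> (b <= 2)%N ->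
  has_type a b true l -> has_type a b false (l *+ r).
Proof.
move=> a2 b2 /and3P[/eqP e1 /eqP e2 _].
have dv d : (d %| N)%N -> coprime d r -> (d %| (l *+ r : 'Z_N))%N = (d %| l)%N.
  move=> dN cop; have -> : (l *+ r : 'Z_N) = (l * r %% N)%N :> nat.
    by rewrite Zp_mulrn; congr (_ %% _)%N; apply: Zp_cast.
  by rewrite /dvdn modn_dvdm // -/(dvdn _ _) Gauss_dvdl.
apply/and3P; split.
- apply/eqP; rewrite -e1; apply: ty_eqv => i i2; rewrite !eqv_p // !subr0 dv ?dvdN_p //.
  by have := cop_pr i 1; rewrite expn1.
- apply/eqP; rewrite -e2; apply: ty_eqv => i i2; rewrite !eqv_q // !subr0 dv ?dvdN_q //.
  by have := cop_qr i 1; rewrite expn1.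
- rewrite eqv_r subr0 eqbF_neg negbK.
  have -> : (l *+ r : 'Z_N) = (l * r %% N)%N :> nat.
    by rewrite Zp_mulrn; congr (_ %% _)%N; apply: Zp_cast.
  by rewrite /dvdn modn_dvdm ?modnMl // dvdn_mull.
Qed.

Lemma tijdeman_zer S T a b : tiling S T -> ~~ (r %| #|S|)%N ->
  (a <= 2)%N -> (b <= 2)%N -> (0 < a + b)%N ->
  zer5 [set coord x | x in S] a b false \/ zer5 [set coord x | x in T] a b true.
Proof.
move=> tST nd a2 b2 ab; have [l hl] := exists_type true a2 b2.
have l0 : l != 0 by apply: has_type_neq0 hl _; rewrite ab.
have := tijdeman_hat N1 r_pr tST nd l0; move/eqP; rewrite mulf_eq0 => /orP[/eqP h|/eqP h].
  by left; apply/(hat_zer5 _ a2 b2 (has_type_mulr a2 b2 hl)).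
by right; apply/(hat_zer5 _ a2 b2 hl).
Qed.

Lemma tilingC S T : tiling S T -> tiling T S.
Proof.
move=> h g; have [[s t] [[/= sS tT st] U]] := h g.
exists (t, s); split; first by split=> //=; rewrite addrC.
move=> [t' s'] [/= t'T s'S e].
have [-> ->] : (s, t) = (s', t') by apply: U; split=> //=; rewrite addrC.
by [].
Qed.

Lemma tile_CM S : tile S -> CM5 [set coord x | x in S].
Proof.
case=> T tST; have [card hz] := tile_hat N1 tST.
apply: (@tile_CM5 _ _ _ _ [set coord x | x in T]); rewrite ?card_ord ?card_coord //.
- move=> a b c a2 b2 abc; have [l hl] := exists_type c a2 b2.
  have /eqP := hz l (has_type_neq0 hl abc); rewrite mulf_eq0 => /orP[/eqP h|/eqP h].
    by left; apply/(hat_zer5 _ a2 b2 hl).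
  by right; apply/(hat_zer5 _ a2 b2 hl).
- by move=> nd a b a2 b2 ab; apply: tijdeman_zer.
- by move=> nd a b a2 b2 ab; apply: tijdeman_zer => //; apply: tilingC.
Qed.

End Equivalence.
End Coordinates.

Theorem theorem1p1 (p q r : nat) :
  prime p -> prime q -> prime r -> p != q -> q != r -> p != r ->
  (p ^ 2 * q ^ 2 < r)%N ->
  (forall S : {set 'Z_(p ^ 2 * q ^ 2 * r)}, spectral S -> tile S) /\
  fuglede_group (p ^ 2 * q ^ 2 * r).
Proof.
move=> p_pr q_pr r_pr pq qr pr lt.
have st (S : {set 'Z_(p ^ 2 * q ^ 2 * r)}) : spectral S -> tile S.
  by move=> sp; apply: (CM5_tile pq qr pr); apply: (spectral_CM _ _ _ pq qr pr lt sp).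
split=> // S S0; split; first exact: st.
by move=> tS; apply: (CM5_spectral pq qr pr S0); apply: (tile_CM _ _ _ pq qr pr tS).
Qed.
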